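(* Let $R,P>0$, $S=\{|y|\le R\}\subset\mathbb{R}^2$, $\alpha\in(0,1)$, and suppose $\phi^\pm_{a,b}\in C^{3,\alpha}(\mathbb{R})$ are given for all $a,b\in\mathbb{R}$ such that: (i) $\phi^\pm_{a,b}$ depend continuously in $C^{3,\alpha}(\mathbb{R})$ on $(a,b)$; (ii) $\phi^\pm_{a,b}(x+P)=\phi^\pm_{a,b}(x)$; (iii) $\int_0^P\phi^+_{a,b}dx=\int_0^P\phi^-_{a,b}dx$; (iv) if $b<b'$ then $\phi^\pm_{a,b}(x)<\phi^\pm_{a,b'}(x)$ for all $a,x$; (v) for all $a,x$, $\phi^\pm_{a,b}(x)\to\pm\infty$ as $b\to\pm\infty$ (i.e. both $\phi^+_{a,b}(x)$ and $\phi^-_{a,b}(x)$ tend to $+\infty$ as $b\to+\infty$ and to $-\infty$ as $b\to-\infty$). Let $(u_{a,b},v_{a,b})$ be the solution associated to $\phi^\pm_{a,b}$, let $\mathbb{Z}$ act on $\mathbb{C}^3$ by $n:(z_1,z_2,z_3)\mapsto(z_1,z_2,z_3+nP)$, and define $$N_{a,b,c}=\bigl\{(z_1,z_2,z_3)\in\mathbb{C}^3:|z_1|^2-|z_2|^2=2a,\ x\in\mathbb{R},\ y\in(-R,R),\ z_1z_2=v_{a,b}(x,y)+iy,\ z_3=x+iu_{a,b}(x,y)+ic\bigr\}/\mathbb{Z}.$$ Then distinct $N_{a,b,c}$ are disjoint, and with $V=\{(z_1,z_2,z_3)\in\mathbb{C}^3:|\operatorname{Im}z_1z_2|<R\}/\mathbb{Z}$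 there exists a continuous surjective $F:V\to\mathbb{R}^3$ with $F^{-1}(a,b,c)=N_{a,b,c}$ for all $(a,b,c)\in\mathbb{R}^3$; thus $F$ is a special Lagrangian fibration of $V$.
   Context: For $a\in\mathbb{R}$ let $(\dagger_a)$ denote $\frac{\partial u}{\partial x}=\frac{\partial v}{\partial y}$, $\frac{\partial v}{\partial x}=-2(v^2+y^2+a^2)^{1/2}\frac{\partial u}{\partial y}$. Given $P$-periodic $\phi^\pm\in C^{3,\alpha}(\mathbb{R})$ with equal integrals over $[0,P]$, the associated solution $(u,v)$ is the unique pair on $S$, $P$-periodic in $x$, with $u(0,0)=0$, $v(x,\pm R)=\phi^\pm(x)$, which is a $C^{3,\alpha}$ solution of $(\dagger_a)$ if $a\ne0$ and a singular solution of $(\dagger_0)$ if $a=0$ (existence and uniqueness hold). Singular solution of $(\dagger_0)$: continuous, weakly differentiable $u,v$ whose weak derivatives satisfy $(\dagger_0)$, with $v$ a weak solution of $\partial_x[(v^2+y^2)^{-1/2}\partial_xv]+2\partial_y^2v=0$, classical and real analytic away from points $(x,0)$ with $v(x,0)=0$, and a $C^0$ limit of $C^2$ solutions of $(\dagger_b)$ as $b\to0_+$. The sets $N_{a,b,c}$ are special Lagrangian 3-folds (possibly singular when $a=0$) in $\mathbb{C}^3/\mathbb{Z}$ with respect to $\omega'=\frac i2\sum dz_j\wedge d\bar z_j$, $\Omega'=dz_1\wedge dz_2\wedge dz_3$. *)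

(* Defs.v *)
From mathcomp Require Import all_boot all_order all_algebra.
From mathcomp Require Import all_classical all_reals all_analysis.
Set Implicit Arguments. Unset Strict Implicit. Unset Printing Implicit Defensive.
Import Order.TTheory GRing.Theory Num.Theory.
Import numFieldNormedType.Exports.
Local Open Scope classical_set_scope.
Local Open Scope ring_scope.

Section Defs.
Variable R : realType.
Implicit Types (f g : R * R -> R) (p q : R * R) (Rr P al a : R).

Definition mu2 := (@lebesgue_measure R \x @lebesgue_measure R)%E.

Definition px f : R * R -> R := fun p => derive1 (fun t => f (t, p.2)) p.1.
Definition py f : R * R -> R := fun p => derive1 (fun t => f (p.1, t)) p.2.
Definition pderivable_at f p :=
  derivable (fun t => f (t, p.2)) p.1 1 /\ derivable (fun t => f (p.1, t)) p.2 1.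

Fixpoint Dseq (s : seq bool) f : R * R -> R :=
  match s with
  | [::] => f
  | b :: s' => (if b then py else px) (Dseq s' f)
  end.

Definition strip Rr : set (R * R) := [set p | `|p.2| <= Rr].
Definition ostrip Rr : set (R * R) := [set p | `|p.2| < Rr].

Definition dist2 p q := Num.sqrt ((p.1 - q.1) ^+ 2 + (p.2 - q.2) ^+ 2).

Definition Ck_strip Rr (k : nat) f :=
  {within strip Rr, continuous f} /\
  (forall s : seq bool, (size s < k)%N ->
     forall p, ostrip Rr p -> pderivable_at (Dseq s f) p) /\
  (forall s : seq bool, (size s <= k)%N ->
     exists g, {within strip Rr, continuous g} /\
       forall p, ostrip Rr p -> Dseq s f p = g p).

Definition C3a_strip Rr al f :=
  Ck_strip Rr 3 f /\
  (forall s : seq bool, (size s <= 3)%N ->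
     exists M, forall p, ostrip Rr p -> `|Dseq s f p| <= M) /\
  (forall s : seq bool, size s = 3%N ->
     exists C, forall p q, ostrip Rr p -> ostrip Rr q ->
       `|Dseq s f p - Dseq s f q| <= C * (dist2 p q) `^ al).

Definition dagger a (u v : R * R -> R) p :=
  px u p = py v p /\
  px v p = - 2 * Num.sqrt (v p ^+ 2 + p.2 ^+ 2 + a ^+ 2) * py u p.

Definition classical_sol a (u v : R * R -> R) p :=
  pderivable_at u p /\ pderivable_at v p /\ dagger a u v p.

Definition smooth2 f :=
  forall s : seq bool, continuous (Dseq s f) /\ forall p, pderivable_at (Dseq s f) p.
Definition test_fun (D : set (R * R)) f :=
  smooth2 f /\ exists K : set (R * R), compact K /\ K `<=` D /\
    forall p, ~ K p -> f p = 0.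

Definition locint (D : set (R * R)) f :=
  forall K : set (R * R), compact K -> K `<=` D -> mu2.-integrable K (EFin \o f).

Definition weak_px (D : set (R * R)) f g :=
  locint D f /\ locint D g /\
  forall phi, test_fun D phi ->
    (\int[mu2]_(p in D) (f p * px phi p)%:E = - \int[mu2]_(p in D) (g p * phi p)%:E)%E.
Definition weak_py (D : set (R * R)) f g :=
  locint D f /\ locint D g /\
  forall phi, test_fun D phi ->
    (\int[mu2]_(p in D) (f p * py phi p)%:E = - \int[mu2]_(p in D) (g p * phi p)%:E)%E.

Definition analytic2 f p :=
  exists (c : nat -> nat -> R) (r : R), 0 < r /\
    forall q, `|q.1 - p.1| < r -> `|q.2 - p.2| < r ->
      (exists M, forall n : nat,
          \sum_(i < n) \sum_(j < n)
             `|c i j| * `|q.1 - p.1| ^+ i * `|q.2 - p.2| ^+ j <= M) /\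
      ((fun n : nat => \sum_(i < n) \sum_(j < n)
          c i j * (q.1 - p.1) ^+ i * (q.2 - p.2) ^+ j) @ \oo --> f q).

Definition singular_sol Rr (u v : R * R -> R) :=
  {within strip Rr, continuous u} /\ {within strip Rr, continuous v} /\
  (exists ux uy vx vy : R * R -> R,
     weak_px (ostrip Rr) u ux /\ weak_py (ostrip Rr) u uy /\
     weak_px (ostrip Rr) v vx /\ weak_py (ostrip Rr) v vy /\
     {ae mu2, forall p, ostrip Rr p -> ux p = vy p} /\
     {ae mu2, forall p, ostrip Rr p ->
        vx p = - 2 * Num.sqrt (v p ^+ 2 + p.2 ^+ 2) * uy p} /\
     locint (ostrip Rr) (fun p => (Num.sqrt (v p ^+ 2 + p.2 ^+ 2))^-1 * vx p) /\
     forall psi, test_fun (ostrip Rr) psi ->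
       (\int[mu2]_(p in ostrip Rr)
          ((Num.sqrt (v p ^+ 2 + p.2 ^+ 2))^-1 * vx p * px psi p
           + 2 * vy p * py psi p)%:E = 0)%E) /\
  (forall p, ostrip Rr p -> ~ (p.2 = 0 /\ v p = 0) ->
     analytic2 u p /\ analytic2 v p /\ classical_sol 0 u v p) /\
  (exists U V : R -> R * R -> R,
     (forall b, 0 < b -> Ck_strip Rr 2 (U b) /\ Ck_strip Rr 2 (V b) /\
        forall p, ostrip Rr p -> classical_sol b (U b) (V b) p) /\
     forall e, 0 < e -> exists d, 0 < d /\ forall b, 0 < b -> b < d ->
       forall p, strip Rr p -> `|U b p - u p| <= e /\ `|V b p - v p| <= e).

Definition assoc_sol Rr P al a (phip phim : R -> R) (u v : R * R -> R) :=
  (forall p, strip Rr p -> u (p.1 + P, p.2) = u p /\ v (p.1 + P, p.2) = v p) /\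
  u (0, 0) = 0 /\
  (forall x, v (x, Rr) = phip x /\ v (x, - Rr) = phim x) /\
  (a != 0 -> C3a_strip Rr al u /\ C3a_strip Rr al v /\
     forall p, ostrip Rr p -> classical_sol a u v p) /\
  (a = 0 -> singular_sol Rr u v).

(** C^{3,al}(R) for functions on the line, and its norm bound
    ||f||_{C^{3,al}} = sum_{j<=3} sup|f^(j)| + [f^(3)]_al <= e. *)
Definition C3a_line al (f : R -> R) :=
  (forall j, (j < 3)%N -> forall x, derivable (derive1n j f) x 1) /\
  (forall j, (j <= 3)%N -> exists M, forall x, `|derive1n j f x| <= M) /\
  (exists C, forall x y, `|derive1n 3 f x - derive1n 3 f y| <= C * `|x - y| `^ al).

Definition holder_norm_le al (f : R -> R) e :=
  exists M : nat -> R,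
    (forall j, (j <= 3)%N -> forall x, `|derive1n j f x| <= M j) /\
    (forall x y, x != y ->
       `|derive1n 3 f x - derive1n 3 f y| <= M 4%N * `|x - y| `^ al) /\
    \sum_(j < 5) M j <= e.

(** C^3 is modelled as ((z1, z2), z3) with each z_k = (Re z_k, Im z_k). *)
Definition C3 := ((R * R) * (R * R) * (R * R))%type.
Definition cmul (z w : R * R) : R * R := (z.1 * w.1 - z.2 * w.2, z.1 * w.2 + z.2 * w.1).
Definition cnorm2 (z : R * R) : R := z.1 ^+ 2 + z.2 ^+ 2.

Definition zshift P (n : int) (z : C3) : C3 := (z.1, (z.2.1 + n%:~R * P, z.2.2)).

(** Preimage in C^3 of N_{a,b,c} (a Z-invariant set), with u = u_{a,b}, v = v_{a,b}. *)
Definition Nset Rr (u v : R * R -> R) a c : set C3 :=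
  [set z | cnorm2 z.1.1 - cnorm2 z.1.2 = 2 * a /\
     exists x y : R, - Rr < y < Rr /\
       cmul z.1.1 z.1.2 = (v (x, y), y) /\ z.2 = (x, u (x, y) + c)].

(** Preimage in C^3 of V. *)
Definition Vset Rr : set C3 := [set z | `|(cmul z.1.1 z.1.2).2| < Rr].

End Defs.

(* Main.v *)
(* The system makes [\int_x^x' v ds] differentiable in [y] with derivative [u (x') - u (x)], so a maximum
   principle for integrals of [v1 - v2] over all windows [x, x'] gives both the comparison principle and
   the closeness of averages of solutions for different parameters.  To upgrade closeness of averages to
   pointwise closeness, uniformly as [a -> 0], an energy estimate over a period yields many horizontal and
   vertical lines on which [u] and [v] are equicontinuous; these bound small boxes, inside which the
   maximum principle applies.  Hence [u] and [v] are continuous in [(a, b, x, y)].  Comparison of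
   translates shows that [v] is monotone in [b]; if two values coincided, then the moment of the
   difference of two intermediate solutions against a bump in [x] would vanish to second order in [y] and
   satisfy a Gronwall inequality, hence vanish up to the boundary, where the data differ.  So [b] is a
   continuous function of [(a, x, y, v)], and [F] is read off from [a = (|z1|^2 - |z2|^2) / 2],
   [z1 z2 = v + i y] and [Im z3 = u + c]. *)
Require Import Defs.
From mathcomp Require Import all_boot all_order all_algebra.
From mathcomp Require Import all_classical all_reals all_analysis.
From mathcomp Require Import ring lra.
Set Implicit Arguments. Unset Strict Implicit. Unset Printing Implicit Defensive.
Import Order.TTheory GRing.Theory Num.Theory.
Import numFieldNormedType.Exports.
Local Open Scope classical_set_scope.
Local Open Scope ring_scope.

(** * Calculus *)

(** A window integral is the increment of a potential whose [x]-derivative is [v] and whose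
    [y]-derivative is [u]. At an extremum of [v1 - v2] itself the weights of the two solutions
    differ and leave a term without sign; at an extremum over windows the two solutions agree at the
    ends, up to a small penalty. The obstacle is [a = 0]: the weight vanishes where [v = y = 0], and
    bounds on derivatives are lost as [a] tends to 0. So [a = 0] is reached only as a limit of
    regular solutions. A solution with small [a] is compared with an approximant of the singular one
    having the same [a ^+ 2], so that the uncontrolled derivative bound multiplies a zero difference
    of weights. Equicontinuity comes from an energy bound that depends only on bounds for [v] and
    [a], in the manner of the Courant-Lebesgue lemma. Averages determine [u] up to a constant, which
    is fixed by the period mean of [u], independent of [y], and by [u (0, 0) = 0]. Strictness avoids
    a strong maximum principle, which would degenerate with the equation, and rests on the bound of
    the inverse weight by the inverse of [|y|], uniform in [a]. *)

Section ContinuityRules.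
Context {R : realType} {T : topologicalType}.
Implicit Types (f g : T -> R) (x : T).

Lemma ctsP f : (forall x, {for x, continuous f}) -> continuous f.
Proof. by []. Qed.

Lemma cts_ext f g x : (forall s, f s = g s) -> {for x, continuous f} ->
  {for x, continuous g}.
Proof. by move=> /funext ->. Qed.

Lemma cts_cst (k : R) x : {for x, continuous (fun _ : T => k)}.
Proof. exact: cst_continuous. Qed.

Lemma ctsD f g x : {for x, continuous f} -> {for x, continuous g} ->
  {for x, continuous (fun s => f s + g s)}.
Proof. exact: continuousD. Qed.

Lemma ctsN f x : {for x, continuous f} -> {for x, continuous (fun s => - f s)}.
Proof. exact: continuousN. Qed.

Lemma ctsB f g x : {for x, continuous f} -> {for x, continuous g} ->
  {for x, continuous (fun s => f s - g s)}.
Proof. exact: continuousB. Qed.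

Lemma ctsM f g x : {for x, continuous f} -> {for x, continuous g} ->
  {for x, continuous (fun s => f s * g s)}.
Proof. exact: continuousM. Qed.

Lemma ctsX f n x : {for x, continuous f} -> {for x, continuous (fun s => f s ^+ n)}.
Proof.
move=> cf; elim: n => [|n IH]; first exact: cts_cst.
rewrite (_ : (fun s => f s ^+ n.+1) = (fun s => f s * f s ^+ n)); first exact: ctsM.
by apply/funext => s; rewrite exprS.
Qed.

Lemma ctsV f x : f x != 0 -> {for x, continuous f} -> {for x, continuous (fun s => (f s)^-1)}.
Proof. move=> fx cf; exact: continuousV. Qed.

Lemma cts_comp (h : R -> R) f x : {for x, continuous f} -> {for (f x), continuous h} ->
  {for x, continuous (fun s => h (f s))}.
Proof. exact: continuous_comp. Qed.

Lemma cts_sqrt f x : {for x, continuous f} -> {for x, continuous (fun s => Num.sqrt (f s))}.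
Proof. by move=> cf; apply: (cts_comp cf); exact: sqrt_continuous. Qed.

End ContinuityRules.

Section DerivationRules.
Context {R : realType}.
Implicit Types (f g h : R -> R) (x df dg dh k : R).

Lemma dD f g x df dg : is_derive x 1 f df -> is_derive x 1 g dg ->
  is_derive x 1 (fun s => f s + g s) (df + dg).
Proof. by move=> ? ?; exact: is_deriveD. Qed.

Lemma dB f g x df dg : is_derive x 1 f df -> is_derive x 1 g dg ->
  is_derive x 1 (fun s => f s - g s) (df - dg).
Proof. by move=> ? ?; exact: is_deriveB. Qed.

Lemma dN f x df : is_derive x 1 f df -> is_derive x 1 (fun s => - f s) (- df).
Proof. by move=> ?; exact: is_deriveN. Qed.

Lemma dM f g x df dg : is_derive x 1 f df -> is_derive x 1 g dg ->
  is_derive x 1 (fun s => f s * g s) (df * g x + f x * dg).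
Proof.
move=> hf hg; have := is_deriveM hf hg.
by rewrite /GRing.scale /= addrC [g x * _]mulrC.
Qed.

Lemma d_cst k x : is_derive x 1 (fun=> k) 0.
Proof. exact: is_derive_cst. Qed.

Lemma d_id x : is_derive x 1 (fun s : R => s) 1.
Proof. exact: is_derive_id. Qed.

Lemma dZ f x k df : is_derive x 1 f df -> is_derive x 1 (fun s => k * f s) (k * df).
Proof. by move=> ?; exact: is_deriveZ. Qed.

Lemma d_eq f x df dg : df = dg -> is_derive x 1 f df -> is_derive x 1 f dg.
Proof. by move=> ->. Qed.

Lemma d_comp h f x df dh : is_derive x 1 f df -> is_derive (f x) 1 h dh ->
  is_derive x 1 (fun s => h (f s)) (df * dh).
Proof.
by move=> hf hh; rewrite mulrC -[dh * df]/(dh *: df); exact: (@is_derive1_comp _ h f).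
Qed.

Lemma d_sqr f x df : is_derive x 1 f df -> is_derive x 1 (fun s => f s ^+ 2) (2 * f x * df).
Proof. by move=> h; have := dM h h; apply: d_eq; ring. Qed.

Lemma d_sqrt f x df : 0 < f x -> is_derive x 1 f df ->
  is_derive x 1 (fun s => Num.sqrt (f s)) (df / (2 * Num.sqrt (f x))).
Proof. by move=> f0 hf; apply: (d_comp hf); exact: is_derive1_sqrt. Qed.

Lemma d_ln f x df : 0 < f x -> is_derive x 1 f df ->
  is_derive x 1 (fun s => ln (f s)) (df / f x).
Proof. by move=> f0 hf; apply: (d_comp hf); exact: is_derive1_ln. Qed.

End DerivationRules.

Section Calculus.
Context {R : realType}.
Implicit Types (f g F G : R -> R) (a b c x y z t e d r k s m p q M P : R).

Lemma continuous_atP f x : {for x, continuous f} <->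
  forall e : R, 0 < e -> exists2 d : R, 0 < d & forall y, `|y - x| < d -> `|f y - f x| < e.
Proof.
split.
- move=> /cvgrPdist_lt h e e0; have := h e e0.
  move=> /nbhs_ballP [d /= d0 H]; exists d => // y yx.
  by rewrite distrC; apply: H; rewrite /ball /= distrC.
- move=> h; apply/cvgrPdist_lt => e e0; have [d d0 H] := h e e0.
  apply/nbhs_ballP; exists d => //= y; rewrite /ball /= distrC => /H.
  by rewrite distrC.
Qed.

Lemma continuous2_atP (f : R * R -> R) (p : R * R) : {for p, continuous f} <->
  forall e : R, 0 < e -> exists2 d : R, 0 < d & forall q : R * R,
    `|q.1 - p.1| < d -> `|q.2 - p.2| < d -> `|f q - f p| < e.
Proof.
split.
- move=> /cvgrPdist_lt h e e0; have := h e e0.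
  move=> /(@nbhs_ballP R (R * R)%type p) [d /= d0 H]; exists d => // q h1 h2.
  by rewrite distrC; apply: H; split; rewrite /ball /= distrC.
- move=> h; apply/cvgrPdist_lt => e e0; have [d d0 H] := h e e0.
  apply/(@nbhs_ballP R (R * R)%type p); exists d => //= q [] /=; rewrite /ball /= distrC => h1.
  by rewrite distrC => h2; rewrite distrC; apply: H.
Qed.

Lemma is_derive_continuous f x df : is_derive x 1 f df -> {for x, continuous f}.
Proof. by move=> [h _]; apply: differentiable_continuous; apply/derivable1_diffP. Qed.

Lemma is_derive_uniq f x d1 d2 : is_derive x 1 f d1 -> is_derive x 1 f d2 -> d1 = d2.
Proof. by move=> [_ <-] [_ <-]. Qed.

Lemma is_derive_dist f x (df : R) : is_derive x 1 f df <->
  forall e : R, 0 < e -> exists2 d : R, 0 < d &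
    forall y, `|y - x| < d -> `|f y - f x - df * (y - x)| <= e * `|y - x|.
Proof.
split.
- move=> [h1 h2] e e0; move: h1; rewrite /derivable => /cvg_ex [l hl].
  have El : df = l by rewrite -h2; exact: cvg_lim.
  subst l; move/cvgrPdist_lt: hl => /(_ e e0) /nbhs_ballP [d /= d0 H].
  exists d => // y yx; have [->|yNx] := eqVneq y x.
    by rewrite !subrr mulr0 subr0 normr0 mulr0.
  have yx0 : y - x != 0 by rewrite subr_eq0.
  have := H (y - x); rewrite /ball /= sub0r normrN => /(_ yx yx0).
  rewrite scaler1 subrK /GRing.scale /= => h.
  have -> : f y - f x - df * (y - x) = - ((df - (y - x)^-1 * (f y - f x)) * (y - x)).
    by field.
  by rewrite normrN normrM ler_wpM2r// ltW.
- move=> h.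
  have H : (h^-1 *: (f (h *: 1 + x) - f x)) @[h --> 0^'] --> df.
    apply/cvgrPdist_lt => e e0; have [d d0 H] := h (e / 2) ltac:(lra).
    apply/nbhs_ballP; exists d => //= y; rewrite /ball /= sub0r normrN => yd y0.
    have := H (y + x); rewrite addrK => /(_ yd) h1.
    rewrite /GRing.scale /= mulr1.
    have -> : df - y^-1 * (f (y + x) - f x) = - (f (y + x) - f x - df * y) / y.
      by field.
    rewrite normrM normrN normfV ltr_pdivrMr ?normr_gt0//.
    apply: (le_lt_trans h1); rewrite ltr_pM2r ?normr_gt0//; lra.
  by split; [apply/cvg_ex; exists df | exact: cvg_lim].
Qed.

Lemma is_derive_ext f g x df : (forall y, f y = g y) -> is_derive x 1 f df -> is_derive x 1 g df.
Proof. by move=> fg; rewrite (_ : f = g) //; apply/funext. Qed.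

Lemma is_derive_near f g x df e : 0 < e -> (forall y, `|y - x| < e -> f y = g y) ->
  is_derive x 1 f df -> is_derive x 1 g df.
Proof.
move=> e0 fg /is_derive_dist h; apply/is_derive_dist => e' /h [d d0 H].
exists (Num.min d e); first by rewrite lt_min d0.
move=> y; rewrite lt_min => /andP[h1 h2].
by rewrite -!fg // ?subrr ?normr0 //; exact: H.
Qed.

Lemma continuous_itv f a b : (forall x, a <= x <= b -> {for x, continuous f}) ->
  {within `[a, b], continuous f}.
Proof.
move=> h; apply: continuous_in_subspaceT => x; rewrite inE /= in_itv /= => xab.
exact: h.
Qed.

Lemma mvt f df a b : a < b -> (forall x, a < x < b -> is_derive x 1 f (df x)) ->
  (forall x, a <= x <= b -> {for x, continuous f}) ->
  exists2 c, a < c < b & f b - f a = df c * (b - a).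
Proof.
move=> ab h1 h2; have h1' x : x \in `]a, b[ -> is_derive x 1 f (df x) by rewrite in_itv /=; exact: h1.
have [c] := MVT ab h1' (continuous_itv h2).
by rewrite in_itv /= => cab E; exists c.
Qed.

Lemma derive_ge0_le f df a b : a <= b ->
  (forall x, a < x < b -> is_derive x 1 f (df x)) ->
  (forall x, a <= x <= b -> {for x, continuous f}) ->
  (forall x, a < x < b -> 0 <= df x) -> f a <= f b.
Proof.
rewrite le_eqVlt => /predU1P[-> //|ab] h1 h2 h3; have [c cab E] := mvt ab h1 h2.
by rewrite -subr_ge0 E mulr_ge0 ?h3 // subr_ge0 ltW.
Qed.

Lemma derive_ext_sub f g df a b : a <= b ->
  (forall x, a < x < b -> is_derive x 1 f (df x)) ->
  (forall x, a < x < b -> is_derive x 1 g (df x)) ->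
  (forall x, a <= x <= b -> {for x, continuous f}) ->
  (forall x, a <= x <= b -> {for x, continuous g}) ->
  f b - f a = g b - g a.
Proof.
rewrite le_eqVlt => /predU1P[-> |ab] h1 h2 h3 h4; first by rewrite !subrr.
have [||c cab] := @mvt (f - g) (fun x => df x - df x) a b ab.
- by move=> x xab; apply: is_deriveB; [exact: h1|exact: h2].
- by move=> x xab; apply: continuousB; [exact: h3|exact: h4].
by rewrite subrr mul0r !fctE => E; lra.
Qed.

Lemma deriv_bound f df a b M : a <= b ->
  (forall x, a < x < b -> is_derive x 1 f (df x)) ->
  (forall x, a <= x <= b -> {for x, continuous f}) ->
  (forall x, a < x < b -> `|df x| <= M) -> `|f b - f a| <= M * (b - a).
Proof.
rewrite le_eqVlt => /predU1P[-> |ab] h1 h2 h3; first by rewrite !subrr normr0 mulr0.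
have [c cab ->] := mvt ab h1 h2; rewrite normrM (gtr0_norm (_ : 0 < b - a)) ?subr_gt0//.
by rewrite ler_pM2r ?subr_gt0//; exact: h3.
Qed.

Lemma local_min_derive f (df : R) d e : 0 < e -> is_derive d 1 f df ->
  (forall x, `|x - d| < e -> f d <= f x) -> df = 0.
Proof.
move=> e0 /is_derive_dist h m; apply/eqP; rewrite -normr_le0; apply/ler_addgt0Pr => k k0.
rewrite add0r; have [r r0 H] := h k k0.
set s := Num.min r e / 2; have s0 : 0 < s by rewrite divr_gt0 // lt_min r0 e0.
have sr : s < r.
  have : Num.min r e <= r by rewrite ge_min lexx.
  rewrite /s; move: (s0); rewrite /s; lra.
have se : s < e.
  have : Num.min r e <= e by rewrite ge_min lexx orbT.
  rewrite /s; move: (s0); rewrite /s; lra.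
have Hs z : `|z| = s -> z * df >= - k * s.
  move=> zs; have := H (d + z); rewrite addrAC subrr add0r zs => /(_ sr).
  have : f d <= f (d + z) by apply: m; rewrite addrAC subrr add0r zs.
  by move=> h1 /ler_normlP [h2 h3]; lra.
have := Hs s (gtr0_norm s0); have := Hs (- s); rewrite normrN => /(_ (gtr0_norm s0)).
move=> h1 h2; apply/ler_normlP; split; rewrite -(ler_pM2r s0); lra.
Qed.

Lemma local_min_derive2 f df d (d2 : R) e : 0 < e ->
  (forall x, `|x - d| < e -> is_derive x 1 f (df x)) -> is_derive d 1 df d2 ->
  (forall x, `|x - d| < e -> f d <= f x) -> df d = 0 /\ 0 <= d2.
Proof.
move=> e0 h1 h2 m.
have E : df d = 0 by apply: (local_min_derive e0 _ m); apply: h1; rewrite subrr normr0.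
split=> //; rewrite leNgt; apply/negP => d2n.
have [r r0 H] := (is_derive_dist _ _ _).1 h2 (- d2 / 2) ltac:(lra).
set s := Num.min r e / 2; have s0 : 0 < s by rewrite divr_gt0 // lt_min r0 e0.
have sr : s < r.
  have : Num.min r e <= r by rewrite ge_min lexx.
  rewrite /s; move: (s0); rewrite /s; lra.
have se : s < e.
  have : Num.min r e <= e by rewrite ge_min lexx orbT.
  rewrite /s; move: (s0); rewrite /s; lra.
(* If [d2 < 0], then [df] is negative just to the right of [d], and the mean value theorem produces
   a value of [f] below the minimum. *)
have [|x xds|x xds|c /andP[c1 c2]] := @mvt f df d (d + s); first by rewrite ltrDl.
- move: xds => /andP[x1 x2]; apply: h1; rewrite gtr0_norm ?subr_gt0 //; lra.
- move: xds => /andP[x1 x2]; apply: is_derive_continuous (h1 x _).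
  rewrite ger0_norm ?subr_ge0 //; lra.
have cd : `|c - d| = c - d by rewrite gtr0_norm // subr_gt0.
have := H c; rewrite cd E subr0 => /(_ ltac:(lra)) /ler_normlP [_ h3].
have := m (d + s); rewrite addrAC subrr add0r gtr0_norm // => /(_ se) h4 h5.
have : df c * s >= 0 by lra.
rewrite pmulr_lge0 // => h6.
have : d2 / 2 * (c - d) < 0 by rewrite nmulr_rlt0; lra.
lra.
Qed.

End Calculus.

(** * Integrals defined through primitives *)

Section Integral.
Context {R : realType}.
Implicit Types (f g F G : R -> R) (a b c x y z t e d r k s m p q M P : R).

Lemma is_derive_compDr f x s (df : R) :
  is_derive (x + s) 1 f df -> is_derive x 1 (fun y => f (y + s)) df.
Proof.
move=> /is_derive_dist h; apply/is_derive_dist => e /h [d d0 H].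
exists d => // y yx; have := H (y + s).
by rewrite (_ : y + s - (x + s) = y - x); [apply|ring].
Qed.

Lemma ex_primitive f : continuous f -> exists F, forall x, is_derive x 1 F (f x).
Proof.
move=> cf.
(* The integral from a base point [A] is a primitive to the right of [A] only. By [same] its
   increments do not depend on the base point, so the base may move with [x]. *)
pose G A x := (\int[@lebesgue_measure R]_(t in `[A, x]) f t)%R.
have dG A x : A < x -> is_derive x 1 (G A) (f x).
  move=> Ax.
  have xx : x < x + 1 by rewrite ltrDl.
  have intf : (@lebesgue_measure R).-integrable `[A, x + 1] (EFin \o f).
    apply: continuous_compact_integrable; first exact: segment_compact.
    by apply: continuous_itv => z _; exact: cf.
  have [h1 h2] := continuous_FTC1_closed xx intf Ax (cf x).
  by split=> //; rewrite -derive1E.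
have same A1 A2 x : A1 < 0 -> A1 < x -> A2 < 0 -> A2 < x ->
    G A1 x - G A1 0 = G A2 x - G A2 0.
  move=> a1 b1 a2 b2; have cG A z : A < z -> {for z, continuous (G A)}.
    by move=> /dG; exact: is_derive_continuous.
  case: (leP 0 x) => x0.
    by apply: (derive_ext_sub (df := f) x0) => z /andP[z1 z2];
      try apply: dG; try apply: cG; lra.
  apply: oppr_inj; rewrite !opprB.
  by apply: (derive_ext_sub (df := f) (ltW x0)) => z /andP[z1 z2];
    try apply: dG; try apply: cG; lra.
exists (fun x => G (- (`|x| + 1)) x - G (- (`|x| + 1)) 0) => x.
have lex (z : R) : - (`|z| + 1) < z by have := ler_norm (- z); rewrite normrN; lra.
have l0 (z : R) : - (`|z| + 1) < 0 by have := normr_ge0 z; lra.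
apply: (@is_derive_near _ (fun z => G (- (`|x| + 2)) z - G (- (`|x| + 2)) 0) _ x _ 1) => //.
  move=> y yx; have h0 := normr_ge0 x.
  have h1 : - `|x| <= x by have := ler_norm (- x); rewrite normrN; lra.
  apply: same => //; try lra.
  by move/ltr_normlP: yx => [h _]; lra.
rewrite -[X in is_derive _ _ _ X]subr0; apply: dB.
by apply: dG; have := ler_norm (- x); rewrite normrN; lra.
Qed.

(* [prim f] is an antiderivative of [f]; it is junk when none exists. *)
Definition prim f : R -> R :=
  if pselect (exists F, forall x, is_derive x 1 F (f x)) is left h
  then projT1 (cid h) else fun=> 0.

(** As a difference of values of a total function, this oriented integral obeys additivity and the
    sign rule for arbitrary bounds and arbitrary [f]. *)
Definition integ f a b := prim f b - prim f a.

Lemma prim_derive f x : continuous f -> is_derive x 1 (prim f) (f x).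
Proof.
move=> /ex_primitive h; rewrite /prim; case: pselect => // h'.
by case: cid.
Qed.

Lemma prim_continuous f : continuous f -> continuous (prim f).
Proof. by move=> cf x; apply: is_derive_continuous (prim_derive x cf). Qed.

Lemma intE f F a b : continuous f -> a <= b ->
  (forall x, a < x < b -> is_derive x 1 F (f x)) ->
  (forall x, a <= x <= b -> {for x, continuous F}) -> integ f a b = F b - F a.
Proof.
move=> cf ab h1 h2; apply: (derive_ext_sub (df := f) ab) => // x _.
- exact: prim_derive.
- exact: prim_continuous.
Qed.

Lemma intE' f F a b : continuous f -> a <= b ->
  (forall x, a <= x <= b -> is_derive x 1 F (f x)) -> integ f a b = F b - F a.
Proof.
move=> cf ab h; apply: intE => // x xab; last exact: is_derive_continuous (h x xab).
by apply: h; case/andP: xab => *; rewrite !ltW.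
Qed.

Lemma eq_int f g a b : f =1 g -> integ f a b = integ g a b.
Proof. by move=> /funext ->. Qed.

Lemma eq_int_itv f g a b : continuous f -> continuous g -> a <= b ->
  (forall x, a < x < b -> f x = g x) -> integ f a b = integ g a b.
Proof.
move=> cf cg ab fg; apply: intE => // x xab; last exact: prim_continuous.
by rewrite fg //; exact: prim_derive.
Qed.

Lemma int_chasles f a b c : integ f a b + integ f b c = integ f a c.
Proof. by rewrite /integ; ring. Qed.

Lemma int_swap f a b : integ f a b = - integ f b a.
Proof. by rewrite /integ opprB. Qed.

Lemma intxx f a : integ f a a = 0.
Proof. by rewrite /integ subrr. Qed.

Lemma int_deriv f a x : continuous f -> is_derive x 1 (integ f a) (f x).
Proof.
move=> cf; rewrite -[X in is_derive _ _ _ X]subr0; apply: dB.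
exact: prim_derive.
Qed.

Lemma int_derivl f b x : continuous f -> is_derive x 1 (fun a => integ f a b) (- f x).
Proof.
move=> cf; rewrite -[X in is_derive _ _ _ X]sub0r; apply: dB.
exact: prim_derive.
Qed.

Lemma le_int f g a b : continuous f -> continuous g -> a <= b ->
  (forall x, a < x < b -> f x <= g x) -> integ f a b <= integ g a b.
Proof.
move=> cf cg ab fg; rewrite -subr_ge0.
have -> : integ g a b - integ f a b = (fun x => prim g x - prim f x) b - (fun x => prim g x - prim f x) a.
  by rewrite /integ; ring.
rewrite subr_ge0; apply: (@derive_ge0_le _ (fun x => prim g x - prim f x) (fun x => g x - f x) _ _ ab) => x xab.
- by apply: dB; exact: prim_derive.
- by apply: ctsB; exact: prim_continuous.
- by rewrite subr_ge0; exact: fg.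
Qed.

Lemma intD f g a b : continuous f -> continuous g ->
  integ (fun x => f x + g x) a b = integ f a b + integ g a b.
Proof.
move=> cf cg; suff H : forall a b, a <= b -> integ (fun x => f x + g x) a b = integ f a b + integ g a b.
  case: (leP a b) => [/H //|/ltW /H]; rewrite /integ; lra.
move=> {a b} a b ab; have -> : integ f a b + integ g a b = (fun x => prim f x + prim g x) b - (fun x => prim f x + prim g x) a.
  by rewrite /integ; ring.
apply: (intE' (F := fun x => prim f x + prim g x)) => //.
  by apply: ctsP => x; apply: ctsD; [exact: cf|exact: cg].
by move=> x _; apply: dD; exact: prim_derive.
Qed.

Lemma intZ f k a b : continuous f -> integ (fun x => k * f x) a b = k * integ f a b.
Proof.
move=> cf; suff H : forall a b, a <= b -> integ (fun x => k * f x) a b = k * integ f a b.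
  case: (leP a b) => [/H //|/ltW /H]; rewrite /integ => h; lra.
move=> {a b} a b ab; have -> : k * integ f a b = (fun x => k * prim f x) b - (fun x => k * prim f x) a.
  by rewrite /integ; ring.
apply: (intE' (F := fun x => k * prim f x)) => //.
  by apply: ctsP => x; apply: ctsM; [exact: cts_cst|exact: cf].
by move=> x _; apply: dZ; exact: prim_derive.
Qed.

Lemma intN f a b : continuous f -> integ (fun x => - f x) a b = - integ f a b.
Proof.
by move=> cf; rewrite -mulN1r -intZ//; apply: eq_int => x; rewrite mulN1r.
Qed.

Lemma intB f g a b : continuous f -> continuous g ->
  integ (fun x => f x - g x) a b = integ f a b - integ g a b.
Proof.
move=> cf cg; rewrite intD ?intN// => x; apply: ctsN; exact: cg.
Qed.

Lemma int_cst k a b : integ (fun=> k) a b = k * (b - a).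
Proof.
have H : forall a b, a <= b -> integ (fun=> k) a b = k * (b - a).
  move=> {a b} a b ab; rewrite mulrBr.
  apply: (@intE' _ (fun x => k * x)) => // x; first exact: cts_cst.
  move=> _; rewrite -[X in is_derive _ _ _ X]mulr1.
  by apply: dZ; exact: d_id.
case: (leP a b) => [/H //|/ltW /H]; rewrite /integ => h; lra.
Qed.

Lemma int_ge0 f a b : continuous f -> a <= b ->
  (forall x, a < x < b -> 0 <= f x) -> 0 <= integ f a b.
Proof.
move=> cf ab f0; have := @le_int (fun=> 0) f a b; rewrite int_cst mul0r; apply => //.
by move=> x; exact: cts_cst.
Qed.

Lemma int_norm_le f a b M : continuous f -> a <= b ->
  (forall x, a < x < b -> `|f x| <= M) -> `|integ f a b| <= M * (b - a).
Proof.
move=> cf ab fM; apply/ler_normlP; split.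
  rewrite -intN // -int_cst; apply: le_int => // x.
  - by apply: ctsN; exact: cf.
  - exact: cts_cst.
  - by move/fM => /ler_normlP [].
rewrite -int_cst; apply: le_int => // x; first exact: cts_cst.
by move/fM => /ler_normlP [].
Qed.

Lemma int_le_cst f a b M : continuous f -> a <= b ->
  (forall x, a < x < b -> f x <= M) -> integ f a b <= M * (b - a).
Proof.
move=> cf ab fM; rewrite -int_cst; apply: le_int => // x; exact: cts_cst.
Qed.

Lemma int_mvt f a b : continuous f -> a < b ->
  exists2 c, a < c < b & integ f a b = f c * (b - a).
Proof.
move=> cf ab; apply: mvt => // x _; first exact: prim_derive.
exact: prim_continuous.
Qed.

Lemma int_gt0 f a b x : continuous f -> (forall z, a < z < b -> 0 <= f z) ->
  a < x < b -> 0 < f x -> 0 < integ f a b.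
Proof.
move=> cf f0 /andP[ax xb] fx; have ab := lt_trans ax xb.
have h1 : integ f a x >= 0.
  by apply: int_ge0 => //; [exact: ltW|move=> z /andP[z1 z2]; apply: f0; rewrite z1 (lt_trans z2)].
have [d d0 H] := (continuous_atP _ _).1 (cf x) (f x / 2) ltac:(lra).
set m := Num.min (x + d) b.
have xm : x < m by rewrite lt_min xb ltrDl d0.
have mb : m <= b by rewrite ge_min lexx orbT.
have md : m <= x + d by rewrite ge_min lexx.
have h2 : integ f m b >= 0.
  by apply: int_ge0 => // z /andP[z1 z2]; apply: f0; rewrite z2 (lt_trans _ z1) ?(lt_trans _ xm).
have h3 : (f x / 2) * (m - x) <= integ f x m.
  rewrite -int_cst; apply: le_int => //; [by move=> z; exact: cts_cst|exact: ltW|].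
  move=> z /andP[z1 z2]; have := H z; rewrite gtr0_norm ?subr_gt0// => /(_ ltac:(lra)).
  by move/ltr_normlP => [? ?]; lra.
have : 0 < f x / 2 * (m - x) by rewrite mulr_gt0 ?subr_gt0//; lra.
have := int_chasles f a x m; have := int_chasles f a m b; lra.
Qed.

Lemma int_periodic f P a b : continuous f -> (forall x, f (x + P) = f x) ->
  integ f a (a + P) = integ f b (b + P).
Proof.
move=> cf fP; pose g x := prim f (x + P).
suff H x y : x <= y -> integ f x (x + P) = integ f y (y + P).
  by case: (leP a b) => [/H //|/ltW /H].
move=> xy; have : prim f y - prim f x = g y - g x.
  have dg z : is_derive z 1 g (f z).
    by rewrite -fP; apply: is_derive_compDr; exact: prim_derive.
  apply: (derive_ext_sub (df := f) xy) => z _ //; first exact: prim_derive.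
  - exact: prim_continuous.
  - exact: is_derive_continuous (dg z).
rewrite /integ /g => h; lra.
Qed.

(** Compactness of the segment makes the modulus of continuity across the line of height [y] uniform
    in [x]; continuity is asked only at points of that line. *)
Lemma itv_near_unif (f : R * R -> R) a b y e :
  (forall x, a <= x <= b -> {for (x, y), continuous f}) -> 0 < e ->
  exists2 d : R, 0 < d & forall x z, a <= x <= b -> `|z - y| < d ->
    `|f (x, z) - f (x, y)| < e.
Proof.
move=> cf e0.
have /compact_near_coveringP/(_ _ (nbhs y) (fun z x => `|f (x, z) - f (x, y)| < e)) :=
  @segment_compact R a b.
move=> /(_ _ _) [|d /= d0 H].
  move=> x /=; rewrite in_itv /= => xab.
  have [d d0 H] := (continuous2_atP _ _).1 (cf x xab) (e / 2) ltac:(lra).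
  exists (ball x d, ball y d); first by split; exact: nbhsx_ballx.
  move=> [z1 z2] [/= h1 h2].
  have e1 : `|f (z1, z2) - f (x, y)| < e / 2.
    by apply: H => /=; rewrite distrC.
  have e2 : `|f (z1, y) - f (x, y)| < e / 2.
    by apply: H => /=; [rewrite distrC|rewrite subrr normr0].
  rewrite (_ : _ - _ = (f (z1, z2) - f (x, y)) - (f (z1, y) - f (x, y))); last by ring.
  by apply: (le_lt_trans (ler_normB _ _)); lra.
exists d => // x z xab zy; apply: (H z); first by rewrite /ball /= distrC.
by rewrite /= in_itv.
Qed.

Lemma continuous_slice1 (f : R * R -> R) x y :
  {for (x, y), continuous f} -> {for x, continuous (fun s => f (s, y))}.
Proof.
move=> /continuous2_atP h; apply/continuous_atP => e /h [d d0 H].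
by exists d => // z zx; apply: H => //=; rewrite subrr normr0.
Qed.

Lemma continuous_slice2 (f : R * R -> R) x y :
  {for (x, y), continuous f} -> {for y, continuous (fun s => f (x, s))}.
Proof.
move=> /continuous2_atP h; apply/continuous_atP => e /h [d d0 H].
by exists d => // z zx; apply: H => //=; rewrite subrr normr0.
Qed.

Lemma continuous_swap (f : R * R -> R) x y : {for (y, x), continuous f} ->
  {for (x, y), continuous (fun p : R * R => f (p.2, p.1))}.
Proof.
move=> /continuous2_atP cf; apply/continuous2_atP => e /cf [k k0 H].
by exists k => // z h1 h2; apply: H.
Qed.

Lemma continuous_int (f : R * R -> R) a b y r : 0 < r -> a <= b ->
  (forall x z, `|z - y| < r -> {for x, continuous (fun s => f (s, z))}) ->
  (forall x, a <= x <= b -> {for (x, y), continuous f}) ->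
  {for y, continuous (fun z => integ (fun x => f (x, z)) a b)}.
Proof.
move=> r0 ab c1 c2; apply/continuous_atP => e e0.
(* The summand 1 keeps the denominator positive when [a = b]. *)
have k0 : 0 < e / (b - a + 1) by rewrite divr_gt0 //; lra.
have [d d0 H] := itv_near_unif c2 k0.
have yy : `|y - y| < r by rewrite subrr normr0.
exists (Num.min d r); first by rewrite lt_min d0.
move=> z; rewrite lt_min => /andP[zd zr].
rewrite -intB; [|by move=> x; exact: c1|by move=> x; exact: c1].
apply: (@le_lt_trans _ _ (e / (b - a + 1) * (b - a))).
  apply: int_norm_le => //.
    by apply: ctsP => x; apply: ctsB; exact: c1.
  by move=> x /andP[x1 x2]; apply: ltW; apply: H => //; rewrite !ltW.
by rewrite mulrAC ltr_pdivrMr ?ltr_pM2l//; lra.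
Qed.

(* Only [f] at height [y] need be integrable, as the difference quotients of [g] are compared with it. *)
Lemma int_param_derive (g f : R * R -> R) a b y r : 0 < r -> a <= b ->
  (forall x z, `|z - y| < r -> {for x, continuous (fun s => g (s, z))}) ->
  (forall x z, a <= x <= b -> `|z - y| < r -> is_derive z 1 (fun t => g (x, t)) (f (x, z))) ->
  (forall x, {for x, continuous (fun s => f (s, y))}) ->
  (forall x, a <= x <= b -> {for (x, y), continuous f}) ->
  is_derive y 1 (fun z => integ (fun x => g (x, z)) a b) (integ (fun x => f (x, y)) a b).
Proof.
move=> r0 ab cg dg cf1 cf; apply/is_derive_dist => e e0.
have k0 : 0 < e / (b - a + 1) by rewrite divr_gt0 //; lra.
have [d d0 H] := itv_near_unif cf k0.
have yy : `|y - y| < r by rewrite subrr normr0.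
exists (Num.min d r); first by rewrite lt_min d0.
move=> z; rewrite lt_min => /andP[zd zr].
have cc : continuous (fun x => (z - y) * f (x, y)).
  by apply: ctsP => x; apply: ctsM;
    [exact: cts_cst|exact: cf1].
have cgz t : `|t - y| < r -> continuous (fun x => g (x, t)) by move=> h x; exact: cg.
have cgg : continuous (fun x => g (x, z) - g (x, y)).
  by apply: ctsP => x; apply: ctsB; [exact: (cgz z)|exact: (cgz y)].
rewrite -intB; [|exact: cgz|exact: cgz].
rewrite [_ * (z - y)]mulrC -intZ // -intB //.
apply: (@le_trans _ _ ((e / (b - a + 1) * `|z - y|) * (b - a))); last first.
  rewrite -mulrA [_ * (b - a)]mulrC mulrA ler_wpM2r //.
  by rewrite mulrAC ler_pdivrMr ?ler_pM2l//; lra.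
apply: int_norm_le => //.
  by apply: ctsP => x; apply: ctsB; [exact: cgg|exact: cc].
move=> x /andP[x1 x2]; have xab : a <= x <= b by rewrite !ltW.
(* Mean value estimate for [g (x, t) - f (x, y) * t], stated for an ordered pair so that it serves
   on either side of [y]. *)
have key p q : p <= q -> `|p - y| <= `|z - y| -> `|q - y| <= `|z - y| ->
   `|(g (x, q) - g (x, p)) - (q - p) * f (x, y)| <= e / (b - a + 1) * (q - p).
  move=> pq hp hq.
  have in_ t : p <= t <= q -> `|t - y| <= `|z - y|.
    move=> /andP[t1 t2]; move: hp hq => /ler_normlP [? ?] /ler_normlP [? ?].
    by apply/ler_normlP; split; lra.
  have -> : g (x, q) - g (x, p) - (q - p) * f (x, y) =
      (fun t => g (x, t) - f (x, y) * t) q - (fun t => g (x, t) - f (x, y) * t) p.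
    by ring.
  have dd t : p <= t <= q ->
      is_derive t 1 (fun t => g (x, t) - f (x, y) * t) (f (x, t) - f (x, y)).
    move=> /in_ tz; apply: dB; first by apply: dg => //; exact: le_lt_trans zr.
    rewrite -[X in is_derive _ _ _ X]mulr1; by apply: dZ; exact: d_id.
  apply: (@deriv_bound _ (fun t => g (x, t) - f (x, y) * t) (fun t => f (x, t) - f (x, y)) _ _ _ pq).
  - by move=> t /andP[t1 t2]; apply: dd; rewrite !ltW.
  - by move=> t /dd; exact: is_derive_continuous.
  - move=> t /andP[t1 t2]; apply/ltW/H => //; apply: le_lt_trans zd.
    by apply: in_; rewrite !ltW.
case: (leP y z) => yz.
  by rewrite (ger0_norm (_ : 0 <= z - y)) ?subr_ge0//; apply: key => //; rewrite subrr normr0.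
rewrite (ltr0_norm (_ : z - y < 0)) ?subr_lt0//.
have := key z y (ltW yz) (lexx _); rewrite subrr normr0 => /(_ (normr_ge0 _)).
rewrite -normrN opprB; congr (_ <= _); last by ring.
by congr `| _ |; ring.
Qed.

(** Both sides vanish for [b = a] and have the same derivative in the upper bound [b], by
    differentiation under the integral sign. *)
Lemma fubini (f : R * R -> R) a b c d : continuous f -> a <= b -> c <= d ->
  integ (fun x => integ (fun y => f (x, y)) c d) a b =
  integ (fun y => integ (fun x => f (x, y)) a b) c d.
Proof.
move=> cf ab cd.
have c1 y : continuous (fun x => f (x, y)) by move=> x; exact: continuous_slice1 (cf _).
have c2 x : continuous (fun y => f (x, y)) by move=> y; exact: continuous_slice2 (cf _).
have swp : continuous (fun p : R * R => f (p.2, p.1)).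
  by move=> [p q]; apply: continuous_swap; exact: cf.
have cI : continuous (fun x => integ (fun y => f (x, y)) c d).
  apply: ctsP => x; have := @continuous_int (fun p : R * R => f (p.2, p.1)) c d x 1 ltr01 cd.
  by apply => [y z _|y _]; [exact: c2|exact: swp].
apply: etrans (_ : _ = integ (fun y => integ (fun x => f (x, y)) a b) c d
                     - integ (fun y => integ (fun x => f (x, y)) a a) c d) _; last first.
  by rewrite [X in _ - X](_ : _ = 0) ?subr0// (eq_int _ _ (g := fun=> 0)) ?int_cst ?mul0r// => y; rewrite intxx.
apply: (@intE' _ (fun t => integ (fun y => integ (fun x => f (x, y)) a t) c d)) => // t _.
apply: (@int_param_derive (fun p : R * R => integ (fun x => f (x, p.1)) a p.2)
   (fun p : R * R => f (p.2, p.1)) c d t 1) => //=.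
- move=> x z _ /=; case: (leP a z) => az.
    by apply: (@continuous_int f a z x 1) => // *; [exact: c1|exact: cf].
  apply: (@cts_ext _ _ (fun y => - integ (fun x => f (x, y)) z a)).
    by move=> y; rewrite /integ opprB.
  apply: ctsN; apply: (@continuous_int f z a x 1) => //; first exact: ltW.
  + by move=> *; exact: c1.
  + by move=> *; exact: cf.
- by move=> x z _ _; apply: int_deriv; exact: c1.
- by move=> x; exact: c2.
- by move=> x _; exact: swp.
Qed.

End Integral.

(** * Solutions on the strip *)

Section Solutions.
Context {R : realType}.
Implicit Types (x y z t e d r k s m L P B C : R) (u v f : R * R -> R) (Rr a : R).

Record derivs := Derivs {
  dux : R * R -> R; duy : R * R -> R; dvx : R * R -> R;
  duxx : R * R -> R; duxy : R * R -> R; duyy : R * R -> R; dvxx : R * R -> R }.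

(** Continuity relative to the closed strip, hence one-sided across its two boundary lines. *)
Definition scont Rr f := forall p, strip Rr p -> forall e, 0 < e ->
  exists2 d, 0 < d & forall q, strip Rr q ->
    `|q.1 - p.1| < d -> `|q.2 - p.2| < d -> `|f q - f p| < e.

Definition wt a (v : R) y := Num.sqrt (v ^+ 2 + y ^+ 2 + a ^+ 2).

(* The first equation of the system makes [dux D] serve also as the [y]-derivative of [v], and
   [duxx D] as the mixed second derivative of [v]. *)
Record is_sol Rr a u v (D : derivs) : Prop := IsSol {
  sol_cu : scont Rr u;
  sol_cv : scont Rr v;
  sol_ux : forall x y, `|y| < Rr -> is_derive x 1 (fun t => u (t, y)) (dux D (x, y));
  sol_uy : forall x y, `|y| < Rr -> is_derive y 1 (fun t => u (x, t)) (duy D (x, y));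
  sol_vx : forall x y, `|y| < Rr -> is_derive x 1 (fun t => v (t, y)) (dvx D (x, y));
  sol_vy : forall x y, `|y| < Rr -> is_derive y 1 (fun t => v (x, t)) (dux D (x, y));
  sol_eq : forall x y, `|y| < Rr ->
    dvx D (x, y) = - 2 * wt a (v (x, y)) y * duy D (x, y);
  sol_uxx : forall x y, `|y| < Rr -> is_derive x 1 (fun t => dux D (t, y)) (duxx D (x, y));
  sol_uxy : forall x y, `|y| < Rr -> is_derive y 1 (fun t => dux D (x, t)) (duxy D (x, y));
  sol_uyx : forall x y, `|y| < Rr -> is_derive x 1 (fun t => duy D (t, y)) (duxy D (x, y));
  sol_uyy : forall x y, `|y| < Rr -> is_derive y 1 (fun t => duy D (x, t)) (duyy D (x, y));
  sol_vxx : forall x y, `|y| < Rr -> is_derive x 1 (fun t => dvx D (t, y)) (dvxx D (x, y));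
  sol_vxy : forall x y, `|y| < Rr -> is_derive y 1 (fun t => dvx D (x, t)) (duxx D (x, y));
  sol_cux : forall x y, `|y| < Rr -> {for (x, y), continuous (dux D)};
  sol_cuy : forall x y, `|y| < Rr -> {for (x, y), continuous (duy D)};
  sol_cvx : forall x y, `|y| < Rr -> {for (x, y), continuous (dvx D)};
  sol_cuxy : forall x y, `|y| < Rr -> {for (x, y), continuous (duxy D)} }.

Lemma scontB Rr f g : scont Rr f -> scont Rr g -> scont Rr (fun p => f p - g p).
Proof.
move=> cf cg p sp e e0; have [d1 d10 H1] := cf p sp (e / 2) ltac:(lra).
have [d2 d20 H2] := cg p sp (e / 2) ltac:(lra).
exists (Num.min d1 d2); first by rewrite lt_min d10.
move=> q sq; rewrite !lt_min => /andP[a1 a2] /andP[b1 b2].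
have := H1 q sq a1 b1; have := H2 q sq a2 b2.
rewrite (_ : f q - g q - _ = (f q - f p) - (g q - g p)); last by ring.
by move=> h1 h2; apply: (le_lt_trans (ler_normB _ _)); lra.
Qed.

Lemma scont_slice Rr f y : scont Rr f -> `|y| <= Rr -> continuous (fun x => f (x, y)).
Proof.
move=> cf yR x; apply/continuous_atP => e e0; have [d d0 H] := cf (x, y) yR e e0.
by exists d => // z zx; apply: H => //=; rewrite subrr normr0.
Qed.

Lemma scont_int Rr f x y : scont Rr f -> `|y| < Rr -> {for (x, y), continuous f}.
Proof.
move=> cf yR; apply/continuous2_atP => e e0; have [d d0 H] := cf (x, y) (ltW yR) e e0.
exists (Num.min d (Rr - `|y|)); first by rewrite lt_min d0 subr_gt0.
move=> q; rewrite !lt_min => /andP[q1 _] /andP[q2 q3]; apply: H => //.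
rewrite /strip /=; have := ler_normD (q.2 - y) y; rewrite subrK => h.
by apply: (le_trans h); move: q3 => /=; lra.
Qed.

(** Retraction of the line onto a segment. Composing with it extends a function on the strip to a
    continuous function on the plane, to which the lemmas on integrals and extreme values apply. *)
Definition clamp Rr y := Num.max (- Rr) (Num.min y Rr).

Lemma clamp_id Rr y : `|y| <= Rr -> clamp Rr y = y.
Proof.
move=> /ler_normlP [h1 h2]; rewrite /clamp (min_idPl h2); apply/max_idPr; lra.
Qed.

Lemma clamp_le Rr y : 0 <= Rr -> `|clamp Rr y| <= Rr.
Proof.
move=> R0; rewrite /clamp; apply/ler_normlP; split.
  by rewrite lerNl le_max lexx.
by rewrite ge_max ge_min lexx orbT andbT; lra.
Qed.

Lemma clamp_lip Rr y z : 0 <= Rr -> `|clamp Rr y - clamp Rr z| <= `|y - z|.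
Proof.
move=> R0; rewrite /clamp.
case: (leP y Rr) => h1; case: (leP z Rr) => h2; rewrite ?maxEle;
  repeat case: ifPn; rewrite -?ltNge => *; apply/ler_normlP; split;
  try (have := ler_norm (y - z)); have := ler_norm (- (y - z)); rewrite normrN;
  lra.
Qed.

Lemma scont_clamp Rr f : 0 <= Rr -> scont Rr f ->
  continuous (fun p : R * R => f (p.1, clamp Rr p.2)).
Proof.
move=> R0 cf; apply: ctsP => -[x y]; apply/continuous2_atP => e e0.
have [d d0 H] := cf (x, clamp Rr y) (clamp_le y R0) e e0.
exists d => // q h1 h2; apply: H => //=; first exact: clamp_le.
by apply: le_lt_trans h2; exact: clamp_lip.
Qed.

(** Clamping to a smaller strip is meant for derivatives, whose continuity is known in the open
    strip. *)
Lemma continuous_clamp Rr r f : 0 <= r -> r < Rr ->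
  (forall x y, `|y| < Rr -> {for (x, y), continuous f}) ->
  continuous (fun p : R * R => f (p.1, clamp r p.2)).
Proof.
move=> r0 rR cf; apply: ctsP => -[x y]; apply/continuous2_atP => e e0.
have [d d0 H] := (continuous2_atP _ _).1 (cf x (clamp r y) (le_lt_trans (clamp_le y r0) rR)) e e0.
exists d => // q h1 h2; apply: H => //=.
by apply: le_lt_trans h2; exact: clamp_lip.
Qed.

Lemma continuous_int3 (f : R * R -> R) B : continuous f -> (forall p, `|f p| <= B) ->
  continuous (fun q : R * R * R => integ (fun s => f (s, q.2)) q.1.1 (q.1.1 + q.1.2)).
Proof.
move=> cf fB; apply: ctsP => -[[x d] y]; apply/cvgrPdist_lt => e e0 /=.
have c1 z : continuous (fun s => f (s, z)) by move=> s; exact: continuous_slice1 (cf _).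
have B0 : 0 <= B by apply: le_trans (fB (0, 0)).
have bnd z s t : `|integ (fun s => f (s, z)) s t| <= B * `|t - s|.
  case: (leP s t) => st.
    by rewrite (ger0_norm (_ : 0 <= t - s)) ?subr_ge0//; apply: int_norm_le.
  rewrite int_swap normrN [`|t - s|]distrC.
  have ts := ltW st; rewrite [`|s - t|]ger0_norm ?subr_ge0 //.
  by apply: int_norm_le.
have cI : {for y, continuous (fun z => integ (fun s => f (s, z)) x (x + d))}.
  case: (leP x (x + d)) => h.
    by apply: (@continuous_int _ f x (x + d) y 1) => // *; [exact: c1|exact: cf].
  apply: (@cts_ext _ _ (fun y => - integ (fun s => f (s, y)) (x + d) x)).
    by move=> z; rewrite /integ opprB.
  apply: ctsN; apply: (@continuous_int _ f (x + d) x y 1) => //; first exact: ltW.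
  + by move=> *; exact: c1.
  + by move=> *; exact: cf.
have [k k0 K] := (continuous_atP _ _).1 cI (e / 2) ltac:(lra).
have m0 : 0 < e / (8 * (B + 1)) by rewrite divr_gt0 //; lra.
pose m := Num.min k (e / (8 * (B + 1))).
have mp : 0 < m by rewrite lt_min k0 m0.
exists ((ball x m `*` ball d m), ball y m).
  split; last exact: nbhsx_ballx.
  by exists (ball x m, ball d m); [split; exact: nbhsx_ballx|].
move=> [[x1 d1] y1] [[/= h1 h2] h3].
have {h1} : `|x1 - x| < m by rewrite distrC.
have {h2} : `|d1 - d| < m by rewrite distrC.
have {h3} : `|y1 - y| < m by rewrite distrC.
rewrite !lt_min => /andP[y3 _] /andP[_ d3] /andP[_ x3].
rewrite distrC.
(* The change of height is separated from the motion of the two ends; the latter costs at most [B]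
   times the displacement. *)
have -> : integ (fun s => f (s, y1)) x1 (x1 + d1) - integ (fun s => f (s, y)) x (x + d) =
  (integ (fun s => f (s, y1)) x (x + d) - integ (fun s => f (s, y)) x (x + d))
  + integ (fun s => f (s, y1)) x1 x + integ (fun s => f (s, y1)) (x + d) (x1 + d1).
  by rewrite /integ; ring.
have b1 := bnd y1 x1 x; have b2 := bnd y1 (x + d) (x1 + d1); have b3 := K y1 y3.
have b4 : `|x1 + d1 - (x + d)| <= `|x1 - x| + `|d1 - d|.
  by rewrite (_ : x1 + d1 - (x + d) = (x1 - x) + (d1 - d)) ?ler_normD//; ring.
rewrite [in X in _ <= X]distrC in b1.
have b5 : B * (`|x1 - x| + `|x1 + d1 - (x + d)|) <= e / 8 * 3.
  apply: (@le_trans _ _ ((B + 1) * (3 * (e / (8 * (B + 1)))))).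
    apply: ler_pM => //; try lra; by rewrite addr_ge0.
  by rewrite le_eqVlt; apply/orP; left; apply/eqP; field; rewrite gt_eqF//; lra.
apply: (le_lt_trans (ler_normD _ _)); have := ler_normD
  (integ (fun s => f (s, y1)) x (x + d) - integ (fun s => f (s, y)) x (x + d)) (integ (fun s => f (s, y1)) x1 x).
lra.
Qed.

Lemma evt3 (f : R * R * R -> R) a1 b1 a2 b2 a3 b3 : continuous f ->
  a1 <= b1 -> a2 <= b2 -> a3 <= b3 ->
  exists x y z, [/\ a1 <= x <= b1, a2 <= y <= b2, a3 <= z <= b3 &
    forall x' y' z', a1 <= x' <= b1 -> a2 <= y' <= b2 -> a3 <= z' <= b3 ->
      f (x, y, z) <= f (x', y', z')].
Proof.
move=> cf h1 h2 h3.
have cK : compact ((`[a1, b1] `*` `[a2, b2]) `*` `[a3, b3] : set (R * R * R)).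
  by apply: compact_setX; [apply: compact_setX|]; exact: segment_compact.
have K0 : ((`[a1, b1] `*` `[a2, b2]) `*` `[a3, b3] : set (R * R * R)) !=set0.
  by exists (a1, a2, a3); split; [split|] => /=; rewrite in_itv /= lexx.
have [[[x y] z] + m] := compact_EVT_min K0 cK (continuous_subspaceT cf).
rewrite inE => -[[/=]]; rewrite !in_itv /= => hx hy hz.
exists x, y, z; split=> // x' y' z' hx' hy' hz'; apply: m; rewrite inE.
by split; [split|] => /=; rewrite in_itv.
Qed.

Lemma sqr_le_norm y r : `|y| <= r -> y ^+ 2 <= r ^+ 2.
Proof.
move=> h; rewrite -(real_normK (num_real y)) ler_pXn2r // nnegrE //.
exact: le_trans h.
Qed.

Lemma sqr_ge_norm y r : 0 <= r -> r <= `|y| -> r ^+ 2 <= y ^+ 2.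
Proof.
by move=> r0 h; rewrite -(real_normK (num_real y)) ler_pXn2r // nnegrE.
Qed.

Lemma wt_gt0 a (v : R) y : a != 0 -> 0 < wt a v y.
Proof.
move=> a0; rewrite sqrtr_gt0; have : 0 < a ^+ 2 by rewrite exprn_even_gt0.
by have := sqr_ge0 v; have := sqr_ge0 y; lra.
Qed.

Lemma wt_ge_a a (v : R) y : `|a| <= wt a v y.
Proof.
rewrite -sqrtr_sqr; apply: ler_wsqrtr; have := sqr_ge0 v; have := sqr_ge0 y; lra.
Qed.

Lemma wt_ge_y a (v : R) y : `|y| <= wt a v y.
Proof.
rewrite -sqrtr_sqr; apply: ler_wsqrtr; have := sqr_ge0 v; have := sqr_ge0 a; lra.
Qed.

Lemma sqr_wt a (v : R) y : wt a v y ^+ 2 = v ^+ 2 + y ^+ 2 + a ^+ 2.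
Proof.
rewrite sqr_sqrtr //; have := sqr_ge0 v; have := sqr_ge0 a; have := sqr_ge0 y; lra.
Qed.

Lemma wt_lip a (v1 v2 : R) y : `|wt a v1 y - wt a v2 y| <= `|v1 - v2|.
Proof.
have H w1 w2 : wt a w1 y <= wt a w2 y + `|w1 - w2|.
  rewrite -(@ler_pXn2r _ 2) ?nnegrE ?addr_ge0 ?sqrtr_ge0 ?normr_ge0 // sqrrD !sqr_wt.
  rewrite (real_normK (num_real (w1 - w2))).
  have h1 : `|w2| * `|w1 - w2| <= wt a w2 y * `|w1 - w2|.
    apply: ler_wpM2r => //; rewrite -sqrtr_sqr; apply: ler_wsqrtr.
    by have := sqr_ge0 y; have := sqr_ge0 a; lra.
  have h2 : w2 * (w1 - w2) <= `|w2| * `|w1 - w2|.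
    by rewrite -normrM ler_norm.
  have : w1 ^+ 2 = w2 ^+ 2 + 2 * (w2 * (w1 - w2)) + (w1 - w2) ^+ 2 by ring.
  by move=> ->; rewrite mulr2n; lra.
apply/ler_normlP; split; first by have := H v2 v1; rewrite distrC; lra.
by have := H v1 v2; lra.
Qed.

Lemma wtV_lip a (v1 v2 : R) y : a != 0 ->
  `|(wt a v1 y)^-1 - (wt a v2 y)^-1| <= `|v1 - v2| / a ^+ 2.
Proof.
move=> a0; have q1 := wt_gt0 v1 y a0; have q2 := wt_gt0 v2 y a0.
have -> : (wt a v1 y)^-1 - (wt a v2 y)^-1 = (wt a v2 y - wt a v1 y) / (wt a v1 y * wt a v2 y).
  by field; rewrite !gt_eqF.
have aa : 0 < a ^+ 2 by rewrite exprn_even_gt0.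
rewrite normrM normfV (gtr0_norm (mulr_gt0 q1 q2)).
apply: ler_pM; rewrite ?invr_ge0 ?normr_ge0 //.
- by rewrite ltW // mulr_gt0.
- by rewrite [X in _ <= X]distrC; exact: wt_lip.
have h : a ^+ 2 <= wt a v1 y * wt a v2 y.
  by rewrite -(real_normK (num_real a)) expr2; apply: ler_pM; rewrite ?normr_ge0 ?wt_ge_a.
by rewrite lef_pV2 // posrE // mulr_gt0.
Qed.

Lemma int_diff_y Rr a1 a2 u1 v1 D1 u2 v2 D2 x x' y :
  is_sol Rr a1 u1 v1 D1 -> is_sol Rr a2 u2 v2 D2 -> x <= x' -> `|y| < Rr ->
  is_derive y 1 (fun z => integ (fun s => v1 (s, z) - v2 (s, z)) x x')
    ((u1 (x', y) - u2 (x', y)) - (u1 (x, y) - u2 (x, y))).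
Proof.
move=> S1 S2 xx yR; pose w p := v1 p - v2 p. pose f p := dux D1 p - dux D2 p.
have cfy z : `|z| < Rr -> continuous (fun s => f (s, z)).
  move=> zR; apply: ctsP => s; apply: ctsB; apply: continuous_slice1;
    [exact: sol_cux S1 _ _ zR|exact: sol_cux S2 _ _ zR].
have sm z : `|z - y| < Rr - `|y| -> `|z| < Rr.
  by move=> h; have := ler_normD (z - y) y; rewrite subrK; lra.
have -> : u1 (x', y) - u2 (x', y) - (u1 (x, y) - u2 (x, y)) = integ (fun s => f (s, y)) x x'.
  apply/esym; apply: (intE' (F := fun s => u1 (s, y) - u2 (s, y))) => //; first exact: cfy.
  by move=> s _; apply: dB; [exact: sol_ux S1 _ _ yR|exact: sol_ux S2 _ _ yR].
apply: (@int_param_derive _ w f x x' y (Rr - `|y|)) => //; first by rewrite subr_gt0.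
- move=> s z /sm zR; apply: (scont_slice _ (ltW zR)).
  by apply: scontB; [exact: sol_cv S1|exact: sol_cv S2].
- by move=> s z _ /sm zR; apply: dB; [exact: sol_vy S1 _ _ zR|exact: sol_vy S2 _ _ zR].
- by move=> s; exact: cfy.
- by move=> s _; apply: ctsB; [exact: sol_cux S1 _ _ yR|exact: sol_cux S2 _ _ yR].
Qed.

(* The integral is minimised over a box of the three variables: at an interior minimum [v1 = v2] at both
   ends, so the equations turn the second-order conditions in [x] and [x'] into the opposite sign for
   the second derivative in [y].  The term [s * (x - X) ^+ 2] is needed as [v1] is not assumed periodic. *)
Lemma int_comparison Rr P a1 a2 B C theta delta m u1 v1 D1 u2 v2 D2 :
  0 < Rr -> 0 < P -> a1 != 0 -> a2 != 0 ->
  is_sol Rr a1 u1 v1 D1 -> is_sol Rr a2 u2 v2 D2 ->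
  let w p := v1 p - v2 p in let W y x x' := integ (fun s => w (s, y)) x x' in
  (forall p, strip Rr p -> `|w p| <= B) ->
  (forall p, ostrip Rr p -> `|dvx D2 p| <= C) ->
  (forall V y, `|(wt a1 V y)^-1 - (wt a2 V y)^-1| <= theta) ->
  C * theta < 2 * delta -> 0 <= m ->
  (forall x x', x <= x' <= x + P -> - m <= W Rr x x') ->
  (forall x x', x <= x' <= x + P -> - m <= W (- Rr) x x') ->
  (forall x y, `|y| <= Rr -> - m <= W y x (x + P)) ->
  forall x x' y, x <= x' <= x + P -> `|y| <= Rr -> - m - delta * Rr ^+ 2 <= W y x x'.
Proof.
move=> R0 P0 a10 a20 S1 S2 w W wB vC th hd m0 bp bm bP X X' Y hX hY.
rewrite leNgt; apply/negP => hlt.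
have cw : scont Rr w by apply: scontB; [exact: sol_cv S1|exact: sol_cv S2].
have B0 : 0 <= B by apply: le_trans (wB (0, 0) _); rewrite // /strip /= normr0 ltW.
have C0 : 0 <= C by apply: le_trans (vC (0, 0) _); rewrite // /ostrip /= normr0.
have a1n : 0 < `|a1| by rewrite normr_gt0.
have a1s : 0 < a1 ^+ 2 by rewrite exprn_even_gt0.
have th0 : 0 <= theta by exact: le_trans (th 0 0).
have d0 : 0 <= delta by have := mulr_ge0 C0 th0; lra.
set kap := 2 * delta - C * theta; have kap0 : 0 < kap by rewrite subr_gt0.
(* [L] is the half-width of the range of [x] and [sg] the strength of the penalty. As
   [sg * L ^+ 2 = B * P] dominates every window integral, no minimum lies at [|x - X| = L]; and [L]
   is so large that the errors due to the penalty stay below [kap], the margin in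
   [C * theta < 2 * delta]. *)
set N := B * P / `|a1| + C * (B * P) / a1 ^+ 2.
have BP0 : 0 <= B * P by rewrite mulr_ge0 // ltW.
have N0 : 0 <= N.
  rewrite /N; apply: addr_ge0; first exact: divr_ge0 BP0 (normr_ge0 _).
  exact: divr_ge0 (mulr_ge0 C0 BP0) (sqr_ge0 _).
set L := 1 + N / kap; have L1 : 1 <= L by rewrite lerDl divr_ge0 // ltW.
have L0 : 0 < L by lra.
set sg := B * P / L ^+ 2.
have sg0 : 0 <= sg by rewrite divr_ge0 // sqr_ge0.
have sgL : sg * L ^+ 2 = B * P by rewrite /sg divfK // gt_eqF // exprn_gt0.
have small : sg / `|a1| + C * (sg * L) / a1 ^+ 2 < kap.
  have NL : N / L < kap.
    rewrite ltr_pdivrMr // /L mulrDr mulr1 mulrC divfK ?gt_eqF //; lra.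
  apply: le_lt_trans NL; rewrite /N mulrDl lerD //.
    rewrite /sg ![_ / `|a1|]mulrC -[X in _ <= X]mulrA ler_wpM2l ?invr_ge0 ?normr_ge0 //.
    rewrite ler_wpM2l // lef_pV2 ?posrE ?exprn_gt0 // expr2 -[X in X <= _]mulr1.
    by rewrite ler_wpM2l // ltW.
  have -> : sg * L = B * P / L by rewrite /sg; field; rewrite gt_eqF.
  by rewrite le_eqVlt; apply/orP; left; apply/eqP; field; rewrite a10 gt_eqF.
pose wc (p : R * R) := w (p.1, clamp Rr p.2).
have cwc : continuous wc by apply: scont_clamp => //; exact: ltW.
have wcB p : `|wc p| <= B by apply: wB; rewrite /strip /=; apply: clamp_le; exact: ltW.
(* A window is given by its left end and its length, so that the domain is a box. The concave term
   in [y] contributes [- 2 * delta] to the second derivative, which outweighs the error caused by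
   [a1] and [a2] being different. *)
pose Psi (q : R * R * R) := integ (fun s => wc (s, q.2)) q.1.1 (q.1.1 + q.1.2)
   - delta * q.2 ^+ 2 + sg * (q.1.1 - X) ^+ 2.
have cPsi : continuous Psi.
  have c1 : continuous (fun q : R * R * R => q.1.1).
    by move=> q; apply: (@continuous_comp _ _ _ fst fst); exact: cvg_fst.
  have c2 : continuous (fun q : R * R * R => q.2) by move=> q; exact: cvg_snd.
  apply: ctsP => q; apply: ctsD; first apply: ctsB.
  - exact: (continuous_int3 cwc wcB).
  - by apply: ctsM; [exact: cts_cst|apply: ctsX; exact: c2].
  - apply: ctsM; first exact: cts_cst.
    by apply: ctsX; apply: ctsB; [exact: c1|exact: cts_cst].
have PsiE x d y : `|y| <= Rr -> Psi (x, d, y) = W y x (x + d) - delta * y ^+ 2 + sg * (x - X) ^+ 2.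
  by move=> yR; rewrite /Psi /W /wc /= clamp_id.
have PsiE' x x' y : `|y| <= Rr -> Psi (x, x' - x, y) = W y x x' - delta * y ^+ 2 + sg * (x - X) ^+ 2.
  by move=> yR; rewrite PsiE // (_ : x + (x' - x) = x') //; ring.
have kapE : kap = 2 * delta - C * theta by [].
clearbody Psi; clear wc cwc wcB; clearbody sg; clearbody L; clearbody N; clearbody kap.
have hXL : X - L <= X + L by clear -L0; lra.
have hRR : - Rr <= Rr by clear -R0; lra.
have [x [d [y [hx hd' hy mn]]]] := evt3 cPsi hXL (ltW P0) hRR.
have yR : `|y| <= Rr by apply/ler_normlP; clear -hy; split; lra.
have y2 : y ^+ 2 <= Rr ^+ 2 by exact: sqr_le_norm.
have dy2 : delta * y ^+ 2 <= delta * Rr ^+ 2 by rewrite ler_wpM2l.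
have val : Psi (x, d, y) < - m - delta * Rr ^+ 2.
  apply: le_lt_trans hlt; have := mn X (X' - X) Y.
  rewrite PsiE' // subrr expr0n mulr0 addr0 => h.
  have /ler_normlP [h1 h2] := hY.
  have b1 : X - L <= X <= X + L by clear -L0; lra.
  have b2 : 0 <= X' - X <= P by clear -hX; lra.
  have b3 : - Rr <= Y <= Rr by clear -h1 h2; lra.
  apply: (le_trans (h b1 b2 b3)).
  by rewrite gerBl mulr_ge0 ?sqr_ge0.
rewrite PsiE // in val.
have sx2 : 0 <= sg * (x - X) ^+ 2 by rewrite mulr_ge0 ?sqr_ge0.
have xL : `|x - X| < L.
  rewrite ltNge; apply/negP => h.
  have : L ^+ 2 <= (x - X) ^+ 2 by apply: sqr_ge_norm => //; exact: ltW.
  move/(ler_wpM2l sg0); rewrite sgL => h2.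
  have : `|W y x (x + d)| <= B * (x + d - x).
    apply: int_norm_le; [exact: scont_slice cw yR|by rewrite lerDl; case/andP: hd'|].
    by move=> s _; exact: wB.
  rewrite addrAC subrr add0r => /ler_normlP [h3 _].
  have : B * d <= B * P by rewrite ler_wpM2l //; case/andP: hd'.
  by clear -m0 dy2 h2 h3 val; lra.
have dpos : 0 < d.
  rewrite lt0r; apply/andP; split; last by case/andP: hd'.
  apply: contraTN val => /eqP ->; rewrite addr0 /W intxx -leNgt.
  by clear -dy2 sx2 m0; lra.
have dP : d < P.
  rewrite lt_neqAle; apply/andP; split; last by case/andP: hd'.
  apply: contraTN val => /eqP ->; rewrite -leNgt; have := bP x y yR.
  by clear -dy2 sx2; lra.
have hxd : x <= x + d <= x + P by clear -dpos dP; lra.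
have yR' : `|y| < Rr.
  rewrite lt_neqAle yR andbT; apply: contraTN val => /eqP h.
  have [->|->] : y = Rr \/ y = - Rr.
    by case: (leP 0 y) => h0; [left; rewrite -h ger0_norm|right; rewrite -h ltr0_norm // opprK].
  - by rewrite -leNgt; have := bp x (x + d) hxd; clear -sx2; lra.
  - by rewrite -leNgt sqrrN; have := bm x (x + d) hxd; clear -sx2; lra.
set x' := x + d in val hxd *.
have cwy := scont_slice cw yR.
have dw s : is_derive s 1 (fun t => w (t, y)) (dvx D1 (s, y) - dvx D2 (s, y)).
  by apply: dB; [exact: sol_vx S1 _ _ yR'|exact: sol_vx S2 _ _ yR'].
(* Only the right end moves: the derivatives of the window integral are [w] and its [x]-derivative
   there. *)
have [w1 w1x] : w (x', y) = 0 /\ 0 <= dvx D1 (x', y) - dvx D2 (x', y).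
  apply: (@local_min_derive2 _ (W y x) (fun t => w (t, y)) x' _ (Num.min d (P - d))).
  - by rewrite lt_min dpos subr_gt0.
  - by move=> t _; exact: int_deriv.
  - move=> t; rewrite lt_min => /andP[/ltr_normlP[t1 t2] /ltr_normlP[t3 t4]].
    have := mn x (t - x) y hx _ hy; rewrite PsiE' // PsiE // -/x' => h.
    have b2 : 0 <= t - x <= P by rewrite /x' in t1 t2 t3 t4; clear -t1 t2 t3 t4; lra.
    by move: (h b2); clear; lra.
(* The left end moves with [x'] fixed, so the length changes as well. The penalty enters here: [w]
   is small at this end but need not vanish. *)
have [w0 w0x] : - w (x, y) + sg * (2 * (x - X)) = 0
   /\ 0 <= - (dvx D1 (x, y) - dvx D2 (x, y)) + sg * 2.
  apply: (@local_min_derive2 _ (fun t => W y t x' + sg * (t - X) ^+ 2)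
    (fun t => - w (t, y) + sg * (2 * (t - X))) x _ (Num.min (Num.min d (P - d)) (L - `|x - X|))).
  - by rewrite !lt_min dpos !subr_gt0 dP.
  - move=> t _.
    have h := dD (int_derivl x' t cwy) (dZ sg (d_sqr (dB (d_id t) (d_cst X t)))).
    by apply: d_eq h; ring.
  - have h := dD (dN (dw x)) (dZ sg (dZ 2 (dB (d_id x) (d_cst X x)))).
    by apply: d_eq h; ring.
  - move=> t; rewrite !lt_min => /andP[/andP[/ltr_normlP[t1 t2] /ltr_normlP[t3 t4]] t5].
    have /ltr_normlP[t6 t7] : `|t - X| < L.
      by have := ler_normD (t - x) (x - X); rewrite addrA subrK; clear -t5; lra.
    have := mn t (x' - t) y _ _ hy; rewrite PsiE' // PsiE // -/x' => h.
    have b1 : X - L <= t <= X + L by clear -t6 t7; lra.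
    have b2 : 0 <= x' - t <= P by rewrite /x'; clear -t1 t2 t3 t4; lra.
    by move: (h b1 b2); clear; lra.
have [_ Uy] : (u1 (x', y) - u2 (x', y)) - (u1 (x, y) - u2 (x, y)) - delta * (2 * y) = 0
  /\ 0 <= (duy D1 (x', y) - duy D2 (x', y)) - (duy D1 (x, y) - duy D2 (x, y)) - delta * 2.
  apply: (@local_min_derive2 _ (fun t => W t x x' - delta * t ^+ 2)
    (fun t => (u1 (x', t) - u2 (x', t)) - (u1 (x, t) - u2 (x, t)) - delta * (2 * t)) y _ (Rr - `|y|)).
  - by rewrite subr_gt0.
  - move=> t ty; have tR : `|t| < Rr by have := ler_normD (t - y) y; rewrite subrK; clear -ty; lra.
    have xx' : x <= x' by case/andP: hxd.
    have h := dB (int_diff_y S1 S2 xx' tR) (dZ delta (d_sqr (d_id t))).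
    by apply: d_eq h; ring.
  - have h s := dB (sol_uy S1 s yR') (sol_uy S2 s yR').
    have {}h := dB (dB (h x') (h x)) (dZ delta (dZ 2 (d_id y))).
    by apply: d_eq h; ring.
  - move=> t ty; have tR : `|t| <= Rr by have := ler_normD (t - y) y; rewrite subrK; clear -ty; lra.
    have := mn x d t hx hd'; rewrite !PsiE // -/x' => h.
    have /ler_normlP [t1 t2] := tR.
    have b3 : - Rr <= t <= Rr by clear -t1 t2; lra.
    by move: (h b3); clear; lra.
(* With the second equation solved for [u_y], the difference splits into one of [v_x], whose sign at
   the minimum is controlled, and one of inverse weights, which is estimated below. *)
have dual p1 : p1 = x \/ p1 = x' -> duy D1 (p1, y) - duy D2 (p1, y) =
   - ((dvx D1 (p1, y) - dvx D2 (p1, y)) / (2 * wt a1 (v1 (p1, y)) y))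
   - dvx D2 (p1, y) / 2 * ((wt a1 (v1 (p1, y)) y)^-1 - (wt a2 (v2 (p1, y)) y)^-1).
  move=> _; have q1 := wt_gt0 (v1 (p1, y)) y a10; have q2 := wt_gt0 (v2 (p1, y)) y a20.
  rewrite (sol_eq S1 p1 yR') (sol_eq S2 p1 yR').
  by field; rewrite !gt_eqF.
rewrite (dual x') ?(dual x) in Uy; [|by left|by right].
have e1 : - ((dvx D1 (x', y) - dvx D2 (x', y)) / (2 * wt a1 (v1 (x', y)) y)) <= 0.
  rewrite oppr_le0 divr_ge0 // mulr_ge0 // ltW //; exact: wt_gt0.
have e2 : (dvx D1 (x, y) - dvx D2 (x, y)) / (2 * wt a1 (v1 (x, y)) y) <= sg / `|a1|.
  have q1 := wt_gt0 (v1 (x, y)) y a10.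
  rewrite ler_pdivrMr ?mulr_gt0 // mulrAC ler_pdivlMr //.
  apply: (@le_trans _ _ (sg * 2 * `|a1|)); first by rewrite ler_wpM2r //; clear -w0x; lra.
  rewrite -mulrA ler_wpM2l // ler_wpM2l //; exact: wt_ge_a.
have bnd p1 k : `|(wt a1 (v1 (p1, y)) y)^-1 - (wt a2 (v2 (p1, y)) y)^-1| <= k ->
   `|dvx D2 (p1, y) / 2 * ((wt a1 (v1 (p1, y)) y)^-1 - (wt a2 (v2 (p1, y)) y)^-1)| <= C / 2 * k.
  move=> h; rewrite normrM; apply: ler_pM => //.
  rewrite normrM (ger0_norm (_ : 0 <= 2^-1)) // ler_wpM2r //; exact: vC.
have /ler_normlP[f1 _] : `|dvx D2 (x', y) / 2 * ((wt a1 (v1 (x', y)) y)^-1 - (wt a2 (v2 (x', y)) y)^-1)| <= C / 2 * theta.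
  apply: bnd; have -> : v1 (x', y) = v2 (x', y) by move: w1; rewrite /w; clear; lra.
  exact: th.
have wx : `|v1 (x, y) - v2 (x, y)| <= 2 * (sg * L).
  rewrite -/(w (x, y)) (_ : w (x, y) = 2 * (sg * (x - X))); last by clear -w0; lra.
  have s20 : 0 <= 2 * sg by rewrite mulr_ge0.
  have -> : 2 * (sg * (x - X)) = 2 * sg * (x - X) by ring.
  have -> : 2 * (sg * L) = 2 * sg * L by ring.
  by rewrite normrM (ger0_norm s20) ler_wpM2l // ltW.
have /ler_normlP[_ f2] : `|dvx D2 (x, y) / 2 * ((wt a1 (v1 (x, y)) y)^-1 - (wt a2 (v2 (x, y)) y)^-1)|
    <= C / 2 * (2 * (sg * L) / a1 ^+ 2 + theta).
  apply: bnd; apply: (le_trans _ (lerD _ (th (v2 (x, y)) y))); last first.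
    apply: (le_trans (wtV_lip (v1 (x, y)) (v2 (x, y)) y a10)).
    by rewrite ler_wpM2r // invr_ge0 ltW.
  by rewrite -[X in `|X| <= _](subrKA (wt a1 (v2 (x, y)) y)^-1) ler_normD.
have e3 : C / 2 * (2 * (sg * L) / a1 ^+ 2 + theta) = C * (sg * L) / a1 ^+ 2 + C * theta / 2.
  by field; exact: a10.
rewrite e3 in f2; move: small; rewrite kapE => small.
clear -small f1 f2 e1 e2 Uy; lra.
Qed.

End Solutions.

(** * Classical solutions and the symmetries of the system *)

Section FromDefs.
Context {R : realType}.
Implicit Types (x y z t e d r k s m P : R) (u v f g : R * R -> R) (Rr a : R).

Lemma within_scont Rr f : {within strip Rr, continuous f} -> scont Rr f.
Proof.
move=> /subspace_continuousP h p sp e e0.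
have /cvgrPdist_lt/(_ e e0) := h p sp.
rewrite /= near_withinE => /(@nbhs_ballP R (R * R)%type p) [d /= d0 H].
exists d => // q sq h1 h2; rewrite distrC; apply: H => //.
by split; rewrite /ball /= distrC.
Qed.

Lemma continuous_eq_ostrip Rr f g x y : (forall p, ostrip Rr p -> f p = g p) -> `|y| < Rr ->
  {for (x, y), continuous g} -> {for (x, y), continuous f}.
Proof.
move=> fg yR /continuous2_atP cg; apply/continuous2_atP => e e0; have [d d0 H] := cg e e0.
exists (Num.min d (Rr - `|y|)); first by rewrite lt_min d0 subr_gt0.
move=> q; rewrite !lt_min => /andP[q1 _] /andP[q2 q3]; rewrite !fg //; first exact: H.
rewrite /ostrip /=; have := ler_normD (q.2 - y) y; rewrite subrK => h.
by apply: (le_lt_trans h); move: q3 => /=; lra.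
Qed.

(** Differentiating the integral of [fx] over [[x - 1, x']] in [y] shows that increments of [fy] in
    [x] are integrals of [fxy]; it remains to differentiate in the upper end. *)
Lemma clairaut Rr f (fx fy fxy fyx : R * R -> R) :
  (forall x y, `|y| < Rr -> is_derive x 1 (fun t => f (t, y)) (fx (x, y))) ->
  (forall x y, `|y| < Rr -> is_derive y 1 (fun t => f (x, t)) (fy (x, y))) ->
  (forall x y, `|y| < Rr -> is_derive y 1 (fun t => fx (x, t)) (fxy (x, y))) ->
  (forall x y, `|y| < Rr -> is_derive x 1 (fun t => fy (t, y)) (fyx (x, y))) ->
  (forall x y, `|y| < Rr -> {for (x, y), continuous fx}) ->
  (forall x y, `|y| < Rr -> {for (x, y), continuous fxy}) ->
  forall x y, `|y| < Rr -> fxy (x, y) = fyx (x, y).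
Proof.
move=> hx hy hxy hyx cfx cfxy x y yR.
have sm z : `|z - y| < Rr - `|y| -> `|z| < Rr.
  by move=> h; have := ler_normD (z - y) y; rewrite subrK; lra.
have csl z : `|z| < Rr -> continuous (fun s => fx (s, z)).
  by move=> zR s; exact: continuous_slice1 (cfx s z zR).
have cslxy : continuous (fun s => fxy (s, y)).
  by move=> s; exact: continuous_slice1 (cfxy s y yR).
have r0 : 0 < Rr - `|y| by rewrite subr_gt0.
have E x' : x - 1 <= x' -> fy (x', y) - fy (x - 1, y) = integ (fun s => fxy (s, y)) (x - 1) x'.
  move=> xx; apply: is_derive_uniq (dB (hy x' y yR) (hy (x - 1) y yR)) _.
  apply: (is_derive_near r0) (_ : forall z, `|z - y| < Rr - `|y| ->
      integ (fun s => fx (s, z)) (x - 1) x' = _) _.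
    move=> z /sm zR; apply: (@intE' _ (fun s => fx (s, z)) (fun t => f (t, z))) => //.
      exact: csl.
    by move=> s _; exact: hx.
  apply: (@int_param_derive _ fx fxy _ _ y (Rr - `|y|)) => //.
  - by move=> s z /sm zR; exact: csl.
  - by move=> s z _ /sm zR; exact: hxy.
  - by move=> s _; exact: cfxy.
apply: is_derive_uniq (int_deriv (x - 1) x cslxy) _.
apply: (is_derive_near (e := 1) ltr01) (_ : forall z, `|z - x| < 1 -> fy (z, y) - fy (x - 1, y) = _) _.
  by move=> z /ltr_normlP [h1 h2]; apply: E; lra.
by have := dB (hyx x y yR) (d_cst (fy (x - 1, y)) x); rewrite subr0.
Qed.

Lemma Ck_px Rr (k : nat) f (s : seq bool) : Ck_strip Rr k f -> (size s < k)%N ->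
  forall x y, `|y| < Rr -> is_derive x 1 (fun t => Dseq s f (t, y)) (px (Dseq s f) (x, y)).
Proof.
move=> [_ [h _]] sk x y yR; have [/= h1 _] := h s sk (x, y) yR.
by rewrite /px /= derive1E; exact: derivableP.
Qed.

Lemma Ck_py Rr (k : nat) f (s : seq bool) : Ck_strip Rr k f -> (size s < k)%N ->
  forall x y, `|y| < Rr -> is_derive y 1 (fun t => Dseq s f (x, t)) (py (Dseq s f) (x, y)).
Proof.
move=> [_ [h _]] sk x y yR; have [/= _ h1] := h s sk (x, y) yR.
by rewrite /py /= derive1E; exact: derivableP.
Qed.

Lemma Ck_cont Rr (k : nat) f (s : seq bool) : Ck_strip Rr k f -> (size s <= k)%N ->
  forall x y, `|y| < Rr -> {for (x, y), continuous (Dseq s f)}.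
Proof.
move=> [_ [_ h]] sk x y yR; have [g [cg fg]] := h s sk.
apply: (continuous_eq_ostrip fg yR); exact: scont_int (within_scont cg) yR.
Qed.

Lemma Ck_clairaut Rr f : Ck_strip Rr 2 f -> forall x y, `|y| < Rr ->
  py (px f) (x, y) = px (py f) (x, y).
Proof.
move=> h; apply: (@clairaut Rr f (px f) (py f)) => x y yR.
- exact: (Ck_px h (s := [::])).
- exact: (Ck_py h (s := [::])).
- exact: (Ck_py h (s := [:: false])).
- exact: (Ck_px h (s := [:: true])).
- exact: (Ck_cont h (s := [:: false])).
- exact: (Ck_cont h (s := [:: true; false])).
Qed.

Definition pderivs u v :=
  Derivs (px u) (py u) (px v) (px (px u)) (py (px u)) (py (py u)) (px (px v)).

Lemma is_sol_of_Ck Rr a u v : Ck_strip Rr 2 u -> Ck_strip Rr 2 v ->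
  (forall p, ostrip Rr p -> classical_sol a u v p) -> is_sol Rr a u v (pderivs u v).
Proof.
move=> hu hv hs.
have e1 p : ostrip Rr p -> px u p = py v p by move=> /hs [_ [_ []]].
split=> /=.
- by apply: within_scont; case: hu.
- by apply: within_scont; case: hv.
- exact: (Ck_px hu (s := [::])).
- exact: (Ck_py hu (s := [::])).
- exact: (Ck_px hv (s := [::])).
- by move=> x y yR; rewrite e1 //; exact: (Ck_py hv (s := [::])).
- by move=> x y yR; have [_ [_ []]] := hs (x, y) yR.
- exact: (Ck_px hu (s := [:: false])).
- exact: (Ck_py hu (s := [:: false])).
- by move=> x y yR; rewrite (Ck_clairaut hu x yR); exact: (Ck_px hu (s := [:: true])).
- exact: (Ck_py hu (s := [:: true])).
- exact: (Ck_px hv (s := [:: false])).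
- move=> x y yR.
  have E : (fun t => px u (t, y)) = (fun t => py v (t, y)) by apply/funext => t; exact: e1.
  (* The first equation turns [u_xx] into [v_yx], and the mixed derivatives of [v] commute. *)
  have -> : px (px u) (x, y) = py (px v) (x, y).
    by apply: etrans (esym (Ck_clairaut hv x yR)); rewrite -[LHS]/(derive1 _ x) E.
  exact: (Ck_py hv (s := [:: false])).
- by move=> x y; exact: (Ck_cont hu (s := [:: false])).
- by move=> x y; exact: (Ck_cont hu (s := [:: true])).
- by move=> x y; exact: (Ck_cont hv (s := [:: false])).
- by move=> x y; exact: (Ck_cont hu (s := [:: true; false])).
Qed.

Lemma Ck_le Rr (k k' : nat) f : (k <= k')%N -> Ck_strip Rr k' f -> Ck_strip Rr k f.
Proof.
move=> kk [h1 [h2 h3]]; split=> //; split=> s sk.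
  by apply: h2; exact: leq_trans sk kk.
by apply: h3; exact: leq_trans sk kk.
Qed.

(** Allows [a] to be replaced by its absolute value, since the approximants of a singular solution
    have positive parameters. *)
Lemma is_sol_sq Rr a b u v D : a ^+ 2 = b ^+ 2 -> is_sol Rr a u v D -> is_sol Rr b u v D.
Proof. by move=> ab []; move=> *; split=> // x y; rewrite /wt -ab; auto. Qed.

Definition negD D := Derivs (R := R) (fun p => - dux D p) (fun p => - duy D p) (fun p => - dvx D p)
  (fun p => - duxx D p) (fun p => - duxy D p) (fun p => - duyy D p) (fun p => - dvxx D p).

Lemma scontN Rr f : scont Rr f -> scont Rr (fun p => - f p).
Proof.
move=> cf p sp e e0; have [d d0 H] := cf p sp e e0.
by exists d => // q sq h1 h2; rewrite -opprD normrN; exact: H.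
Qed.

(** This symmetry turns lower bounds into upper bounds. *)
Lemma is_solN Rr a u v D : is_sol Rr a u v D ->
  is_sol Rr a (fun p => - u p) (fun p => - v p) (negD D).
Proof.
case=> cu cv ux uy vx vy eqn uxx uxy uyx uyy vxx vxy cux cuy cvx cuxy.
split=> /=; try (by apply: scontN); try (by move=> x y yR; apply: dN; auto);
  try (by move=> x y yR; apply: ctsN; auto).
by move=> x y yR; rewrite (eqn x y yR) /wt sqrrN; ring.
Qed.

Definition shiftD s D := Derivs (R := R) (fun p => dux D (p.1 + s, p.2)) (fun p => duy D (p.1 + s, p.2))
  (fun p => dvx D (p.1 + s, p.2)) (fun p => duxx D (p.1 + s, p.2)) (fun p => duxy D (p.1 + s, p.2))
  (fun p => duyy D (p.1 + s, p.2)) (fun p => dvxx D (p.1 + s, p.2)).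

Lemma scont_shift Rr f s : scont Rr f -> scont Rr (fun p => f (p.1 + s, p.2)).
Proof.
move=> cf [x y] sp e e0; have [d d0 H] := cf (x + s, y) sp e e0.
exists d => // q sq h1 h2; apply: H => //=.
by rewrite (_ : q.1 + s - (x + s) = q.1 - x) //; ring.
Qed.

Lemma continuous_shift f s x y : {for (x + s, y), continuous f} ->
  {for (x, y), continuous (fun p => f (p.1 + s, p.2))}.
Proof.
move=> /continuous2_atP cf; apply/continuous2_atP => e e0; have [d d0 H] := cf e e0.
exists d => // q h1 h2; apply: H => //=.
by rewrite (_ : q.1 + s - (x + s) = q.1 - x) //; ring.
Qed.

Lemma is_sol_shift Rr a s u v D : is_sol Rr a u v D ->
  is_sol Rr a (fun p => u (p.1 + s, p.2)) (fun p => v (p.1 + s, p.2)) (shiftD s D).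
Proof.
case=> cu cv ux uy vx vy eqn uxx uxy uyx uyy vxx vxy cux cuy cvx cuxy.
split=> /=; try (by apply: scont_shift); try (by move=> x y yR; auto);
  try (by move=> x y yR; apply: continuous_shift; auto);
  by move=> x y yR; apply: (is_derive_compDr (f := fun t => _ (t, y))); auto.
Qed.

(** Constants are the barriers of the maximum principle, and the zero solution reduces facts on one
    solution to facts on differences. *)
Lemma is_sol_cst Rr a k : is_sol Rr a (fun=> 0) (fun=> k)
  (Derivs (fun=> 0) (fun=> 0) (fun=> 0) (fun=> 0) (fun=> 0) (fun=> 0) (fun=> 0)).
Proof.
have sc c : scont Rr (fun=> c).
  by move=> p sp e e0; exists 1 => // q _ _ _; rewrite subrr normr0.
by split=> /=; try exact: sc; try (move=> *; exact: d_cst); try (move=> *; exact: cts_cst);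
  move=> *; rewrite mulr0.
Qed.

End FromDefs.

(** * Comparison *)

Section ComparisonCorollaries.
Context {R : realType}.
Implicit Types (x y z t e d r k s m P B C : R) (u v f g : R * R -> R) (Rr a : R).

Lemma int_nonneg_pointwise (f : R -> R) P : 0 < P -> continuous f ->
  (forall x x', x <= x' <= x + P -> 0 <= integ f x x') -> forall x, 0 <= f x.
Proof.
move=> P0 cf h x; rewrite leNgt; apply/negP => fx.
have [d d0 H] := (continuous_atP _ _).1 (cf x) (- f x) ltac:(lra).
set k := Num.min d P; have k0 : 0 < k by rewrite lt_min d0.
have [kd kP] : k <= d /\ k <= P by split; rewrite ge_min lexx ?orbT.
have xk : x < x + k by rewrite ltrDl.
have [c /andP[c1 c2] E] := int_mvt cf xk.
have := H c; rewrite gtr0_norm ?subr_gt0 // => /(_ ltac:(lra)) /ltr_normlP [_ h2].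
have : 0 <= f c * (x + k - x) by rewrite -E; apply: h; lra.
rewrite addrAC subrr add0r => h3.
have : f c * k < 0 by rewrite nmulr_rlt0 //; lra.
lra.
Qed.

Lemma continuous_int_clamp Rr f x x' : 0 <= Rr -> x <= x' -> scont Rr f ->
  continuous (fun y => integ (fun s => f (s, clamp Rr y)) x x').
Proof.
move=> R0 xx cf; apply: ctsP => y; have cc := scont_clamp R0 cf.
apply: (@continuous_int _ (fun p => f (p.1, clamp Rr p.2)) x x' y 1) => //.
  by move=> s z _; exact: continuous_slice1 (cc (s, z)).
by move=> s _; exact: cc.
Qed.

Lemma int_sol_y Rr a u v D x x' y : is_sol Rr a u v D -> x <= x' -> `|y| < Rr ->
  is_derive y 1 (fun z => integ (fun s => v (s, z)) x x') (u (x', y) - u (x, y)).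
Proof.
move=> S xx yR; have := int_diff_y S (is_sol_cst Rr a 0) xx yR.
rewrite !subr0; apply: is_derive_ext => z; apply: eq_int => s; exact: subr0.
Qed.

(** The period integral of [v] has [y]-derivative [u (x + P, y) - u (x, y)]. The defect [e] is kept
    because approximants of a periodic solution need not be periodic. *)
Lemma mean_variation Rr a u v D P e : 0 < Rr -> 0 < P -> 0 <= e -> is_sol Rr a u v D ->
  (forall x y, `|y| < Rr -> `|u (x + P, y) - u (x, y)| <= e) ->
  forall x y y', `|y| <= Rr -> `|y'| <= Rr ->
  `|integ (fun s => v (s, y)) x (x + P) - integ (fun s => v (s, y')) x (x + P)| <= e * (2 * Rr).
Proof.
move=> R0 P0 e0 S ue x y y' yR y'R.
have xP : x <= x + P by rewrite lerDl ltW.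
pose J z := integ (fun s => v (s, clamp Rr z)) x (x + P).
have cJ : continuous J by apply: continuous_int_clamp => //; [exact: ltW|exact: sol_cv S].
have dJ z : `|z| < Rr -> is_derive z 1 J (u (x + P, z) - u (x, z)).
  move=> zR; apply: (is_derive_near (e := Rr - `|z|)) (int_sol_y S xP zR).
    by rewrite subr_gt0.
  move=> t tz; rewrite /J clamp_id //.
  by have := ler_normD (t - z) z; rewrite subrK; lra.
have key p q : `|p| <= Rr -> `|q| <= Rr -> p <= q -> `|J q - J p| <= e * (2 * Rr).
  move=> /ler_normlP [p1 p2] /ler_normlP [q1 q2] pq.
  have b z : p < z < q -> `|z| < Rr by move=> /andP[z1 z2]; apply/ltr_normlP; split; lra.
  apply: le_trans (_ : e * (q - p) <= _).
    apply: (deriv_bound pq (df := fun z => u (x + P, z) - u (x, z))).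
    + by move=> z /b; exact: dJ.
    + by move=> z _; exact: cJ.
    + by move=> z /b; exact: ue.
  by rewrite ler_wpM2l //; lra.
have JE z : `|z| <= Rr -> integ (fun s => v (s, z)) x (x + P) = J z.
  by move=> zR; rewrite /J clamp_id.
rewrite !JE //; case: (leP y y') => h; last exact: key (ltW h).
by rewrite distrC; exact: key.
Qed.

Section AveragedComparison.
Variables (Rr P a1 a2 B C theta m : R).
Variables (u1 v1 u2 v2 : R * R -> R) (D1 D2 : @derivs R).
Hypotheses (R0 : 0 < Rr) (P0 : 0 < P) (a10 : a1 != 0) (a20 : a2 != 0).
Hypotheses (S1 : is_sol Rr a1 u1 v1 D1) (S2 : is_sol Rr a2 u2 v2 D2).
Hypothesis wB : forall p, strip Rr p -> `|v1 p - v2 p| <= B.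
Hypothesis vC : forall p, ostrip Rr p -> `|dvx D2 p| <= C.
Hypothesis th : forall V y, `|(wt a1 V y)^-1 - (wt a2 V y)^-1| <= theta.
Let W y x x' := integ (fun s => v1 (s, y) - v2 (s, y)) x x'.

Lemma int_comparison_low : 0 <= m ->
  (forall x x', x <= x' <= x + P -> - m <= W Rr x x') ->
  (forall x x', x <= x' <= x + P -> - m <= W (- Rr) x x') ->
  (forall x y, `|y| <= Rr -> - m <= W y x (x + P)) ->
  forall x x' y, x <= x' <= x + P -> `|y| <= Rr -> - m - C * theta * Rr ^+ 2 <= W y x x'.
Proof.
move=> m0 h1 h2 h3 x x' y hx hy.
have C0 : 0 <= C by apply: le_trans (vC (p := (0, 0)) _); rewrite // /ostrip /= normr0.
have th0 : 0 <= theta by exact: le_trans (th 0 0).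
have Ct : 0 <= C * theta by exact: mulr_ge0.
have R2 : 0 < Rr ^+ 2 by rewrite exprn_gt0.
apply/ler_addgt0Pr => k k0.
(* This choice of [delta] makes the inequality strict even for [C * theta = 0], and its second
   summand costs only the arbitrary [k] in the conclusion. *)
have dk : C * theta < 2 * (C * theta + k / Rr ^+ 2).
  by have := divr_gt0 k0 R2; lra.
have := int_comparison R0 P0 a10 a20 S1 S2 wB vC th dk m0 h1 h2 h3 hx hy.
by rewrite mulrDl divfK ?gt_eqF // -/(W y x x'); lra.
Qed.

End AveragedComparison.

Lemma int_comparison_abs Rr P a1 a2 B C theta m u1 v1 D1 u2 v2 D2 :
  0 < Rr -> 0 < P -> a1 != 0 -> a2 != 0 ->
  is_sol Rr a1 u1 v1 D1 -> is_sol Rr a2 u2 v2 D2 ->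
  (forall p, strip Rr p -> `|v1 p - v2 p| <= B) ->
  (forall p, ostrip Rr p -> `|dvx D2 p| <= C) ->
  (forall V y, `|(wt a1 V y)^-1 - (wt a2 V y)^-1| <= theta) ->
  0 <= m ->
  (forall x x', x <= x' <= x + P -> `|integ (fun s => v1 (s, Rr) - v2 (s, Rr)) x x'| <= m) ->
  (forall x x', x <= x' <= x + P -> `|integ (fun s => v1 (s, - Rr) - v2 (s, - Rr)) x x'| <= m) ->
  (forall x y, `|y| <= Rr -> `|integ (fun s => v1 (s, y) - v2 (s, y)) x (x + P)| <= m) ->
  forall x x' y, x <= x' <= x + P -> `|y| <= Rr ->
    `|integ (fun s => v1 (s, y) - v2 (s, y)) x x'| <= m + C * theta * Rr ^+ 2.
Proof.
move=> R0 P0 a10 a20 S1 S2 wB vC th m0 h1 h2 h3 x x' y hx hy.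
have cw z : `|z| <= Rr -> continuous (fun s => v1 (s, z) - v2 (s, z)).
  by move=> zR; apply: scont_slice (scontB (sol_cv S1) (sol_cv S2)) zR.
have flip z p q : `|z| <= Rr ->
    integ (fun s => - v1 (s, z) - - v2 (s, z)) p q = - integ (fun s => v1 (s, z) - v2 (s, z)) p q.
  move=> zR; rewrite -intN; last exact: cw.
  by apply: eq_int => s; rewrite opprB opprK addrC.
have RR : `|Rr| <= Rr by rewrite ger0_norm // ltW.
have RRn : `|- Rr| <= Rr by rewrite normrN.
apply/ler_normlP; split; last first.
  have := int_comparison_low R0 P0 a10 a20 (is_solN S1) (is_solN S2) (B := B) (C := C) (theta := theta) (m := m).
  move=> /(_ _ _ th m0 _ _ _ x x' y hx hy); rewrite flip // lerNr opprD !opprK; apply.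
  - by move=> p /wB; rewrite -opprB normrN opprK addrC.
  - by move=> p /vC; rewrite /= normrN.
  - by move=> p q /h1; rewrite flip // lerN2 => /ler_normlP [].
  - by move=> p q /h2; rewrite flip // lerN2 => /ler_normlP [].
  - by move=> p z zR; rewrite flip // lerN2; have /ler_normlP [] := h3 p z zR.
have := int_comparison_low R0 P0 a10 a20 S1 S2 wB vC th m0.
move=> /(_ _ _ _ x x' y hx hy); rewrite lerNl opprD; apply.
- by move=> p q /h1 /ler_normlP [? _]; rewrite lerNl.
- by move=> p q /h2 /ler_normlP [? _]; rewrite lerNl.
- by move=> p z zR; have /ler_normlP [? _] := h3 p z zR; rewrite lerNl.
Qed.

(** With equal parameters [theta] and [m] can be 0, so every window integral of the difference is
    nonnegative, and short windows give the sign pointwise. Full periods cause no loss: their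
    integrals do not depend on [y] and can be read off at [y = Rr]. *)
Lemma sol_comparison Rr P a B C u1 v1 D1 u2 v2 D2 :
  0 < Rr -> 0 < P -> a != 0 ->
  is_sol Rr a u1 v1 D1 -> is_sol Rr a u2 v2 D2 ->
  (forall p, strip Rr p -> `|v1 p - v2 p| <= B) ->
  (forall p, ostrip Rr p -> `|dvx D2 p| <= C) ->
  (forall x y, `|y| < Rr -> u1 (x + P, y) = u1 (x, y)) ->
  (forall x y, `|y| < Rr -> u2 (x + P, y) = u2 (x, y)) ->
  (forall x, v2 (x, Rr) <= v1 (x, Rr)) -> (forall x, v2 (x, - Rr) <= v1 (x, - Rr)) ->
  forall p, strip Rr p -> v2 p <= v1 p.
Proof.
move=> R0 P0 a0 S1 S2 wB vC u1P u2P hp hm [X Y] YR.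
have cw z : `|z| <= Rr -> continuous (fun s => v1 (s, z) - v2 (s, z)).
  by move=> zR; apply: scont_slice (scontB (sol_cv S1) (sol_cv S2)) zR.
have RR : `|Rr| <= Rr by rewrite ger0_norm // ltW.
have RRn : `|- Rr| <= Rr by rewrite normrN.
have pos z : `|z| <= Rr -> (forall x, v2 (x, z) <= v1 (x, z)) -> forall x x', x <= x' <= x + P ->
   - 0 <= integ (fun s => v1 (s, z) - v2 (s, z)) x x'.
  move=> zR h x x' /andP[xx _]; rewrite oppr0; apply: int_ge0 => //; first exact: cw.
  by move=> s _; rewrite subr_ge0.
have th V y : `|(wt a V y)^-1 - (wt a V y)^-1| <= (0 : R) by rewrite subrr normr0.
have c1 z : `|z| <= Rr -> continuous (fun s => v1 (s, z)) by apply: scont_slice (sol_cv S1).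
have c2 z : `|z| <= Rr -> continuous (fun s => v2 (s, z)) by apply: scont_slice (sol_cv S2).
have per x y : `|y| <= Rr -> - 0 <= integ (fun s => v1 (s, y) - v2 (s, y)) x (x + P).
  move=> yR; rewrite intB; [|exact: c1|exact: c2].
  have e1 : forall x y, `|y| < Rr -> `|u1 (x + P, y) - u1 (x, y)| <= 0.
    by move=> ? ? h; rewrite u1P // subrr normr0.
  have e2 : forall x y, `|y| < Rr -> `|u2 (x + P, y) - u2 (x, y)| <= 0.
    by move=> ? ? h; rewrite u2P // subrr normr0.
  have /ler_normlP [i1 i2] := mean_variation R0 P0 (lexx _) S1 e1 x yR RR.
  have /ler_normlP [j1 j2] := mean_variation R0 P0 (lexx _) S2 e2 x yR RR.
  have := pos Rr RR hp x (x + P); rewrite intB; [|exact: c1|exact: c2].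
  move=> /(_ ltac:(rewrite lexx lerDl ltW //)); lra.
have := int_comparison_low R0 P0 a0 a0 S1 S2 wB vC th (lexx 0) (pos _ RR hp) (pos _ RRn hm) per.
rewrite mulr0 mul0r subr0 oppr0 => H.
rewrite -subr_ge0; apply: (@int_nonneg_pointwise (fun x => v1 (x, Y) - v2 (x, Y)) P) => //.
  exact: cw.
by move=> x x' hx; exact: H.
Qed.

(** Turns the Lipschitz bound of the weight in [V] into one in [a]. *)
Lemma wt_sym a (V : R) y : wt a V y = wt V a y.
Proof. by rewrite /wt; congr Num.sqrt; ring. Qed.

Lemma wtV_lip_a (a1 a2 V : R) y : a1 != 0 -> a2 != 0 ->
  `|(wt a1 V y)^-1 - (wt a2 V y)^-1| <= `|a1 - a2| / (`|a1| * `|a2|).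
Proof.
move=> a10 a20; have q1 := wt_gt0 V y a10; have q2 := wt_gt0 V y a20.
have n1 : 0 < `|a1| by rewrite normr_gt0.
have n2 : 0 < `|a2| by rewrite normr_gt0.
have -> : (wt a1 V y)^-1 - (wt a2 V y)^-1 = (wt a2 V y - wt a1 V y) / (wt a1 V y * wt a2 V y).
  by field; rewrite !gt_eqF.
rewrite normrM normfV (gtr0_norm (mulr_gt0 q1 q2)).
apply: ler_pM; rewrite ?invr_ge0 ?normr_ge0 //.
- by rewrite ltW // mulr_gt0.
- by rewrite [X in _ <= X]distrC !(wt_sym _ V); exact: wt_lip.
rewrite lef_pV2 ?posrE ?mulr_gt0 //.
by apply: ler_pM; rewrite ?normr_ge0 ?wt_ge_a.
Qed.

Lemma periodic_int_shift (T : Type) (g : R -> T) P (n : int) x :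
  (forall x, g (x + P) = g x) -> g (x + n%:~R * P) = g x.
Proof.
move=> gP; have gn (m : nat) z : g (z + m%:R * P) = g z.
  elim: m z => [|m IH] z; first by rewrite mul0r addr0.
  by rewrite -natr1 mulrDl mul1r addrA gP IH.
case: n => m; first exact: gn.
by rewrite NegzE mulrNz -[in RHS](subrK (m.+1%:R * P) x) gn mulNr.
Qed.

Lemma periodic_reduce (T : Type) (g : R -> T) P : 0 < P -> (forall x, g (x + P) = g x) ->
  forall x, exists2 x0, 0 <= x0 <= P & g x0 = g x.
Proof.
move=> P0 gP x.
have := floor_itv (x / P).
set n := Num.floor _ => /andP[n1 n2].
exists (x + (- n)%:~R * P); last exact: periodic_int_shift.
rewrite mulrNz mulNr.
move: n1 n2; rewrite ler_pdivlMr // ltr_pdivrMr // intrD mulrDl mul1r => n1 n2.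
by apply/andP; split; lra.
Qed.

Lemma scont_periodic_bounded Rr f P : 0 < Rr -> 0 < P -> scont Rr f ->
  (forall p, strip Rr p -> f (p.1 + P, p.2) = f p) ->
  exists B, forall p, strip Rr p -> `|f p| <= B.
Proof.
move=> R0 P0 cf fP.
have cc := scont_clamp (ltW R0) cf.
have cg : continuous (fun q : R * R * R => - `|f (q.1.1, clamp Rr q.1.2)|).
  apply: ctsP => q; apply: ctsN.
  apply: (@continuous_comp _ _ _ (fun q : R * R * R => f (q.1.1, clamp Rr q.1.2)) (fun t : R => `|t|)).
    apply: (@continuous_comp _ _ _ fst (fun p : R * R => f (p.1, clamp Rr p.2))); first exact: cvg_fst.
    exact: cc.
  exact: norm_continuous.
have hRR : - Rr <= Rr by lra.
(* The third variable is a dummy, confined to the point 0. *)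
have [x [y [z [_ _ _ mn]]]] := evt3 cg (ltW P0) hRR (lexx 0).
exists (`|f (x, clamp Rr y)|) => -[p q] pq.
have [x0 x0P E] := periodic_reduce P0 (g := fun x => f (x, q)) (fun x => fP (x, q) pq) p.
rewrite -E; have := mn x0 q 0 x0P; rewrite /= lerN2 clamp_id //; apply; last by rewrite lexx.
by move/ler_normlP: pq => /= [? ?]; lra.
Qed.

End ComparisonCorollaries.

(** * Interior estimates *)

Section InteriorEstimates.
Context {R : realType}.
Implicit Types (x y z t e d r k s m P B C : R) (u v f g : R * R -> R) (Rr a : R) (D : @derivs R).

Lemma dwt_x Rr a u v D x y : a != 0 -> is_sol Rr a u v D -> `|y| < Rr ->
  is_derive x 1 (fun t => wt a (v (t, y)) y) (v (x, y) * dvx D (x, y) / wt a (v (x, y)) y).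
Proof.
move=> a0 S yR; have q0 := wt_gt0 (v (x, y)) y a0.
have s0 : 0 < v (x, y) ^+ 2 + y ^+ 2 + a ^+ 2 by rewrite -sqrtr_gt0.
have h := d_sqrt (f := fun t => v (t, y) ^+ 2 + y ^+ 2 + a ^+ 2) s0
  (dD (dD (d_sqr (sol_vx S x yR)) (d_cst (y ^+ 2) x)) (d_cst (a ^+ 2) x)).
by apply: d_eq h; rewrite -/(wt a (v (x, y)) y); field; rewrite gt_eqF.
Qed.

Lemma dwt_y Rr a u v D x y : a != 0 -> is_sol Rr a u v D -> `|y| < Rr ->
  is_derive y 1 (fun t => wt a (v (x, t)) t) ((v (x, y) * dux D (x, y) + y) / wt a (v (x, y)) y).
Proof.
move=> a0 S yR; have q0 := wt_gt0 (v (x, y)) y a0.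
have s0 : 0 < v (x, y) ^+ 2 + y ^+ 2 + a ^+ 2 by rewrite -sqrtr_gt0.
have h := d_sqrt (f := fun t => v (x, t) ^+ 2 + t ^+ 2 + a ^+ 2) s0
  (dD (dD (d_sqr (sol_vy S x yR)) (d_sqr (d_id y))) (d_cst (a ^+ 2) y)).
by apply: d_eq h; rewrite -/(wt a (v (x, y)) y); field; rewrite gt_eqF.
Qed.

Lemma sol_vxxE Rr a u v D x y : a != 0 -> is_sol Rr a u v D -> `|y| < Rr ->
  dvxx D (x, y) = - 2 * (v (x, y) * dvx D (x, y) / wt a (v (x, y)) y * duy D (x, y)
     + wt a (v (x, y)) y * duxy D (x, y)).
Proof.
move=> a0 S yR; apply: is_derive_uniq (sol_vxx S x yR) _.
have h := dZ (- 2) (dM (dwt_x x a0 S yR) (sol_uyx S x yR)).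
by apply: is_derive_ext h => t; rewrite (sol_eq S t yR) mulrA.
Qed.

Lemma sol_uxxE Rr a u v D x y : a != 0 -> is_sol Rr a u v D -> `|y| < Rr ->
  duxx D (x, y) = - 2 * ((v (x, y) * dux D (x, y) + y) / wt a (v (x, y)) y * duy D (x, y)
     + wt a (v (x, y)) y * duyy D (x, y)).
Proof.
move=> a0 S yR; apply: is_derive_uniq (sol_vxy S x yR) _.
have h := dZ (- 2) (dM (dwt_y x a0 S yR) (sol_uyy S x yR)).
apply: (is_derive_near (e := Rr - `|y|)) h; first by rewrite subr_gt0.
move=> t ty; rewrite (sol_eq S x) ?mulrA //.
by have := ler_normD (t - y) y; rewrite subrK; lra.
Qed.

Lemma evt_box Rr (g h : R * R -> R) x1 x2 y1 y2 : x1 <= x2 -> y1 <= y2 ->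
  - Rr <= y1 -> y2 <= Rr -> scont Rr g -> continuous h ->
  exists x y, [/\ x1 <= x <= x2, y1 <= y <= y2 &
    forall x' y', x1 <= x' <= x2 -> y1 <= y' <= y2 ->
      g (x', y') + h (x', y') <= g (x, y) + h (x, y)].
Proof.
move=> hx hy h1 h2 cg ch; have R0 : 0 <= Rr by lra.
have cc := scont_clamp R0 cg.
have cF : continuous (fun q : R * R * R => - (g (q.1.1, clamp Rr q.1.2) + h q.1)).
  apply: ctsP => q; apply: ctsN; apply: ctsD.
    apply: (@continuous_comp _ _ _ fst (fun p : R * R => g (p.1, clamp Rr p.2))); first exact: cvg_fst.
    exact: cc.
  by apply: (@continuous_comp _ _ _ fst h); [exact: cvg_fst|exact: ch].
have [x [y [z [xx yy _ mn]]]] := evt3 cF hx hy (lexx 0).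
exists x, y; split=> // x' y' hx' hy'.
have := mn x' y' 0 hx' hy'; rewrite lexx => /(_ isT) /=; rewrite lerN2.
have cl t : y1 <= t <= y2 -> clamp Rr t = t by move=> ht; apply: clamp_id; apply/ler_normlP; split; lra.
by rewrite !cl.
Qed.

(** The function maximised is [v] plus a perturbation in [y] alone, so [v_x = 0] holds exactly at an
    interior maximum; this removes the quadratic term of [sol_vxxE] and leaves [v_xx] and
    [v_yy = u_xy] with opposite signs. *)
Lemma box_max_v Rr a u v D x1 x2 y1 y2 c : a != 0 -> is_sol Rr a u v D ->
  - Rr < y1 -> y2 < Rr ->
  (forall x y, x1 <= x <= x2 -> y1 <= y <= y2 -> [|| x == x1, x == x2, y == y1 | y == y2] ->
     v (x, y) <= c) ->
  forall x y, x1 <= x <= x2 -> y1 <= y <= y2 -> v (x, y) <= c.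
Proof.
move=> a0 S h1 h2 bd X Y hX hY; rewrite leNgt; apply/negP => hc.
have R0 : 0 < Rr by lra.
have R2 : 0 < Rr ^+ 2 by rewrite exprn_gt0.
(* The perturbation then lies between 0 and minus half the excess [v (X, Y) - c], so the perturbed
   maximum still exceeds [c]. *)
set n := (v (X, Y) - c) / (2 * Rr ^+ 2); have n0 : 0 < n by rewrite divr_gt0 ?subr_gt0 // mulr_gt0.
have nR : n * Rr ^+ 2 = (v (X, Y) - c) / 2 by rewrite /n; field; rewrite gt_eqF.
have ch : continuous (fun p : R * R => n * (p.2 ^+ 2 - Rr ^+ 2)).
  apply: ctsP => p; apply: ctsM; first exact: cts_cst.
  by apply: ctsB; [apply: ctsX; exact: cvg_snd|exact: cts_cst].
have hx12 : x1 <= x2 by lra.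
have hy12 : y1 <= y2 by lra.
have [x [y [hx hy mx]]] := evt_box hx12 hy12 (ltW h1) (ltW h2) (sol_cv S) ch.
have y2R (t : R) : y1 <= t <= y2 -> t ^+ 2 <= Rr ^+ 2.
  by move=> ht; apply: sqr_le_norm; apply/ler_normlP; split; lra.
have vc : c < v (x, y).
  have := mx X Y hX hY; rewrite /= => h.
  have : n * (y ^+ 2 - Rr ^+ 2) <= 0 by rewrite pmulr_rle0 // subr_le0; exact: y2R.
  have : 0 <= n * Y ^+ 2 by rewrite mulr_ge0 ?sqr_ge0 // ltW.
  by move: h; rewrite !mulrBr nR; lra.
have : ~~ [|| x == x1, x == x2, y == y1 | y == y2].
  by apply/negP => /(bd x y hx hy); rewrite leNgt vc.
rewrite !negb_or => /and4P[nx1 nx2 ny1 ny2].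
have [hx1 hx2 hy1 hy2] : [/\ x1 < x, x < x2, y1 < y & y < y2].
  move/andP: hx => [? ?]; move/andP: hy => [? ?].
  by split; rewrite lt_neqAle ?nx2 ?ny2 // eq_sym ?nx1 ?ny1.
have yR : `|y| < Rr by apply/ltr_normlP; split; lra.
have [E1 E2] : - dvx D (x, y) = 0 /\ 0 <= - dvxx D (x, y).
  apply: (@local_min_derive2 _ (fun t => - v (t, y)) (fun t => - dvx D (t, y)) x _ (Num.min (x - x1) (x2 - x))).
  - by rewrite lt_min !subr_gt0 hx1.
  - by move=> t _; exact: dN (sol_vx S t yR).
  - by exact: dN (sol_vxx S x yR).
  - move=> t; rewrite lt_min => /andP[/ltr_normlP[t1 t2] /ltr_normlP[t3 t4]].
    by have := mx t y ltac:(lra) hy; rewrite /= lerN2 lerD2r.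
have [E3 E4] : - dux D (x, y) - n * (2 * y) = 0 /\ 0 <= - duxy D (x, y) - n * 2.
  apply: (@local_min_derive2 _ (fun t => - v (x, t) - n * t ^+ 2)
    (fun t => - dux D (x, t) - n * (2 * t)) y _ (Num.min (y - y1) (y2 - y))).
  - by rewrite lt_min !subr_gt0 hy1.
  - move=> t; rewrite lt_min => /andP[/ltr_normlP[t1 t2] /ltr_normlP[t3 t4]].
    have tR : `|t| < Rr by apply/ltr_normlP; split; lra.
    have h := dB (dN (sol_vy S x tR)) (dZ n (d_sqr (d_id t))).
    by apply: d_eq h; ring.
  - have h := dB (dN (sol_uxy S x yR)) (dZ n (dZ 2 (d_id y))).
    by apply: d_eq h; ring.
  - move=> t; rewrite lt_min => /andP[/ltr_normlP[t1 t2] /ltr_normlP[t3 t4]].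
    by have := mx x t hx ltac:(lra); rewrite /= => h; lra.
have q0 := wt_gt0 (v (x, y)) y a0.
have vx0 : dvx D (x, y) = 0 by lra.
move: E2; rewrite (sol_vxxE x a0 S yR) vx0 mulr0 !mul0r add0r => E2.
have : wt a (v (x, y)) y * duxy D (x, y) < 0 by rewrite pmulr_rlt0 //; lra.
lra.
Qed.

(** Here the perturbation depends on [x] alone: the lower-order term of [sol_uxxE] carries the
    factor [u_y], which must vanish exactly at the maximum. *)
Lemma box_max_u Rr a u v D x1 x2 y1 y2 c : a != 0 -> is_sol Rr a u v D ->
  - Rr < y1 -> y2 < Rr ->
  (forall x y, x1 <= x <= x2 -> y1 <= y <= y2 -> [|| x == x1, x == x2, y == y1 | y == y2] ->
     u (x, y) <= c) ->
  forall x y, x1 <= x <= x2 -> y1 <= y <= y2 -> u (x, y) <= c.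
Proof.
move=> a0 S h1 h2 bd X Y hX hY; rewrite leNgt; apply/negP => hc.
have R0 : 0 < Rr by lra.
set T := (x2 - x1) ^+ 2 + 1; have T0 : 0 < T by rewrite ltr_pwDr // sqr_ge0.
set n := (u (X, Y) - c) / (2 * T); have n0 : 0 < n by rewrite divr_gt0 ?subr_gt0 // mulr_gt0.
have nR : n * T = (u (X, Y) - c) / 2 by rewrite /n; field; rewrite gt_eqF.
have ch : continuous (fun p : R * R => n * ((p.1 - x1) ^+ 2 - T)).
  apply: ctsP => p; apply: ctsM; first exact: cts_cst.
  apply: ctsB; last exact: cts_cst.
  by apply: ctsX; apply: ctsB; [exact: cvg_fst|exact: cts_cst].
have hx12 : x1 <= x2 by lra.
have hy12 : y1 <= y2 by lra.
have [x [y [hx hy mx]]] := evt_box hx12 hy12 (ltW h1) (ltW h2) (sol_cu S) ch.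
have xT (t : R) : x1 <= t <= x2 -> (t - x1) ^+ 2 <= T.
  move=> ht; apply: (@le_trans _ _ ((x2 - x1) ^+ 2)); last by rewrite lerDl.
  by apply: sqr_le_norm; apply/ler_normlP; split; lra.
have vc : c < u (x, y).
  have := mx X Y hX hY; rewrite /= => h.
  have : n * ((x - x1) ^+ 2 - T) <= 0 by rewrite pmulr_rle0 // subr_le0; exact: xT.
  have : 0 <= n * (X - x1) ^+ 2 by rewrite mulr_ge0 ?sqr_ge0 // ltW.
  by move: h; rewrite !mulrBr nR; lra.
have : ~~ [|| x == x1, x == x2, y == y1 | y == y2].
  by apply/negP => /(bd x y hx hy); rewrite leNgt vc.
rewrite !negb_or => /and4P[nx1 nx2 ny1 ny2].
have [hx1 hx2 hy1 hy2] : [/\ x1 < x, x < x2, y1 < y & y < y2].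
  move/andP: hx => [? ?]; move/andP: hy => [? ?].
  by split; rewrite lt_neqAle ?nx2 ?ny2 // eq_sym ?nx1 ?ny1.
have yR : `|y| < Rr by apply/ltr_normlP; split; lra.
have [E1 E2] : - duy D (x, y) = 0 /\ 0 <= - duyy D (x, y).
  apply: (@local_min_derive2 _ (fun t => - u (x, t)) (fun t => - duy D (x, t)) y _ (Num.min (y - y1) (y2 - y))).
  - by rewrite lt_min !subr_gt0 hy1.
  - move=> t; rewrite lt_min => /andP[/ltr_normlP[t1 t2] /ltr_normlP[t3 t4]].
    have tR : `|t| < Rr by apply/ltr_normlP; split; lra.
    exact: dN (sol_uy S x tR).
  - by exact: dN (sol_uyy S x yR).
  - move=> t; rewrite lt_min => /andP[/ltr_normlP[t1 t2] /ltr_normlP[t3 t4]].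
    by have := mx x t hx ltac:(lra); rewrite /= lerN2 lerD2r.
have [E3 E4] : - dux D (x, y) - n * (2 * (x - x1)) = 0 /\ 0 <= - duxx D (x, y) - n * 2.
  apply: (@local_min_derive2 _ (fun t => - u (t, y) - n * (t - x1) ^+ 2)
    (fun t => - dux D (t, y) - n * (2 * (t - x1))) x _ (Num.min (x - x1) (x2 - x))).
  - by rewrite lt_min !subr_gt0 hx1.
  - move=> t _.
    have h := dB (dN (sol_ux S t yR)) (dZ n (d_sqr (dB (d_id t) (d_cst x1 t)))).
    by apply: d_eq h; ring.
  - have h := dB (dN (sol_uxx S x yR)) (dZ n (dZ 2 (dB (d_id x) (d_cst x1 x)))).
    by apply: d_eq h; ring.
  - move=> t; rewrite lt_min => /andP[/ltr_normlP[t1 t2] /ltr_normlP[t3 t4]].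
    by have := mx t y ltac:(lra) hy; rewrite /= => h; lra.
have q0 := wt_gt0 (v (x, y)) y a0.
have uy0 : duy D (x, y) = 0 by lra.
move: E4; rewrite (sol_uxxE x a0 S yR) uy0 mulr0 add0r => E4.
have : wt a (v (x, y)) y * duyy D (x, y) <= 0 by rewrite pmulr_rle0 //; lra.
lra.
Qed.

(* With [rt = (v ^+ 2 + a ^+ 2) ^ (1 / 4)], the convex function [rt ^+ 3] of [v] has a second derivative
   at least [3 / (4 * rt)]: large enough near [v = 0] for the weighted energy below to control [duy]
   with a weight [sqrt `|y|], uniformly in [a]. *)
Definition rt a (v : R) := Num.sqrt (Num.sqrt (v ^+ 2 + a ^+ 2)).
Definition cvx a (v : R) := rt a v ^+ 3.
Definition cvx1 a (v : R) := 3 / 2 * (v * (rt a v)^-1).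
Definition cvx2 a (v : R) := 3 / 2 * ((rt a v)^-1 - v ^+ 2 / (2 * rt a v ^+ 5)).

Lemma rt_gt0 a (v : R) : a != 0 -> 0 < rt a v.
Proof.
move=> a0; rewrite !sqrtr_gt0; have : 0 < a ^+ 2 by rewrite exprn_even_gt0.
by have := sqr_ge0 v; lra.
Qed.

Lemma rt4 a (v : R) : rt a v ^+ 4 = v ^+ 2 + a ^+ 2.
Proof.
rewrite (exprM _ 2 2) sqr_sqrtr ?sqrtr_ge0 // sqr_sqrtr //.
by rewrite addr_ge0 // sqr_ge0.
Qed.

Lemma d_rt a (v : R) : a != 0 -> is_derive v 1 (rt a) (v / (2 * rt a v ^+ 3)).
Proof.
move=> a0; have r0 := rt_gt0 v a0.
have s2 : 0 < Num.sqrt (v ^+ 2 + a ^+ 2) by move: r0; rewrite /rt sqrtr_gt0.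
have s1 : 0 < v ^+ 2 + a ^+ 2 by move: s2; rewrite sqrtr_gt0.
have h1 := d_sqrt (f := fun t => t ^+ 2 + a ^+ 2) s1 (dD (d_sqr (d_id v)) (d_cst (a ^+ 2) v)).
have h := d_sqrt (f := fun t => Num.sqrt (t ^+ 2 + a ^+ 2)) s2 h1.
apply: d_eq h; rewrite -/(rt a v).
have -> : Num.sqrt (v ^+ 2 + a ^+ 2) = rt a v ^+ 2 by rewrite sqr_sqrtr // ltW.
by field; rewrite gt_eqF.
Qed.

Lemma d_cvx a (v : R) : a != 0 -> is_derive v 1 (cvx a) (cvx1 a v).
Proof.
move=> a0; have r0 := rt_gt0 v a0; have h0 := d_rt v a0.
have h := dM h0 (dM h0 h0).
apply: (@is_derive_ext _ (fun s => rt a s * (rt a s * rt a s))).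
  by move=> s; rewrite /cvx; ring.
by apply: d_eq h; rewrite /cvx1; field; rewrite gt_eqF.
Qed.

Lemma d_inv (f : R -> R) x (df : R) : f x != 0 -> is_derive x 1 f df ->
  is_derive x 1 (fun s => (f s)^-1) (- df / f x ^+ 2).
Proof.
move=> fx h; have := is_deriveV fx h.
by apply: d_eq; rewrite /GRing.scale /= mulrC mulrN mulNr.
Qed.

Lemma d_cvx1 a (v : R) : a != 0 -> is_derive v 1 (cvx1 a) (cvx2 a v).
Proof.
move=> a0; have r0 := rt_gt0 v a0; have rn : rt a v != 0 by rewrite gt_eqF.
have h := dZ (3 / 2) (dM (d_id v) (d_inv rn (d_rt v a0))).
by apply: d_eq h; rewrite /cvx2; field; rewrite gt_eqF.
Qed.

Lemma continuous_rt a (v : R) : {for v, continuous (rt a)}.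
Proof.
apply: cts_sqrt; apply: cts_sqrt; apply: ctsD; last exact: cts_cst.
by apply: ctsX; exact: cvg_id.
Qed.

Lemma continuous_cvx2 a (v : R) : a != 0 -> {for v, continuous (cvx2 a)}.
Proof.
move=> a0; have rn : rt a v != 0 by rewrite gt_eqF // rt_gt0.
apply: ctsM; first exact: cts_cst.
have c1 : {for v, continuous (fun s : R => (rt a s)^-1)} by apply: ctsV => //; exact: continuous_rt.
apply: ctsB => //; apply: ctsM; first by apply: ctsX; exact: cvg_id.
apply: ctsV; first by rewrite mulf_neq0 // expf_neq0.
by apply: ctsM; [exact: cts_cst|apply: ctsX; exact: continuous_rt].
Qed.

Lemma cvx2_ge a (v : R) : a != 0 -> 3 / 4 / rt a v <= cvx2 a v.
Proof.
move=> a0; have r0 := rt_gt0 v a0.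
have h : v ^+ 2 / (2 * rt a v ^+ 5) <= (2 * rt a v)^-1.
  rewrite ler_pdivrMr ?mulr_gt0 ?exprn_gt0 //.
  have -> : (2 * rt a v)^-1 * (2 * rt a v ^+ 5) = rt a v ^+ 4 by field; rewrite gt_eqF.
  by rewrite rt4 lerDl sqr_ge0.
have -> : 3 / 4 / rt a v = 3 / 2 * ((rt a v)^-1 - (2 * rt a v)^-1) by field; rewrite gt_eqF.
by rewrite /cvx2 ler_wpM2l // lerD2l lerN2.
Qed.

Lemma cvx2_ge0 a (v : R) : a != 0 -> 0 <= cvx2 a v.
Proof.
by move=> a0; apply: le_trans (cvx2_ge v a0); rewrite divr_ge0 // ltW // rt_gt0.
Qed.

(** Both [|y|] and [rt a v ^+ 2] are at most the weight, so the quotient of the weight by [rt a v]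
    is at least [sqrt |y|]. *)
Lemma wt_cvx2_ge a (v : R) y : a != 0 -> 3 / 4 * Num.sqrt `|y| <= wt a v y * cvx2 a v.
Proof.
move=> a0; have r0 := rt_gt0 v a0; have q0 := wt_gt0 v y a0.
apply: (@le_trans _ _ (wt a v y * (3 / 4 / rt a v))); last by rewrite ler_wpM2l ?cvx2_ge // ltW.
have -> : wt a v y * (3 / 4 / rt a v) = 3 / 4 * (wt a v y / rt a v) by field; rewrite gt_eqF.
rewrite ler_wpM2l // ler_pdivlMr //.
have s1 : Num.sqrt `|y| <= Num.sqrt (wt a v y) by apply: ler_wsqrtr; exact: wt_ge_y.
have s2 : rt a v <= Num.sqrt (wt a v y).
  by apply: ler_wsqrtr; apply: ler_wsqrtr; have := sqr_ge0 y; lra.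
rewrite -[X in _ <= X]sqr_sqrtr; last exact: ltW.
by rewrite expr2; apply: ler_pM; rewrite ?sqrtr_ge0.
Qed.

End InteriorEstimates.

(** * The energy estimate over a period *)

Section Energy.
Context {R : realType}.
Implicit Types (x y z t e d r k s m B C : R) (u v f g : R * R -> R).
Variables (Rr P a M A : R) (u v : R * R -> R) (D : @derivs R).
Hypotheses (R0 : 0 < Rr) (P0 : 0 < P) (a0 : a != 0) (A0 : 0 < A) (aA : `|a| <= A).
Hypothesis S : is_sol Rr a u v D.
Hypothesis uP : forall x y, `|y| < Rr -> u (x + P, y) = u (x, y).
Hypothesis vP : forall x y, `|y| < Rr -> v (x + P, y) = v (x, y).
Hypothesis vM : forall p, strip Rr p -> `|v p| <= M.

(** Since [v_x * u_y = - 2 * wt * u_y ^+ 2], the bracket is [u_x ^+ 2 - v_x * u_y]. This is the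
    density of the second [y]-derivative of the period integral of [cvx a v]. *)
Definition energy (p : R * R) :=
  cvx2 a (v p) * (dux D p ^+ 2 + 2 * wt a (v p) p.2 * duy D p ^+ 2).

Lemma energy_ge0 p : 0 <= energy p.
Proof.
rewrite /energy mulr_ge0 ?cvx2_ge0 // addr_ge0 ?sqr_ge0 // mulr_ge0 ?sqr_ge0 //.
by rewrite mulr_ge0 // sqrtr_ge0.
Qed.

Lemma continuous_energy x y : `|y| < Rr -> {for (x, y), continuous energy}.
Proof.
move=> yR; have cv := scont_int (sol_cv S) yR.
have c2 : {for (x, y), continuous (fun p : R * R => cvx2 a (v p))}.
  by apply: (cts_comp (cv x)); exact: continuous_cvx2.
apply: ctsM => //; apply: ctsD; first by apply: ctsX; exact: sol_cux S x y yR.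
apply: ctsM; last by apply: ctsX; exact: sol_cuy S x y yR.
apply: ctsM; first exact: cts_cst.
apply: cts_sqrt; apply: ctsD; last exact: cts_cst.
by apply: ctsD; apply: ctsX; [exact: cv|exact: cvg_snd].
Qed.

Definition rho := Num.sqrt (Num.sqrt (M ^+ 2 + A ^+ 2)).

Lemma M_ge0 : 0 <= M.
Proof. by apply: le_trans (vM (p := (0, 0)) _); rewrite // /strip /= normr0 ltW. Qed.

Lemma rho_gt0 : 0 < rho.
Proof.
by rewrite /rho !sqrtr_gt0 ltr_wpDl ?sqr_ge0 // exprn_gt0.
Qed.

Lemma rt_le_rho p : strip Rr p -> rt a (v p) <= rho.
Proof.
move=> sp; apply: ler_wsqrtr; apply: ler_wsqrtr; apply: lerD; apply: sqr_le_norm => //.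
exact: vM.
Qed.

Lemma cvx2_ge_rho p : strip Rr p -> 3 / 4 / rho <= cvx2 a (v p).
Proof.
move=> sp; apply: le_trans (cvx2_ge _ a0).
rewrite ler_wpM2l // lef_pV2 ?posrE ?rho_gt0 ?rt_gt0 //; exact: rt_le_rho.
Qed.

Lemma cvx_le_rho p : strip Rr p -> 0 <= cvx a (v p) <= rho ^+ 3.
Proof.
move=> sp; rewrite /cvx exprn_ge0 /= ?sqrtr_ge0 //.
rewrite ler_pXn2r ?nnegrE ?sqrtr_ge0 //; exact: rt_le_rho.
Qed.

Lemma sqr_ux_le p : strip Rr p -> dux D p ^+ 2 <= 4 / 3 * rho * energy p.
Proof.
move=> sp; have r0 := rho_gt0.
have h : 3 / 4 / rho * dux D p ^+ 2 <= energy p.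
  rewrite /energy mulrDr -[X in X <= _]addr0; apply: lerD.
    by rewrite ler_wpM2r ?sqr_ge0 // cvx2_ge_rho.
  by rewrite mulr_ge0 ?cvx2_ge0 // mulr_ge0 ?sqr_ge0 // mulr_ge0 ?sqrtr_ge0.
have -> : dux D p ^+ 2 = 4 / 3 * rho * (3 / 4 / rho * dux D p ^+ 2) by field; rewrite gt_eqF.
by rewrite ler_wpM2l // mulr_ge0 // ltW.
Qed.

(** The weight [sqrt |y|] is the price of a constant that does not depend on [a]. *)
Lemma sqr_uy_le p : Num.sqrt `|p.2| * duy D p ^+ 2 <= energy p.
Proof.
apply: (@le_trans _ _ (2 * (wt a (v p) p.2 * cvx2 a (v p)) * duy D p ^+ 2)).
  rewrite ler_wpM2r ?sqr_ge0 //.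
  have := wt_cvx2_ge (v p) p.2 a0; have := sqrtr_ge0 `|p.2|; lra.
have : 0 <= cvx2 a (v p) * dux D p ^+ 2 by rewrite mulr_ge0 ?cvx2_ge0 ?sqr_ge0.
rewrite /energy; lra.
Qed.

(** In [v_x ^+ 2 = 4 * wt ^+ 2 * u_y ^+ 2] one factor [wt] belongs to the energy and the other is at
    most [M + Rr + A]. *)
Lemma sqr_vx_le x y : `|y| < Rr ->
  dvx D (x, y) ^+ 2 <= 8 / 3 * rho * (M + Rr + A) * energy (x, y).
Proof.
move=> yR; have r0 := rho_gt0; have M0 := M_ge0; have q0 := wt_gt0 (v (x, y)) y a0.
have sp : strip Rr (x, y) by exact: ltW.
have vxy := vM sp.
have qM : wt a (v (x, y)) y <= M + Rr + A.
  rewrite -(@ler_pXn2r _ 2) // ?nnegrE ?sqr_wt; first last.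
  - by have := R0; have := A0; lra.
  - exact: ltW.
  have h1 : v (x, y) ^+ 2 <= M ^+ 2 by exact: sqr_le_norm.
  have h2 : y ^+ 2 <= Rr ^+ 2 by apply: sqr_le_norm; exact: ltW.
  have h3 : a ^+ 2 <= A ^+ 2 by exact: sqr_le_norm.
  have h4 : 0 <= M * Rr by rewrite mulr_ge0 // ltW.
  have h5 : 0 <= M * A by rewrite mulr_ge0 // ltW.
  have h6 : 0 <= Rr * A by rewrite mulr_ge0 // ltW.
  rewrite (_ : (M + Rr + A) ^+ 2 = M ^+ 2 + Rr ^+ 2 + A ^+ 2 + 2 * (M * Rr) + 2 * (M * A) + 2 * (Rr * A)); last by ring.
  lra.
rewrite (sol_eq S x yR).
set Q := wt a (v (x, y)) y in q0 qM *; set U := duy D (x, y).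
have h : 3 / 4 / rho * (2 * Q * U ^+ 2) <= energy (x, y).
  rewrite /energy mulrDr -[X in X <= _]add0r; apply: lerD.
    by rewrite mulr_ge0 ?cvx2_ge0 ?sqr_ge0.
  rewrite ler_wpM2r ?cvx2_ge_rho // mulr_ge0 ?sqr_ge0 // mulr_ge0 //; exact: ltW.
have -> : (- 2 * Q * U) ^+ 2 = 8 / 3 * rho * Q * (3 / 4 / rho * (2 * Q * U ^+ 2)).
  by field; rewrite gt_eqF.
apply: ler_pM => //.
- by rewrite !mulr_ge0 // ltW.
- rewrite mulr_ge0 //; first by rewrite divr_ge0 // ltW.
  by rewrite mulr_ge0 ?sqr_ge0 // mulr_ge0 // ltW.
- by rewrite ler_wpM2l // mulr_ge0 // ltW.
Qed.

Section EnergyIntegral.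
Variable x0 : R.

Definition cvx_int y := integ (fun s => cvx a (v (s, y))) x0 (x0 + P).
Definition cvx_int1 y := integ (fun s => cvx1 a (v (s, y)) * dux D (s, y)) x0 (x0 + P).
Definition energy_int y := integ (fun s => energy (s, y)) x0 (x0 + P).

Let x0P : x0 <= x0 + P. Proof. by rewrite lerDl ltW. Qed.

Lemma continuous_cvx_v (h : R -> R) : (forall t, {for t, continuous h}) ->
  forall x y, `|y| < Rr -> {for (x, y), continuous (fun p => h (v p))}.
Proof. by move=> ch x y yR; apply: (cts_comp (scont_int (sol_cv S) yR)). Qed.

Lemma cvx_cont t : {for t, continuous (cvx a)}.
Proof. exact: is_derive_continuous (d_cvx t a0). Qed.

Lemma cvx1_cont t : {for t, continuous (cvx1 a)}.
Proof. exact: is_derive_continuous (d_cvx1 t a0). Qed.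

Lemma d_cvx_int y : `|y| < Rr -> is_derive y 1 cvx_int (cvx_int1 y).
Proof.
move=> yR.
have sm z : `|z - y| < Rr - `|y| -> `|z| < Rr.
  by move=> h; have := ler_normD (z - y) y; rewrite subrK; lra.
have cf x z : `|z| < Rr -> {for (x, z), continuous (fun p => cvx1 a (v p) * dux D p)}.
  move=> zR; apply: ctsM; last exact: sol_cux S x z zR.
  exact: (continuous_cvx_v cvx1_cont).
apply: (@int_param_derive _ (fun p => cvx a (v p)) (fun p => cvx1 a (v p) * dux D p)
  x0 (x0 + P) y (Rr - `|y|)) => //.
- by rewrite subr_gt0.
- move=> x z /sm zR; apply: (continuous_slice1 (f := fun p => cvx a (v p))).
  exact: (continuous_cvx_v cvx_cont).
- move=> x z _ /sm zR; rewrite [X in is_derive _ _ _ X]mulrC.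
  exact: d_comp (sol_vy S x zR) (d_cvx _ a0).
- by move=> x; exact: continuous_slice1 (cf x y yR).
- by move=> x _; exact: cf.
Qed.

(* Integrating by parts over a period turns the [u_xy] term of the second derivative into energy. *)
Lemma d_cvx_int1 y : `|y| < Rr -> is_derive y 1 cvx_int1 (energy_int y).
Proof.
move=> yR.
have sm z : `|z - y| < Rr - `|y| -> `|z| < Rr.
  by move=> h; have := ler_normD (z - y) y; rewrite subrK; lra.
have cg x z : `|z| < Rr -> {for (x, z), continuous (fun p => cvx1 a (v p) * dux D p)}.
  move=> zR; apply: ctsM; last exact: sol_cux S x z zR.
  exact: (continuous_cvx_v cvx1_cont).
pose f p := cvx2 a (v p) * dux D p ^+ 2 + cvx1 a (v p) * duxy D p.
have cf x z : `|z| < Rr -> {for (x, z), continuous f}.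
  move=> zR; apply: ctsD; apply: ctsM.
  - by apply: (continuous_cvx_v (h := cvx2 a)) => // t; exact: continuous_cvx2.
  - by apply: ctsX; exact: sol_cux S x z zR.
  - exact: (continuous_cvx_v cvx1_cont).
  - exact: sol_cuxy S x z zR.
have ce x z : `|z| < Rr -> {for (x, z), continuous energy} by exact: continuous_energy.
have E : integ (fun s => f (s, y)) x0 (x0 + P) = energy_int y.
  apply/eqP; rewrite -subr_eq0 -intB; first last.
  - by move=> s; exact: continuous_slice1 (ce s y yR).
  - by move=> s; exact: continuous_slice1 (cf s y yR).
  have uyP : duy D (x0 + P, y) = duy D (x0, y).
    apply: is_derive_uniq (sol_uy S (x0 + P) yR) _.
    apply: (is_derive_near (e := Rr - `|y|)) (sol_uy S x0 yR); first by rewrite subr_gt0.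
    by move=> z /sm zR; rewrite uP.
  have dF s : is_derive s 1 (fun s => cvx1 a (v (s, y)) * duy D (s, y)) (f (s, y) - energy (s, y)).
    have h := dM (d_comp (sol_vx S s yR) (d_cvx1 _ a0)) (sol_uyx S s yR).
    by apply: d_eq h; rewrite (sol_eq S s yR) /f /energy /=; ring.
  have cfe : continuous (fun s => f (s, y) - energy (s, y)).
    apply: ctsP => s; apply: ctsB; first exact: continuous_slice1 (cf s y yR).
    exact: continuous_slice1 (ce s y yR).
  by rewrite (intE' cfe x0P (fun s _ => dF s)) vP // uyP subrr.
have r0 : 0 < Rr - `|y| by rewrite subr_gt0.
have H1 x z : `|z - y| < Rr - `|y| -> {for x, continuous (fun s => cvx1 a (v (s, z)) * dux D (s, z))}.
  by move=> /sm zR; exact: continuous_slice1 (cg x z zR).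
have H2 x z : x0 <= x <= x0 + P -> `|z - y| < Rr - `|y| ->
    is_derive z 1 (fun t => cvx1 a (v (x, t)) * dux D (x, t)) (f (x, z)).
  move=> _ /sm zR; have h := dM (d_comp (sol_vy S x zR) (d_cvx1 _ a0)) (sol_uxy S x zR).
  by apply: d_eq h; rewrite /f; ring.
have H3 x : {for x, continuous (fun s => f (s, y))} by exact: continuous_slice1 (cf x y yR).
have H4 x : x0 <= x <= x0 + P -> {for (x, y), continuous f} by move=> _; exact: cf.
rewrite -E.
exact: (int_param_derive (g := fun p => cvx1 a (v p) * dux D p) r0 x0P H1 H2 H3 H4).
Qed.

Lemma energy_int_ge0 y : `|y| < Rr -> 0 <= energy_int y.
Proof.
move=> yR; apply: int_ge0 => //; last by move=> s _; exact: energy_ge0.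
by move=> s; apply: (continuous_slice1 (f := energy)); exact: continuous_energy.
Qed.

Lemma cvx_int_bounds y : `|y| < Rr -> 0 <= cvx_int y <= rho ^+ 3 * P.
Proof.
move=> yR; have sp s : strip Rr (s, y) by exact: ltW.
have c : continuous (fun s => cvx a (v (s, y))).
  move=> s; apply: (continuous_slice1 (f := fun p => cvx a (v p))).
  exact: (continuous_cvx_v cvx_cont).
apply/andP; split.
  by apply: int_ge0 => // s _; have /andP[] := cvx_le_rho (sp s).
have h := int_le_cst c x0P (fun s _ => (andP (cvx_le_rho (sp s))).2).
by move: h; rewrite addrAC subrr add0r.
Qed.

Lemma cvx_int1_mono p q : - Rr < p -> q < Rr -> p <= q -> cvx_int1 p <= cvx_int1 q.
Proof.
move=> h1 h2 pq.
have b z : p <= z <= q -> `|z| < Rr by move=> /andP[? ?]; apply/ltr_normlP; split; lra.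
apply: (derive_ge0_le pq (df := energy_int)).
- by move=> z /andP[z1 z2]; apply: d_cvx_int1; apply: b; rewrite !ltW.
- by move=> z /b zR; exact: is_derive_continuous (d_cvx_int1 zR).
- by move=> z /andP[z1 z2]; apply: energy_int_ge0; apply: b; rewrite !ltW.
Qed.

(** [cvx_int] is convex with values between 0 and [rho ^+ 3 * P], so its slope at one end is limited
    by the room up to the other. *)
Lemma cvx_int1_le p q : - Rr < p -> q < Rr -> p < q ->
  cvx_int1 p <= rho ^+ 3 * P / (q - p) /\ - cvx_int1 q <= rho ^+ 3 * P / (q - p).
Proof.
move=> h1 h2 pq.
have b z : p <= z <= q -> `|z| < Rr by move=> /andP[? ?]; apply/ltr_normlP; split; lra.
have [||c /andP[c1 c2] E] := @mvt _ cvx_int cvx_int1 p q pq.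
- by move=> z /andP[z1 z2]; apply: d_cvx_int; apply: b; rewrite !ltW.
- by move=> z /b zR; exact: is_derive_continuous (d_cvx_int zR).
have qp : 0 < q - p by rewrite subr_gt0.
have /andP[k1 k2] := cvx_int_bounds (b p ltac:(lra)).
have /andP[k3 k4] := cvx_int_bounds (b q ltac:(lra)).
have m1 := cvx_int1_mono h1 (lt_trans c2 h2) (ltW c1).
have m2 := cvx_int1_mono (lt_trans h1 c1) h2 (ltW c2).
rewrite !ler_pdivlMr //; split.
  by apply: (@le_trans _ _ (cvx_int1 c * (q - p))); [rewrite ler_wpM2r // ltW|lra].
apply: (@le_trans _ _ (- cvx_int1 c * (q - p))); last by rewrite mulNr; lra.
by rewrite ler_wpM2r ?lerN2 // ltW.
Qed.

Lemma cvx_int1_var r p q : 0 < r < Rr -> - r <= p -> p <= q -> q <= r ->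
  cvx_int1 q - cvx_int1 p <= 4 * (rho ^+ 3 * P) / (Rr - r).
Proof.
(* Half the margin to the boundary: slopes at [p] and [q] are estimated over a further length [h]
   that stays inside the open strip. *)
move=> /andP[r0 rR] h1 pq h2; set h := (Rr - r) / 2.
have h0 : 0 < h by rewrite divr_gt0 // subr_gt0.
have hE : h + h = Rr - r by rewrite /h; field.
have [k1 _] := @cvx_int1_le q (q + h) ltac:(lra) ltac:(lra) ltac:(lra).
have [_ k2] := @cvx_int1_le (p - h) p ltac:(lra) ltac:(lra) ltac:(lra).
have e1 : q + h - q = h by ring.
have e2 : p - (p - h) = h by ring.
rewrite e1 in k1; rewrite e2 in k2.
have -> : 4 * (rho ^+ 3 * P) / (Rr - r) = rho ^+ 3 * P / h + rho ^+ 3 * P / h.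
  by rewrite /h; field; rewrite gt_eqF // subr_gt0.
lra.
Qed.

(** Energy is the derivative of the slope [cvx_int1], so by the mean value theorem some height
    carries no more than the average energy. *)
Lemma horizontal_line r p q : 0 < r < Rr -> - r <= p -> p < q -> q <= r ->
  exists2 y : R, p < y < q & energy_int y <= 4 * (rho ^+ 3 * P) / (Rr - r) / (q - p).
Proof.
move=> /andP[r0 rR] h1 pq h2.
have b z : p <= z <= q -> `|z| < Rr by move=> /andP[? ?]; apply/ltr_normlP; split; lra.
have [||c hc E] := @mvt _ cvx_int1 energy_int p q pq.
- by move=> z /andP[z1 z2]; apply: d_cvx_int1; apply: b; rewrite !ltW.
- by move=> z /b zR; exact: is_derive_continuous (d_cvx_int1 zR).
exists c => //; rewrite ler_pdivlMr ?subr_gt0 // -E.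
by apply: cvx_int1_var; rewrite ?r0 // ltW.
Qed.

(** By Fubini the average over abscissae of the energy along vertical lines is at most the energy of
    a whole period divided by [l]. *)
Lemma vertical_line r l : 0 < r < Rr -> 0 < l <= P ->
  exists2 x : R, x0 < x < x0 + l &
    integ (fun y => energy (x, clamp r y)) (- r) r <= 4 * (rho ^+ 3 * P) / (Rr - r) / l.
Proof.
move=> rr /andP[l0 lP]; have /andP[r0 rR] := rr.
pose ec (p : R * R) := energy (p.1, clamp r p.2).
have cec : continuous ec by apply: (continuous_clamp (ltW r0) rR) => x y; exact: continuous_energy.
have rr' : - r <= r by lra.
have x0l : x0 < x0 + l by rewrite ltrDl.
have c1 y : continuous (fun x => ec (x, y)) by move=> x; exact: continuous_slice1 (cec _).
have c2 x : continuous (fun y => ec (x, y)) by move=> y; exact: continuous_slice2 (cec _).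
have cI b : x0 <= b -> continuous (fun y => integ (fun x => ec (x, y)) x0 b).
  move=> xb; apply: ctsP => y; apply: (@continuous_int _ ec x0 b y 1) => //.
    by move=> *; exact: c1.
  by move=> *; exact: cec.
have F := fubini cec (ltW x0l) rr'.
have G : integ (fun y => integ (fun x => ec (x, y)) x0 (x0 + l)) (- r) r
    <= integ (fun y => integ (fun x => ec (x, y)) x0 (x0 + P)) (- r) r.
  apply: le_int => //; [exact: cI (ltW x0l)|exact: cI x0P|].
  move=> y _; rewrite -[X in _ <= X](int_chasles _ x0 (x0 + l)) lerDl.
  by apply: int_ge0 => //; [rewrite lerD2l|move=> s _; exact: energy_ge0].
have H : integ (fun y => integ (fun x => ec (x, y)) x0 (x0 + P)) (- r) r = cvx_int1 r - cvx_int1 (- r).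
  have b z : - r <= z <= r -> `|z| < Rr by move=> /andP[? ?]; apply/ltr_normlP; split; lra.
  apply: intE' => //; first exact: cI x0P.
  move=> y hy; have := d_cvx_int1 (b y hy).
  by rewrite /energy_int /ec /= clamp_id //; apply/ler_normlP; split; lra.
have cJ : continuous (fun x => integ (fun y => ec (x, y)) (- r) r).
  apply: ctsP => x; have := @continuous_int _ (fun p : R * R => ec (p.2, p.1)) (- r) r x 1 ltr01 rr'.
  apply => [y z _|y _]; first exact: c2.
  by apply: continuous_swap; exact: cec.
have [x hx E] := int_mvt cJ x0l.
exists x => //; rewrite ler_pdivlMr //.
have -> : l = x0 + l - x0 by ring.
rewrite -[X in X <= _]E F; apply: (le_trans G); rewrite H.
by apply: cvx_int1_var; rewrite // ?lexx.
Qed.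

End EnergyIntegral.
End Energy.

(** * Lines of controlled oscillation *)

Section GoodLines.
Context {R : realType}.
Implicit Types (x y z t e d r k s l h m p q : R) (u v f g : R * R -> R).

(** A linear substitute for the Cauchy-Schwarz inequality; [k] is tuned at the end. *)
Lemma amgm k x : 0 < k -> `|x| <= k * x ^+ 2 + k^-1.
Proof.
move=> k0; rewrite -(ler_pM2l k0) mulrDr divff ?gt_eqF //.
have -> : k * (k * x ^+ 2) = (k * `|x|) ^+ 2 by rewrite exprMn real_normK ?num_real //; ring.
set z := k * `|x|; have := sqr_ge0 (z - 2^-1).
have -> : (z - 2^-1) ^+ 2 = z ^+ 2 - z + 4^-1 by field.
lra.
Qed.

(** The functions [k * prim e + S - phi] and [k * prim e + S + phi] are nondecreasing. [S] is a
    separate explicit primitive because its derivative may blow up at an end point. *)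
Lemma oscillation (phi dphi S dS e : R -> R) k p q : p <= q -> continuous e ->
  (forall t, p < t < q -> is_derive t 1 phi (dphi t)) ->
  (forall t, p < t < q -> is_derive t 1 S (dS t)) ->
  (forall t, p <= t <= q -> {for t, continuous phi}) ->
  (forall t, p <= t <= q -> {for t, continuous S}) ->
  (forall t, p < t < q -> `|dphi t| <= k * e t + dS t) ->
  `|phi q - phi p| <= k * integ e p q + (S q - S p).
Proof.
move=> pq ce h1 h2 c1 c2 hb.
have dE t : is_derive t 1 (prim e) (e t) by exact: prim_derive.
have cE t : {for t, continuous (prim e)} by exact: prim_continuous.
have H1 : (fun t => k * prim e t + S t - phi t) p <= (fun t => k * prim e t + S t - phi t) q.
  have d t : p < t < q -> is_derive t 1 (fun t => k * prim e t + S t - phi t) (k * e t + dS t - dphi t).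
    by move=> ht; have := dB (dD (dZ k (dE t)) (h2 t ht)) (h1 t ht).
  apply: (derive_ge0_le pq d) => t ht.
    apply: ctsB; last exact: c1.
    by apply: ctsD; [apply: ctsM; [exact: cts_cst|exact: cE]|exact: c2].
  by have /ler_normlP [_] := hb t ht; rewrite subr_ge0.
have H2 : (fun t => k * prim e t + S t + phi t) p <= (fun t => k * prim e t + S t + phi t) q.
  have d t : p < t < q -> is_derive t 1 (fun t => k * prim e t + S t + phi t) (k * e t + dS t + dphi t).
    by move=> ht; have := dD (dD (dZ k (dE t)) (h2 t ht)) (h1 t ht).
  apply: (derive_ge0_le pq d) => t ht.
    apply: ctsD; last exact: c1.
    by apply: ctsD; [apply: ctsM; [exact: cts_cst|exact: cE]|exact: c2].
  by have /ler_normlP [] := hb t ht; lra.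
by rewrite /integ mulrBr; apply/ler_normlP; split; move: H1 H2 => /=; lra.
Qed.

Lemma oscillation_lin (phi dphi e : R -> R) k p q : 0 < k -> p <= q -> continuous e ->
  (forall t, p < t < q -> is_derive t 1 phi (dphi t)) ->
  (forall t, p <= t <= q -> {for t, continuous phi}) ->
  (forall t, p < t < q -> dphi t ^+ 2 <= e t) ->
  `|phi q - phi p| <= k * integ e p q + (q - p) / k.
Proof.
move=> k0 pq ce h1 c1 hb.
have -> : (q - p) / k = k^-1 * q - k^-1 * p by ring.
apply: (oscillation pq ce h1 (dS := fun=> k^-1 * 1) (S := fun t => k^-1 * t)) => //.
- by move=> t _; apply: ctsM; [exact: cts_cst|exact: cvg_id].
- move=> t ht; rewrite mulr1; apply: (le_trans (amgm _ k0)).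
  by rewrite lerD2r ler_wpM2l ?hb // ltW.
Qed.

Lemma sqrt_sub_le p q : 0 <= p -> p <= q -> Num.sqrt q - Num.sqrt p <= Num.sqrt (q - p).
Proof.
move=> p0 pq; rewrite lerBlDr.
rewrite -(@ler_pXn2r _ 2) ?nnegrE ?addr_ge0 ?sqrtr_ge0 //.
rewrite sqrrD !sqr_sqrtr ?subr_ge0 //; last exact: le_trans pq.
have : 0 <= Num.sqrt (q - p) * Num.sqrt p by rewrite mulr_ge0 ?sqrtr_ge0.
by rewrite -mulr_natr; lra.
Qed.

(** [amgm] with the parameter [k * sqrt |t|] leaves the inverse of that parameter, which is
    integrable through 0. Each side of 0 contributes at most [2 * sqrt (q - p) / k], whence the
    factor 4. *)
Lemma oscillation_sqrt (phi dphi e : R -> R) k p q : 0 < k -> p <= q -> continuous e ->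
  (forall t, 0 <= e t) ->
  (forall t, p < t < q -> is_derive t 1 phi (dphi t)) ->
  (forall t, p <= t <= q -> {for t, continuous phi}) ->
  (forall t, p < t < q -> Num.sqrt `|t| * dphi t ^+ 2 <= e t) ->
  `|phi q - phi p| <= k * integ e p q + 4 * Num.sqrt (q - p) / k.
Proof.
move=> k0 pq ce e0 h1 c1 hb.
have pos p' q' : 0 <= p' -> p <= p' -> p' <= q' -> q' <= q ->
   `|phi q' - phi p'| <= k * integ e p' q' + 2 * Num.sqrt (q' - p') / k.
  move=> p'0 pp pq' qq.
  have kn : 0 < k^-1 by rewrite invr_gt0.
  apply: (@le_trans _ _ (k * integ e p' q' + ((2 * k^-1) * Num.sqrt q' - (2 * k^-1) * Num.sqrt p'))).
    apply: (oscillation pq' ce (dphi := dphi) (dS := fun t => (2 * k^-1) * (1 / (2 * Num.sqrt t)))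
       (S := fun t => (2 * k^-1) * Num.sqrt t)).
    - by move=> t /andP[t1 t2]; apply: h1; lra.
    - move=> t /andP[t1 t2]; have t0 : 0 < t by exact: le_lt_trans t1.
      exact: dZ _ (d_sqrt (f := fun t => t) t0 (d_id t)).
    - by move=> t /andP[t1 t2]; apply: c1; lra.
    - by move=> t _; apply: ctsM; [exact: cts_cst|apply: cts_sqrt; exact: cvg_id].
    - move=> t /andP[t1 t2]; have t0 : 0 < t by exact: le_lt_trans t1.
      have st : 0 < Num.sqrt t by rewrite sqrtr_gt0.
      apply: (le_trans (amgm _ (mulr_gt0 k0 st))).
      have -> : 2 * k^-1 * (1 / (2 * Num.sqrt t)) = (k * Num.sqrt t)^-1 by field; rewrite !gt_eqF.
      rewrite lerD2r -mulrA ler_wpM2l ?(ltW k0) //.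
      by have := hb t; rewrite gtr0_norm //; apply; lra.
  rewrite lerD2l -mulrBr [X in _ <= X]mulrAC ler_wpM2l ?sqrt_sub_le //.
  by rewrite mulr_ge0 // ltW.
have neg p' q' : q' <= 0 -> p <= p' -> p' <= q' -> q' <= q ->
   `|phi q' - phi p'| <= k * integ e p' q' + 2 * Num.sqrt (q' - p') / k.
  move=> q'0 pp pq' qq.
  have kn : 0 < k^-1 by rewrite invr_gt0.
  apply: (@le_trans _ _ (k * integ e p' q' + ((- (2 * k^-1)) * Num.sqrt (- q') - (- (2 * k^-1)) * Num.sqrt (- p')))).
    apply: (oscillation pq' ce (dphi := dphi) (dS := fun t => (- (2 * k^-1)) * (- 1 / (2 * Num.sqrt (- t))))
       (S := fun t => (- (2 * k^-1)) * Num.sqrt (- t))).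
    - by move=> t /andP[t1 t2]; apply: h1; lra.
    - move=> t /andP[t1 t2]; have t0 : 0 < - t by lra.
      exact: dZ _ (d_sqrt (f := fun t => - t) t0 (dN (d_id t))).
    - by move=> t /andP[t1 t2]; apply: c1; lra.
    - move=> t _; apply: ctsM; first exact: cts_cst.
      by apply: cts_sqrt; apply: ctsN; exact: cvg_id.
    - move=> t /andP[t1 t2]; have t0 : 0 < - t by lra.
      have st : 0 < Num.sqrt (- t) by rewrite sqrtr_gt0.
      apply: (le_trans (amgm _ (mulr_gt0 k0 st))).
      have -> : - (2 * k^-1) * (- 1 / (2 * Num.sqrt (- t))) = (k * Num.sqrt (- t))^-1.
        by field; rewrite !gt_eqF.
      rewrite lerD2r -mulrA ler_wpM2l ?(ltW k0) //.
      have := hb t; rewrite ltr0_norm; last by lra.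
      by apply; lra.
  rewrite lerD2l !mulNr opprK addrC -mulrBr [X in _ <= X]mulrAC ler_wpM2l //.
    by rewrite mulr_ge0 // ltW.
  have -> : q' - p' = - p' - - q' by ring.
  by apply: sqrt_sub_le; lra.
have half p' q' : p <= p' -> p' <= q' -> q' <= q -> 2 * Num.sqrt (q' - p') / k <= 2 * Num.sqrt (q - p) / k.
  move=> *; rewrite ler_wpM2r ?invr_ge0 ?(ltW k0) // ler_wpM2l //.
  by apply: ler_wsqrtr; lra.
have fin p' q' : p <= p' -> p' <= q' -> q' <= q -> 0 <= integ e p' q'.
  by move=> *; apply: int_ge0.
have T0 : 0 <= 2 * Num.sqrt (q - p) / k by rewrite divr_ge0 ?mulr_ge0 ?sqrtr_ge0 // ltW.
have -> : 4 * Num.sqrt (q - p) / k = 2 * Num.sqrt (q - p) / k + 2 * Num.sqrt (q - p) / k.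
  by field; rewrite gt_eqF.
case: (leP 0 p) => p0.
  by apply: (le_trans (pos p q p0 (lexx _) pq (lexx _))); lra.
case: (leP q 0) => q0.
  by apply: (le_trans (neg p q q0 (lexx _) pq (lexx _))); lra.
have n1 := neg p 0 (lexx _) (lexx _) (ltW p0) (ltW q0).
have n2 := pos 0 q (lexx _) (ltW p0) (ltW q0) (lexx _).
have n3 := half p 0 (lexx _) (ltW p0) (ltW q0).
have n4 := half 0 q (ltW p0) (ltW q0) (lexx _).
have n5 := ler_normD (phi q - phi 0) (phi 0 - phi p).
have E : phi q - phi p = phi q - phi 0 + (phi 0 - phi p) by ring.
rewrite E -(int_chasles e p 0 q) mulrDr; lra.
Qed.

Variables (Rr P a M A : R) (u v : R * R -> R) (D : @derivs R).
Hypotheses (R0 : 0 < Rr) (P0 : 0 < P) (a0 : a != 0) (A0 : 0 < A) (aA : `|a| <= A).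
Hypothesis S : is_sol Rr a u v D.
Hypothesis uP : forall x y, `|y| < Rr -> u (x + P, y) = u (x, y).
Hypothesis vP : forall x y, `|y| < Rr -> v (x + P, y) = v (x, y).
Hypothesis vM : forall p : R * R, strip Rr p -> `|v p| <= M.

(** The first factor dominates the constants of the bounds of [u_y], [u_x] and [v_x] by energy; the
    second bounds the energy of one period over [|y| <= r]. *)
Definition line_cst r := (1 + 4 / 3 * rho M A + 8 / 3 * rho M A * (M + Rr + A)) *
  (4 * (rho M A ^+ 3 * P) / (Rr - r)).

Let K1 := 1 + 4 / 3 * rho M A + 8 / 3 * rho M A * (M + Rr + A).
Let e := energy a v D.

Let M0 : 0 <= M. Proof. exact: M_ge0 R0 vM. Qed.
Let r0 : 0 < rho M A. Proof. exact: rho_gt0. Qed.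

Let K1_ge : 1 <= K1 /\ 4 / 3 * rho M A <= K1 /\ 8 / 3 * rho M A * (M + Rr + A) <= K1.
Proof.
have h1 : 0 <= 4 / 3 * rho M A by rewrite mulr_ge0 // ltW // r0.
have h2 : 0 <= 8 / 3 * rho M A * (M + Rr + A).
  rewrite mulr_ge0 //; first by rewrite mulr_ge0 // ltW // r0.
  by rewrite !addr_ge0 // ?M0 // ltW.
rewrite /K1; move: h1 h2; lra.
Qed.

Lemma vertical_osc r l x0 : 0 < r < Rr -> 0 < l <= P ->
  exists2 x : R, x0 < x < x0 + l & forall k p q, 0 < k -> - r <= p -> p <= q -> q <= r ->
   `|v (x, q) - v (x, p)| <= k * (line_cst r / l) + (q - p) / k /\
   `|u (x, q) - u (x, p)| <= k * (line_cst r / l) + 4 * Num.sqrt (q - p) / k.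
Proof.
move=> rr ll; have /andP[rp rR] := rr; have /andP[l0 lP] := ll.
have [x hx hE] := vertical_line P0 a0 aA S uP vP vM x0 rr ll.
exists x => // k p q k0 hp pq hq.
have [k1 [k2 k3]] := K1_ge.
have b t : p <= t <= q -> `|t| <= r by move=> ht; apply/ler_normlP; split; lra.
have b' t : p <= t <= q -> `|t| < Rr by move=> /b h; exact: le_lt_trans rR.
pose ec t := K1 * e (x, clamp r t).
have cc : continuous (fun t => e (x, clamp r t)).
  have := continuous_clamp (ltW rp) rR (continuous_energy a0 S).
  by move=> c t; exact: continuous_slice2 (c (x, t)).
have cec : continuous ec by apply: ctsP => t; apply: ctsM; [exact: cts_cst|exact: cc].
have e0 t : 0 <= e (x, clamp r t) by exact: energy_ge0.
have ec0 t : 0 <= ec t by rewrite mulr_ge0 //; lra.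
have bnd : integ ec p q <= line_cst r / l.
  rewrite intZ // /line_cst -/K1 -[X in _ <= X]mulrA; apply: ler_wpM2l; first by lra.
  apply: le_trans hE; rewrite -(int_chasles _ (- r) p r) -(int_chasles _ p q r).
  have i1 : 0 <= integ (fun y => e (x, clamp r y)) (- r) p by apply: int_ge0.
  have i2 : 0 <= integ (fun y => e (x, clamp r y)) q r by apply: int_ge0.
  by rewrite /e in i1 i2 *; lra.
split.
  apply: (@le_trans _ _ (k * integ ec p q + (q - p) / k)); last first.
    by rewrite lerD2r ler_wpM2l // ltW.
  apply: (oscillation_lin (phi := fun t => v (x, t)) k0 pq cec (dphi := fun t => dux D (x, t))).
  - move=> t /andP[t1 t2]; have tR : `|t| < Rr by apply: b'; rewrite !ltW.
    by have := sol_vy S x tR.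
  - by move=> t /b' tR; exact: is_derive_continuous (sol_vy S x tR).
  - move=> t /andP[t1 t2]; have tr : `|t| <= r by apply: b; rewrite !ltW.
    rewrite /ec clamp_id //; apply: le_trans (sqr_ux_le D a0 A0 aA vM _) _.
      by apply: le_trans tr _; exact: ltW.
    by rewrite ler_wpM2r // energy_ge0.
apply: (@le_trans _ _ (k * integ ec p q + 4 * Num.sqrt (q - p) / k)); last first.
  by rewrite lerD2r ler_wpM2l // ltW.
apply: (oscillation_sqrt (phi := fun t => u (x, t)) k0 pq cec ec0 (dphi := fun t => duy D (x, t))).
- move=> t /andP[t1 t2]; have tR : `|t| < Rr by apply: b'; rewrite !ltW.
  by have := sol_uy S x tR.
- by move=> t /b' tR; exact: is_derive_continuous (sol_uy S x tR).
- move=> t /andP[t1 t2]; have tr : `|t| <= r by apply: b; rewrite !ltW.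
  rewrite /ec clamp_id //; apply: le_trans (sqr_uy_le v D a0 (x, t)) _.
  by rewrite ler_peMl // energy_ge0.
Qed.

Lemma horizontal_osc r p0 q0 x0 : 0 < r < Rr -> - r <= p0 -> p0 < q0 -> q0 <= r ->
  exists2 y : R, p0 < y < q0 & forall k p q, 0 < k -> x0 <= p -> p <= q -> q <= x0 + P ->
   `|v (q, y) - v (p, y)| <= k * (line_cst r / (q0 - p0)) + (q - p) / k /\
   `|u (q, y) - u (p, y)| <= k * (line_cst r / (q0 - p0)) + (q - p) / k.
Proof.
move=> rr hp0 pq0 hq0; have /andP[rp rR] := rr.
have [y hy hE] := horizontal_line P0 a0 aA S uP vP vM x0 rr hp0 pq0 hq0.
exists y => // k p q k0 hp pq hq.
have [k1 [k2 k3]] := K1_ge.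
have yR : `|y| < Rr by apply/ltr_normlP; split; lra.
pose ec t := K1 * e (t, y).
have cc : continuous (fun t => e (t, y)).
  by move=> t; apply: (continuous_slice1 (f := e)); exact: (continuous_energy a0 S).
have cec : continuous ec by apply: ctsP => t; apply: ctsM; [exact: cts_cst|exact: cc].
have e0 t : 0 <= e (t, y) by exact: energy_ge0.
have bnd : integ ec p q <= line_cst r / (q0 - p0).
  rewrite intZ // /line_cst -/K1 -[X in _ <= X]mulrA; apply: ler_wpM2l; first by lra.
  apply: le_trans hE; rewrite /energy_int -/e -(int_chasles (fun s => e (s, y)) x0 p (x0 + P))
    -(int_chasles (fun s => e (s, y)) p q (x0 + P)).
  have i1 : 0 <= integ (fun x => e (x, y)) x0 p by apply: int_ge0.
  have i2 : 0 <= integ (fun x => e (x, y)) q (x0 + P) by apply: int_ge0.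
  by move: i1 i2; lra.
have fin X : X <= k * integ ec p q + (q - p) / k -> X <= k * (line_cst r / (q0 - p0)) + (q - p) / k.
  by move=> h; apply: le_trans h _; rewrite lerD2r ler_wpM2l // ltW.
split; apply: fin.
  apply: (oscillation_lin (phi := fun t => v (t, y)) k0 pq cec (dphi := fun t => dvx D (t, y))).
  - by move=> t _; have := sol_vx S t yR.
  - by move=> t _; exact: is_derive_continuous (sol_vx S t yR).
  - move=> t _; apply: le_trans (sqr_vx_le R0 a0 A0 aA S vM t yR) _.
    by rewrite /ec ler_wpM2r // energy_ge0.
apply: (oscillation_lin (phi := fun t => u (t, y)) k0 pq cec (dphi := fun t => dux D (t, y))).
- by move=> t _; have := sol_ux S t yR.
- by move=> t _; exact: is_derive_continuous (sol_ux S t yR).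
- move=> t _; apply: le_trans (sqr_ux_le D a0 A0 aA vM (p := (t, y)) _) _; first exact: ltW.
  by rewrite /ec ler_wpM2r // energy_ge0.
Qed.

End GoodLines.

(** * Local convergence *)

Section LocalConvergence.
Context {R : realType}.
Implicit Types (x y z t e d r k s l h m p q c : R) (u v f g : R * R -> R).

Lemma line_cst_pos (Rr P M A r : R) : 0 < Rr -> 0 < P -> 0 < A -> 0 <= M -> r < Rr ->
  0 < line_cst Rr P M A r.
Proof.
move=> R0 P0 A0 M0 rR; have r0 := rho_gt0 M A0.
rewrite /line_cst mulr_gt0 //; last first.
  by rewrite divr_gt0 ?subr_gt0 // mulr_gt0 // mulr_gt0 // exprn_gt0.
have h1 : 0 <= 4 / 3 * rho M A by rewrite mulr_ge0 // ltW.
have h2 : 0 <= 8 / 3 * rho M A * (M + Rr + A).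
  rewrite mulr_ge0 //; first by rewrite mulr_ge0 // ltW.
  by rewrite !addr_ge0 // ltW.
lra.
Qed.

Lemma box_close_v (Rr a : R) u v D x1 x2 y1 y2 c m : a != 0 -> is_sol Rr a u v D ->
  - Rr < y1 -> y2 < Rr ->
  (forall x y, x1 <= x <= x2 -> y1 <= y <= y2 -> [|| x == x1, x == x2, y == y1 | y == y2] ->
     `|v (x, y) - c| <= m) ->
  forall x y, x1 <= x <= x2 -> y1 <= y <= y2 -> `|v (x, y) - c| <= m.
Proof.
move=> a0 S h1 h2 bd x y hx hy; apply/ler_normlP; split.
  have := box_max_v (c := m - c) a0 (is_solN S) h1 h2 _ hx hy; rewrite /= => h.
  have := h _; suff H : forall X Y, x1 <= X <= x2 -> y1 <= Y <= y2 ->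
    [|| X == x1, X == x2, Y == y1 | Y == y2] -> - v (X, Y) <= m - c by move=> /(_ H); lra.
  by move=> X Y hX hY hb; have /ler_normlP [h3 _] := bd X Y hX hY hb; lra.
suff : v (x, y) <= c + m by lra.
apply: (box_max_v a0 S h1 h2 _ hx hy) => X Y hX hY hb.
by have /ler_normlP [_ h3] := bd X Y hX hY hb; lra.
Qed.

Lemma box_close_u (Rr a : R) u v D x1 x2 y1 y2 c m : a != 0 -> is_sol Rr a u v D ->
  - Rr < y1 -> y2 < Rr ->
  (forall x y, x1 <= x <= x2 -> y1 <= y <= y2 -> [|| x == x1, x == x2, y == y1 | y == y2] ->
     `|u (x, y) - c| <= m) ->
  forall x y, x1 <= x <= x2 -> y1 <= y <= y2 -> `|u (x, y) - c| <= m.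
Proof.
move=> a0 S h1 h2 bd x y hx hy; apply/ler_normlP; split.
  have := box_max_u (c := m - c) a0 (is_solN S) h1 h2 _ hx hy; rewrite /= => h.
  have := h _; suff H : forall X Y, x1 <= X <= x2 -> y1 <= Y <= y2 ->
    [|| X == x1, X == x2, Y == y1 | Y == y2] -> - u (X, Y) <= m - c by move=> /(_ H); lra.
  by move=> X Y hX hY hb; have /ler_normlP [h3 _] := bd X Y hX hY hb; lra.
suff : u (x, y) <= c + m by lra.
apply: (box_max_u a0 S h1 h2 _ hx hy) => X Y hX hY hb.
by have /ler_normlP [_ h3] := bd X Y hX hY hb; lra.
Qed.

Lemma chain_close_v e a b c d :
  `|a - b| <= e -> `|b - c| <= 2 * e -> `|a - d| <= e -> `|d - c| <= 4 * e.
Proof.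
move=> /ler_normlP [? ?] /ler_normlP [? ?] /ler_normlP [? ?].
by apply/ler_normlP; split; lra.
Qed.

Lemma chain_close_u e w a b c d k :
  `|w - (a - b - k)| <= e -> `|b - c| <= 2 * e -> `|a - d| <= e -> `|w| <= e ->
  `|d - k - c| <= 5 * e.
Proof.
move=> /ler_normlP [? ?] /ler_normlP [? ?] /ler_normlP [? ?] /ler_normlP [? ?].
by apply/ler_normlP; split; lra.
Qed.

Lemma chain_close1 e m a b c : `|a - c| <= m -> `|a - b| <= e -> `|b - c| <= m + e.
Proof.
move=> /ler_normlP [? ?] /ler_normlP [? ?].
by apply/ler_normlP; split; lra.
Qed.

Lemma chain_close2 e m a b c k :
  `|a - k - c| <= m -> `|a - b| <= e -> `|b - k - c| <= m + e.
Proof.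
move=> /ler_normlP [? ?] /ler_normlP [? ?].
by apply/ler_normlP; split; lra.
Qed.

(** The class over which the local estimates are uniform: [a] is nonzero, but the constants depend
    on it only through [A]. *)
Definition admissible (Rr P M A a : R) u v D :=
  [/\ a != 0, `|a| <= A, is_sol Rr a u v D,
    (forall x y, `|y| < Rr -> u (x + P, y) = u (x, y) /\ v (x + P, y) = v (x, y)) &
    forall p : R * R, strip Rr p -> `|v p| <= M].

(* A horizontal line on which [v] is equicontinuous inherits the closeness to [Vs] from the averages;
   on a vertical line [v] oscillates little as soon as the box is thin enough, and the maximum
   principle takes over inside the box. *)
Lemma local_conv_v (Rr P M A r X Y c e l0 h0 : R) :
  0 < Rr -> 0 < P -> 0 < A -> 0 <= M -> r < Rr -> `|Y| < r -> 0 < e -> 0 < l0 -> 0 < h0 ->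
  exists d dl : R, [/\ 0 < d, 0 < dl & forall a u v D Vs, admissible Rr P M A a u v D ->
    scont Rr Vs ->
    (forall x y, `|x - X| <= l0 -> `|y - Y| <= h0 -> `|Vs (x, y) - c| <= 2 * e) ->
    (forall x x' y, x <= x' <= x + P -> `|y| <= Rr ->
       `|integ (fun s => v (s, y) - Vs (s, y)) x x'| <= dl) ->
    forall x y, `|x - X| <= d -> `|y - Y| <= d -> `|v (x, y) - c| <= 5 * e].
Proof.
move=> R0 P0 A0 M0 rR Yr e0 l00 h00.
have r0 : 0 < r by exact: le_lt_trans Yr.
have rr : 0 < r < Rr by rewrite r0.
set C := line_cst Rr P M A r; have C0 : 0 < C by exact: line_cst_pos.
(* The constants are chosen in the order [l], [k1], [h], [k2], [t]. On vertical lines [k1] makes the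
   energy term [e / 2], and [h] then makes the length term at most [e / 2]; [k2] and [t] do the same
   on horizontal lines. The factor 8 keeps all windows within one period. *)
pose l := Num.min l0 P / 8.
have m0 : 0 < Num.min l0 P by rewrite lt_min l00.
have lp : 0 < l by rewrite divr_gt0.
have [ll0 lP] : 8 * l <= l0 /\ 8 * l <= P.
  by rewrite /l mulrC divfK //; split; rewrite ge_min lexx ?orbT.
pose k1 := e * l / (4 * C); have k10 : 0 < k1 by apply: divr_gt0; apply: mulr_gt0.
have k1E : k1 * (C / (l / 2)) = e / 2 by rewrite /k1; field; rewrite !gt_eqF.
pose h := Num.min (Num.min h0 (r - `|Y|)) (e * k1 / 4).
have hp : 0 < h by rewrite !lt_min h00 subr_gt0 Yr /=; apply: divr_gt0 => //; apply: mulr_gt0.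
have [hh0 hr hk] : [/\ h <= h0, h <= r - `|Y| & h <= e * k1 / 4].
  by split; rewrite !ge_min lexx ?orbT.
pose k2 := e * h / (4 * C); have k20 : 0 < k2 by apply: divr_gt0; apply: mulr_gt0.
have k2E : k2 * (C / (h / 2)) = e / 2 by rewrite /k2; field; rewrite !gt_eqF.
pose t := Num.min l (e * k2 / 2).
have tp : 0 < t by rewrite !lt_min lp /=; apply: divr_gt0 => //; apply: mulr_gt0.
have [tl tk] : t <= l /\ t <= e * k2 / 2 by split; rewrite !ge_min lexx ?orbT.
clearbody t h l; move=> {m0}.
exists (Num.min l h / 2), (e * t); split.
- by rewrite divr_gt0 // lt_min lp.
- by rewrite mulr_gt0.
move=> a u v D Vs [a0 aA S per vM] cVs VsC avg x y hx hy.
have uP x' y' : `|y'| < Rr -> u (x' + P, y') = u (x', y') by move=> h'; case: (per x' y' h').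
have vP x' y' : `|y'| < Rr -> v (x' + P, y') = v (x', y') by move=> h'; case: (per x' y' h').
have {hx hy} [/ler_normlP [hx1 hx2] /ler_normlP [hy1 hy2]] : `|x - X| <= l / 2 /\ `|y - Y| <= h / 2.
  have m1 : Num.min l h <= l by rewrite ge_min lexx.
  have m2 : Num.min l h <= h by rewrite ge_min lexx orbT.
  by split; [apply: (le_trans hx)|apply: (le_trans hy)]; rewrite ler_pM2r.
have Yb : - (r - h) <= Y <= r - h.
  by have := ler_norm Y; have := ler_norm (- Y); rewrite normrN; clear -hr; lra.
have hl2 : 0 < l / 2 <= P by clear -lp lP; apply/andP; split; lra.
(* Two vertical and two horizontal lines frame a box that contains all points within [l / 2] and
   [h / 2] of [(X, Y)]. *)
have [xr hxr vr] := vertical_osc R0 P0 a0 A0 aA S uP vP vM (X + l / 2) rr hl2.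
have [xl hxl vl] := vertical_osc R0 P0 a0 A0 aA S uP vP vM (X - l) rr hl2.
have [||| yt hyt ht] := @horizontal_osc _ _ _ _ _ _ _ _ _ R0 P0 a0 A0 aA S uP vP vM r (Y + h / 2) (Y + h) (X - l) rr.
- by clear -Yb hp; lra.
- by clear -Yb hp; lra.
- by clear -Yb hp; lra.
have [||| yb hyb hb] := @horizontal_osc _ _ _ _ _ _ _ _ _ R0 P0 a0 A0 aA S uP vP vM r (Y - h) (Y - h / 2) (X - l) rr.
- by clear -Yb hp; lra.
- by clear -Yb hp; lra.
- by clear -Yb hp; lra.
have e1 : Y + h - (Y + h / 2) = h / 2 by field.
have e2 : Y - h / 2 - (Y - h) = h / 2 by field.
rewrite e1 in ht; rewrite e2 in hb.
have horiz z : Y - h <= z <= Y + h ->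
    (forall k p q, 0 < k -> X - l <= p -> p <= q -> q <= X - l + P ->
      `|v (q, z) - v (p, z)| <= k * (C / (h / 2)) + (q - p) / k) ->
    forall p, X - l <= p <= X + l -> `|v (p, z) - c| <= 4 * e.
  move=> hz osc p hpp.
  have zR : `|z| < Rr by apply/ltr_normlP; clear -hz Yb rR; split; lra.
  have c1 : continuous (fun s => v (s, z)) by exact: scont_slice (sol_cv S) (ltW zR).
  have c2 : continuous (fun s => Vs (s, z)) by exact: scont_slice cVs (ltW zR).
  have cc : continuous (fun s => v (s, z) - Vs (s, z)) by move=> s; apply: ctsB; [exact: c1|exact: c2].
  have pt : p < p + t by rewrite ltrDl.
  (* The average of [v - Vs] over [[p, p + t]] is at most [dl / t = e], hence so is its value at
     some point. *)
  have [xi /andP[xi1 xi2] E] := int_mvt cc pt.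
  have b1 : p <= p + t <= p + P by clear -tp tl lP lp; lra.
  have := avg p (p + t) z b1 (ltW zR); rewrite E addrAC subrr add0r normrM (gtr0_norm tp) ler_pM2r // => w1.
  have w2 : `|Vs (xi, z) - c| <= 2 * e.
    by apply: VsC; apply/ler_normlP; clear -hpp xi1 xi2 tl ll0 lp hz hh0; split; lra.
  have w3 : `|v (xi, z) - v (p, z)| <= e.
    apply: (le_trans (osc k2 p xi k20 _ (ltW xi1) _)); try (clear -hpp xi2 tl lP lp; lra).
    rewrite k2E; have : (xi - p) / k2 <= e / 2.
      by rewrite ler_pdivrMr //; clear -xi2 tk; lra.
    by clear; lra.
  exact: chain_close_v w1 w2 w3.
have hT := horiz yt ltac:(clear -hyt hp; lra) (fun k p q a1 a2 a3 a4 => (ht k p q a1 a2 a3 a4).1).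
have hB := horiz yb ltac:(clear -hyb hp; lra) (fun k p q a1 a2 a3 a4 => (hb k p q a1 a2 a3 a4).1).
have vert z : X - l <= z <= X + l ->
    (forall k p q, 0 < k -> - r <= p -> p <= q -> q <= r ->
      `|v (z, q) - v (z, p)| <= k * (C / (l / 2)) + (q - p) / k) ->
    forall p, yb <= p <= yt -> `|v (z, p) - c| <= 5 * e.
  move=> hz osc p hpp; have w1 := hT z hz.
  have w3 : `|v (z, yt) - v (z, p)| <= e.
    have pyt : p <= yt by case/andP: hpp.
    apply: (le_trans (osc k1 p yt k10 _ pyt _)); try (clear -hpp hyb hyt hp Yb; lra).
    rewrite k1E; have : (yt - p) / k1 <= e / 2.
      by rewrite ler_pdivrMr //; clear -hpp hyb hyt hk; lra.
    by clear; lra.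
  have -> : 5 * e = 4 * e + e by ring.
  exact: chain_close1 w1 w3.
have vR := vert xr ltac:(clear -hxr lp; lra) (fun k p q a1 a2 a3 a4 => (vr k p q a1 a2 a3 a4).1).
have vL := vert xl ltac:(clear -hxl lp; lra) (fun k p q a1 a2 a3 a4 => (vl k p q a1 a2 a3 a4).1).
apply: (@box_close_v Rr a u v D xl xr yb yt c _ a0 S).
- by clear -hyb Yb rR; lra.
- by clear -hyt Yb rR; lra.
- move=> p q hpp hqq /or4P[] /eqP E; rewrite E in hpp hqq *.
  + exact: vL.
  + exact: vR.
  + by apply: (le_trans (hB p _)); clear -hpp hxl hxr lp e0; lra.
  + by apply: (le_trans (hT p _)); clear -hpp hxl hxr lp e0; lra.
- by clear -hxl hxr hx1 hx2; lra.
- by clear -hyb hyt hy1 hy2; lra.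
Qed.

(* Dual to [local_conv_v]: here vertical lines carry the closeness, through an antiderivative [H] of
   the difference in [y], and horizontal ones the small oscillation. *)
Lemma local_conv_u (Rr P M A r X Y c e l0 h0 : R) :
  0 < Rr -> 0 < P -> 0 < A -> 0 <= M -> r < Rr -> `|Y| < r -> 0 < e -> 0 < l0 -> 0 < h0 ->
  exists d dl : R, [/\ 0 < d, 0 < dl & forall a u v D Us k, admissible Rr P M A a u v D ->
    (forall x y, `|x - X| <= l0 -> `|y - Y| <= h0 -> `|Us (x, y) - c| <= 2 * e) ->
    (forall x1, exists H g : R -> R, forall y, `|y| < Rr ->
       [/\ is_derive y 1 H (g y), `|H y| <= dl &
         `|g y - (u (x1, y) - Us (x1, y) - k)| <= e]) ->
    forall x y, `|x - X| <= d -> `|y - Y| <= d -> `|u (x, y) - k - c| <= 6 * e].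
Proof.
move=> R0 P0 A0 M0 rR Yr e0 l00 h00.
have r0 : 0 < r by exact: le_lt_trans Yr.
have rr : 0 < r < Rr by rewrite r0.
set C := line_cst Rr P M A r; have C0 : 0 < C by exact: line_cst_pos.
(* The order is now [h], [k2], [l], [k1], [t]. The bound on [t] is a square because [u] oscillates
   on vertical lines like the square root of the length. *)
pose h := Num.min h0 (r - `|Y|) / 2.
have m0 : 0 < Num.min h0 (r - `|Y|) by rewrite lt_min h00 subr_gt0.
have hp : 0 < h by rewrite divr_gt0.
have [hh0 hr] : 2 * h <= h0 /\ 2 * h <= r - `|Y|.
  by rewrite /h mulrC divfK //; split; rewrite ge_min lexx ?orbT.
pose k2 := e * h / (4 * C); have k20 : 0 < k2 by apply: divr_gt0; apply: mulr_gt0.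
have k2E : k2 * (C / (h / 2)) = e / 2 by rewrite /k2; field; rewrite !gt_eqF.
pose l := Num.min (Num.min l0 (P / 8)) (e * k2 / 4).
have lp : 0 < l by rewrite !lt_min l00 divr_gt0 //=; apply: divr_gt0 => //; apply: mulr_gt0.
have [ll0 lP lk] : [/\ l <= l0, l <= P / 8 & l <= e * k2 / 4].
  by split; rewrite !ge_min lexx ?orbT.
pose k1 := e * l / (4 * C); have k10 : 0 < k1 by apply: divr_gt0; apply: mulr_gt0.
have k1E : k1 * (C / (l / 2)) = e / 2 by rewrite /k1; field; rewrite !gt_eqF.
pose t := Num.min h ((e * k1 / 8) ^+ 2).
have ek : 0 < e * k1 / 8 by apply: divr_gt0 => //; apply: mulr_gt0.
have tp : 0 < t by rewrite lt_min hp exprn_gt0.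
have [th tk] : t <= h /\ t <= (e * k1 / 8) ^+ 2 by split; rewrite !ge_min lexx ?orbT.
clearbody t h l; move=> {m0}.
exists (Num.min l h / 2), (e * t / 2); split.
- by rewrite divr_gt0 // lt_min lp.
- by apply: divr_gt0 => //; apply: mulr_gt0.
move=> a u v D Us k [a0 aA S per vM] UsC avg x y hx hy.
have uP x' y' : `|y'| < Rr -> u (x' + P, y') = u (x', y') by move=> h'; case: (per x' y' h').
have vP x' y' : `|y'| < Rr -> v (x' + P, y') = v (x', y') by move=> h'; case: (per x' y' h').
have {hx hy} [/ler_normlP [hx1 hx2] /ler_normlP [hy1 hy2]] : `|x - X| <= l / 2 /\ `|y - Y| <= h / 2.
  have m1 : Num.min l h <= l by rewrite ge_min lexx.
  have m2 : Num.min l h <= h by rewrite ge_min lexx orbT.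
  by split; [apply: (le_trans hx)|apply: (le_trans hy)]; rewrite ler_pM2r.
have Yb : - (r - 2 * h) <= Y <= r - 2 * h.
  by have := ler_norm Y; have := ler_norm (- Y); rewrite normrN; clear -hr; lra.
have hl2 : 0 < l / 2 <= P by clear -lp lP; apply/andP; split; lra.
have [xr hxr vr] := vertical_osc R0 P0 a0 A0 aA S uP vP vM (X + l / 2) rr hl2.
have [xl hxl vl] := vertical_osc R0 P0 a0 A0 aA S uP vP vM (X - l) rr hl2.
have [||| yt hyt ht] := @horizontal_osc _ _ _ _ _ _ _ _ _ R0 P0 a0 A0 aA S uP vP vM r (Y + h / 2) (Y + h) (X - l) rr.
- by clear -Yb hp; lra.
- by clear -Yb hp; lra.
- by clear -Yb hp; lra.
have [||| yb hyb hb] := @horizontal_osc _ _ _ _ _ _ _ _ _ R0 P0 a0 A0 aA S uP vP vM r (Y - h) (Y - h / 2) (X - l) rr.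
- by clear -Yb hp; lra.
- by clear -Yb hp; lra.
- by clear -Yb hp; lra.
have e1 : Y + h - (Y + h / 2) = h / 2 by field.
have e2 : Y - h / 2 - (Y - h) = h / 2 by field.
rewrite e1 in ht; rewrite e2 in hb.
have vert z : X - l <= z <= X + l ->
    (forall k p q, 0 < k -> - r <= p -> p <= q -> q <= r ->
      `|u (z, q) - u (z, p)| <= k * (C / (l / 2)) + 4 * Num.sqrt (q - p) / k) ->
    forall p, Y - h <= p <= Y + h -> `|u (z, p) - k - c| <= 5 * e.
  move=> hz osc p hpp; have [H [g Hg]] := avg z.
  have inR s : p <= s <= p + t -> `|s| < Rr.
    by move=> hs; apply/ltr_normlP; clear -hs hpp Yb rR th; split; lra.
  have pt : p < p + t by rewrite ltrDl.
  (* As [|H|] is at most [e * t / 2] at both ends, its derivative [g] is at most [e] at some height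
     between them. *)
  have [||xi /andP[xi1 xi2] E] := @mvt _ H g p (p + t) pt.
  - by move=> s /andP[s1 s2]; have [] := Hg s (inR s _); rewrite // !ltW.
  - by move=> s /inR sR; have [h1 _ _] := Hg s sR; exact: is_derive_continuous h1.
  have xiR : `|xi| < Rr by apply: inR; rewrite !ltW.
  have [_ _ w1] := Hg xi xiR.
  have [_ w4 _] := Hg p (inR p ltac:(clear -tp; lra)).
  have [_ w5 _] := Hg (p + t) (inR (p + t) ltac:(clear -tp; lra)).
  have w6 : `|g xi| <= e.
    rewrite -(ler_pM2r tp) -[X in _ * X <= _](gtr0_norm tp) -normrM.
    have -> : g xi * t = H (p + t) - H p by rewrite E; ring.
    by apply: (le_trans (ler_normB _ _)); clear -w4 w5; lra.
  have w2 : `|Us (z, xi) - c| <= 2 * e.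
    by apply: UsC; apply/ler_normlP; clear -hz ll0 hpp xi1 xi2 th hh0; split; lra.
  have w3 : `|u (z, xi) - u (z, p)| <= e.
    apply: (le_trans (osc k1 p xi k10 _ (ltW xi1) _)); try (clear -hpp xi2 th Yb hp; lra).
    rewrite k1E; have : 4 * Num.sqrt (xi - p) / k1 <= e / 2.
      rewrite ler_pdivrMr //.
      have : Num.sqrt (xi - p) <= e * k1 / 8.
        rewrite -[X in _ <= X]gtr0_norm // -sqrtr_sqr; apply: ler_wsqrtr.
        by clear -xi2 tk; lra.
      by clear; lra.
    by clear; lra.
  exact: chain_close_u w1 w2 w3 w6.
have vR := vert xr ltac:(clear -hxr lp; lra) (fun k p q a1 a2 a3 a4 => (vr k p q a1 a2 a3 a4).2).
have vL := vert xl ltac:(clear -hxl lp; lra) (fun k p q a1 a2 a3 a4 => (vl k p q a1 a2 a3 a4).2).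
have horiz z : Y - h <= z <= Y + h ->
    (forall k p q, 0 < k -> X - l <= p -> p <= q -> q <= X - l + P ->
      `|u (q, z) - u (p, z)| <= k * (C / (h / 2)) + (q - p) / k) ->
    forall p, xl <= p <= xr -> `|u (p, z) - k - c| <= 6 * e.
  move=> hz osc p hpp; have w1 := vR z hz.
  have w3 : `|u (xr, z) - u (p, z)| <= e.
    have pxr : p <= xr by case/andP: hpp.
    apply: (le_trans (osc k2 p xr k20 _ pxr _)); try (clear -hpp hxl hxr lp lP; lra).
    rewrite k2E; have : (xr - p) / k2 <= e / 2.
      by rewrite ler_pdivrMr //; clear -hpp hxl hxr lk; lra.
    by clear; lra.
  have -> : 6 * e = 5 * e + e by ring.
  exact: chain_close2 w1 w3.
have hT := horiz yt ltac:(clear -hyt hp; lra) (fun k p q a1 a2 a3 a4 => (ht k p q a1 a2 a3 a4).2).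
have hB := horiz yb ltac:(clear -hyb hp; lra) (fun k p q a1 a2 a3 a4 => (hb k p q a1 a2 a3 a4).2).
have -> : u (x, y) - k - c = u (x, y) - (k + c) by ring.
apply: (@box_close_u Rr a u v D xl xr yb yt (k + c) _ a0 S).
- by clear -hyb Yb rR hp; lra.
- by clear -hyt Yb rR hp; lra.
- move=> p q hpp hqq hor; have -> : u (p, q) - (k + c) = u (p, q) - k - c by ring.
  move: hor => /or4P[] /eqP E; rewrite E in hpp hqq *.
  + by apply: (le_trans (vL q _)); clear -hqq hyb hyt hp e0; lra.
  + by apply: (le_trans (vR q _)); clear -hqq hyb hyt hp e0; lra.
  + exact: hB.
  + exact: hT.
- by clear -hxl hxr hx1 hx2; lra.
- by clear -hyb hyt hy1 hy2; lra.
Qed.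

End LocalConvergence.

(** * Closeness of averages and the period mean of [u] *)

Section PeriodMeans.
Context {R : realType}.
Implicit Types (x y z t e d r k s m K M A B C : R) (u v f g : R * R -> R) (Rr P a : R).

(** Windows on the boundary lines contribute at most [e * P]. A full period at another height
    differs from one at [y = Rr] by [k * (2 * Rr)], [k] being the defect of periodicity of [u1]. The
    last term is the price of different weights. *)
Lemma avg_close Rr P a1 a2 B C theta e k u1 v1 D1 u2 v2 D2 :
  0 < Rr -> 0 < P -> a1 != 0 -> a2 != 0 ->
  is_sol Rr a1 u1 v1 D1 -> is_sol Rr a2 u2 v2 D2 ->
  (forall p, strip Rr p -> `|v1 p - v2 p| <= B) ->
  (forall p, ostrip Rr p -> `|dvx D2 p| <= C) ->
  (forall V y, `|(wt a1 V y)^-1 - (wt a2 V y)^-1| <= theta) ->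
  0 <= e -> 0 <= k ->
  (forall x, `|v1 (x, Rr) - v2 (x, Rr)| <= e) ->
  (forall x, `|v1 (x, - Rr) - v2 (x, - Rr)| <= e) ->
  (forall x y, `|y| < Rr -> `|u1 (x + P, y) - u1 (x, y)| <= k) ->
  (forall x y, `|y| < Rr -> u2 (x + P, y) = u2 (x, y)) ->
  forall x x' y, x <= x' <= x + P -> `|y| <= Rr ->
    `|integ (fun s => v1 (s, y) - v2 (s, y)) x x'| <= e * P + k * (2 * Rr) + C * theta * Rr ^+ 2.
Proof.
move=> R0 P0 a10 a20 S1 S2 wB vC th e0 k0 h1 h2 u1P u2P.
have RR : `|Rr| <= Rr by rewrite ger0_norm // ltW.
have RRn : `|- Rr| <= Rr by rewrite normrN.
have c1 z : `|z| <= Rr -> continuous (fun s => v1 (s, z)) by apply: scont_slice (sol_cv S1).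
have c2 z : `|z| <= Rr -> continuous (fun s => v2 (s, z)) by apply: scont_slice (sol_cv S2).
have cw z : `|z| <= Rr -> continuous (fun s => v1 (s, z) - v2 (s, z)).
  by move=> zR; apply: scont_slice (scontB (sol_cv S1) (sol_cv S2)) zR.
have kR : 0 <= k * (2 * Rr) by rewrite mulr_ge0 // mulr_ge0 // ltW.
have bd z : `|z| <= Rr -> (forall x, `|v1 (x, z) - v2 (x, z)| <= e) ->
    forall x x', x <= x' <= x + P -> `|integ (fun s => v1 (s, z) - v2 (s, z)) x x'| <= e * P.
  move=> zR h x x' /andP[xx xP].
  apply: (le_trans (int_norm_le (cw z zR) xx (fun s _ => h s))).
  by rewrite ler_wpM2l //; lra.
apply: (int_comparison_abs R0 P0 a10 a20 S1 S2 wB vC th).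
- by apply: addr_ge0 => //; rewrite mulr_ge0 // ltW.
- by move=> x x' hx; apply: (le_trans (bd Rr RR h1 x x' hx)); rewrite lerDl.
- by move=> x x' hx; apply: (le_trans (bd (- Rr) RRn h2 x x' hx)); rewrite lerDl.
move=> x y yR; have e2 : forall x y, `|y| < Rr -> `|u2 (x + P, y) - u2 (x, y)| <= 0.
  by move=> ? ? h; rewrite u2P // subrr normr0.
have w1 := mean_variation R0 P0 k0 S1 u1P x yR RR.
have w2 := mean_variation R0 P0 (lexx _) S2 e2 x yR RR.
have w3 := bd Rr RR h1 x (x + P) ltac:(rewrite lexx lerDl ltW //).
rewrite intB in w3; [|exact: c1|exact: c2].
rewrite intB; [|exact: c1|exact: c2].
move: w1 w2 w3; rewrite mul0r; clear; move=> /ler_normlP [? ?] /ler_normlP [? ?] /ler_normlP [? ?].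
by apply/ler_normlP; split; lra.
Qed.

Lemma wt_gt_norm a (V : R) y : a != 0 -> `|V| < wt a V y.
Proof.
move=> a0; rewrite -sqrtr_sqr; have : 0 < a ^+ 2 by rewrite exprn_even_gt0.
move=> ?; rewrite ltr_sqrt; have := sqr_ge0 V; have := sqr_ge0 y; lra.
Qed.

Lemma wt_add_gt0 a (V : R) y : a != 0 -> 0 < V + wt a V y.
Proof. by move=> /(wt_gt_norm V y) /ltr_normlP [? ?]; lra. Qed.

(** [ln (V + wt a V y)] is a primitive in [V] of the inverse weight, an inverse hyperbolic sine up
    to a function of [y]. So the second equation makes [u_y] an exact [x]-derivative. *)
Lemma ln_wt_dx Rr a u v D x y : a != 0 -> is_sol Rr a u v D -> `|y| < Rr ->
  is_derive x 1 (fun s => - 2^-1 * ln (v (s, y) + wt a (v (s, y)) y)) (duy D (x, y)).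
Proof.
move=> a0 S yR; have q0 := wt_gt0 (v (x, y)) y a0; have p0 := wt_add_gt0 (v (x, y)) y a0.
have h1 := dD (sol_vx S x yR) (dwt_x x a0 S yR).
have h2 := dZ (- 2^-1) (@d_ln R (fun t => v (t, y) + wt a (v (t, y)) y) x _ p0 h1).
apply: d_eq h2; rewrite (sol_eq S x yR); field.
by rewrite !gt_eqF.
Qed.

Lemma int_u_dy Rr a u v D x x' y : a != 0 -> is_sol Rr a u v D -> x <= x' -> `|y| < Rr ->
  is_derive y 1 (fun z => integ (fun s => u (s, z)) x x')
    (- 2^-1 * ln (v (x', y) + wt a (v (x', y)) y) + 2^-1 * ln (v (x, y) + wt a (v (x, y)) y)).
Proof.
move=> a0 S xx yR; pose G s := - 2^-1 * ln (v (s, y) + wt a (v (s, y)) y).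
have dG s : is_derive s 1 G (duy D (s, y)) by exact: (ln_wt_dx s a0 S yR).
have cuy : continuous (fun s => duy D (s, y)).
  by apply: ctsP => s; apply: (@continuous_slice1 _ (duy D) s y); exact: (sol_cuy S yR).
have E : integ (fun s => duy D (s, y)) x x' = G x' - G x by apply: intE'.
have -> : - 2^-1 * ln (v (x', y) + wt a (v (x', y)) y) + 2^-1 * ln (v (x, y) + wt a (v (x, y)) y)
  = integ (fun s => duy D (s, y)) x x' by rewrite E /G; ring.
have inR z : `|z - y| < Rr - `|y| -> `|z| < Rr.
  by move=> h; have := ler_normD (z - y) y; rewrite subrK; lra.
apply: (@int_param_derive _ u (duy D) x x' y (Rr - `|y|)) => //.
- by rewrite subr_gt0.
- move=> s z /inR zR; exact: (scont_slice (sol_cu S) (ltW zR)).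
- by move=> s z _ /inR zR; have := sol_uy S s zR.
- by move=> s _; exact: (sol_cuy S yR).
Qed.

Lemma int_u_cst Rr P a u v D : 0 < P -> a != 0 -> is_sol Rr a u v D ->
  (forall x y, `|y| < Rr -> v (x + P, y) = v (x, y)) ->
  forall x y y', `|y| < Rr -> `|y'| < Rr ->
  integ (fun s => u (s, y)) x (x + P) = integ (fun s => u (s, y')) x (x + P).
Proof.
move=> P0 a0 S vP x; have xx : x <= x + P by rewrite lerDl ltW.
have key y y' : `|y| < Rr -> `|y'| < Rr -> y <= y' ->
    integ (fun s => u (s, y)) x (x + P) = integ (fun s => u (s, y')) x (x + P).
  move=> yR y'R yy; have inR z : y <= z <= y' -> `|z| < Rr.
    move: yR y'R => /ltr_normlP [? ?] /ltr_normlP [? ?] /andP[? ?].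
    by apply/ltr_normlP; split; lra.
  have dz z : y <= z <= y' -> is_derive z 1 (fun z => integ (fun s => u (s, z)) x (x + P)) 0.
    move=> /inR zR; have h := int_u_dy a0 S xx zR; apply: d_eq h.
    by rewrite vP //; ring.
  suff : `|integ (fun s => u (s, y')) x (x + P) - integ (fun s => u (s, y)) x (x + P)| <= 0.
    by rewrite normr_le0 subr_eq0 => /eqP.
  rewrite -[X in _ <= X](mul0r (y' - y)).
  apply: (@deriv_bound _ (fun z => integ (fun s => u (s, z)) x (x + P)) (fun=> 0) y y' 0 yy).
  + by move=> z /andP[? ?]; apply: dz; rewrite !ltW.
  + by move=> z /dz h; exact: is_derive_continuous h.
  + by rewrite normr0.
move=> y y' yR y'R; case: (leP y y') => h; first exact: key.
by symmetry; apply: key => //; exact: ltW.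
Qed.

(** The product of [V + wt] and [- V + wt] is [y ^+ 2 + a ^+ 2], which keeps [V + wt] away from 0
    uniformly in [a] as long as [|y| >= y0]. *)
Lemma ln_wt_bounded Rr M A y0 : 0 < y0 -> 0 <= M -> 0 < Rr -> 0 <= A -> exists2 K : R, 0 <= K & forall a V y,
  a != 0 -> `|a| <= A -> `|V| <= M -> y0 <= `|y| <= Rr -> `|ln (V + wt a V y)| <= K.
Proof.
move=> y00 M0 R0 A0; pose hi := 2 * M + Rr + A; pose lo := y0 ^+ 2 / hi.
have hi0 : 0 < hi by rewrite /hi; lra.
have lo0 : 0 < lo by rewrite divr_gt0 // exprn_gt0.
exists (`|ln lo| + `|ln hi|); first exact: addr_ge0.
move=> a V y a0 aA VM /andP[y1 y2].
have p0 := wt_add_gt0 V y a0; have p1 := wt_add_gt0 (- V) y a0.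
have wle : wt a V y <= M + Rr + A.
  rewrite -[X in _ <= X]ger0_norm; last by lra.
  rewrite -sqrtr_sqr; apply: ler_wsqrtr.
  have s1 : V ^+ 2 <= M ^+ 2 by rewrite -real_normK ?num_real // lerXn2r ?nnegrE.
  have s2 : y ^+ 2 <= Rr ^+ 2 by rewrite -real_normK ?num_real // lerXn2r ?nnegrE // ltW.
  have s3 : a ^+ 2 <= A ^+ 2 by rewrite -real_normK ?num_real // lerXn2r ?nnegrE.
  have t1 : 0 <= M * Rr by rewrite mulr_ge0 // ltW.
  have t2 : 0 <= M * A by rewrite mulr_ge0.
  have t3 : 0 <= A * Rr by rewrite mulr_ge0 // ltW.
  by clear -s1 s2 s3 t1 t2 t3; nra.
have /ler_normlP [V1 V2] := VM.
have hhi : V + wt a V y <= hi by rewrite /hi; lra.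
have wN : wt a (- V) y = wt a V y by rewrite /wt sqrrN.
have hlo : lo <= V + wt a V y.
  rewrite ler_pdivrMr //; apply: le_trans (_ : y ^+ 2 <= _).
    by rewrite -(real_normK (num_real y)) lerXn2r ?nnegrE // ltW.
  apply: le_trans (_ : (V + wt a V y) * (- V + wt a V y) <= _).
    have := sqr_wt a V y; have := sqr_ge0 a; clear; nra.
  by rewrite ler_pM2l //; rewrite /hi; lra.
have l1 : ln lo <= ln (V + wt a V y) by rewrite ler_ln ?posrE.
have l2 : ln (V + wt a V y) <= ln hi by rewrite ler_ln ?posrE.
have := ler_norm (ln hi); have := ler_norm (- ln lo); rewrite normrN => n1 n2.
have := normr_ge0 (ln hi); have := normr_ge0 (ln lo) => n3 n4.
by apply/ler_normlP; split; lra.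
Qed.

Lemma int_periods (f : R -> R) P (n : nat) : continuous f -> (forall x, f (x + P) = f x) ->
  integ f 0 (n%:R * P) = n%:R * integ f 0 P.
Proof.
move=> cf fP; elim: n => [|n IH]; first by rewrite !mul0r intxx.
rewrite -natr1 mulrDl mul1r -(int_chasles f 0 (n%:R * P)) IH (int_periodic _ 0 cf fP) add0r.
by ring.
Qed.

(* The limit solution has periodic data but its approximants need not, so the boundary term of
   [int_u_dy] only becomes negligible after averaging over many periods. *)
Lemma int_u_cst_limit Rr P M A u : 0 < Rr -> 0 < P -> 0 <= M -> 0 <= A -> scont Rr u ->
  (forall p, strip Rr p -> u (p.1 + P, p.2) = u p) ->
  (forall e, 0 < e -> exists a U V D, [/\ a != 0, `|a| <= A, is_sol Rr a U V D,
     (forall p, strip Rr p -> `|U p - u p| <= e) & (forall p, strip Rr p -> `|V p| <= M)]) ->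
  forall y, `|y| < Rr -> integ (fun s => u (s, y)) 0 P = integ (fun s => u (s, 0)) 0 P.
Proof.
move=> R0 P0 M0 A0 cu uP app; pose J z := integ (fun s => u (s, z)) 0 P.
have cs z : `|z| <= Rr -> continuous (fun s => u (s, z)) by exact: scont_slice.
have key p q y0 : 0 < y0 -> p <= q -> (forall z, p <= z <= q -> y0 <= `|z| < Rr) -> J p = J q.
  move=> y00 pq hz; have [K K0 HK] := ln_wt_bounded y00 M0 R0 A0.
  have pR : `|p| < Rr by have /andP[] := hz p ltac:(rewrite lexx pq //).
  have qR : `|q| < Rr by have /andP[] := hz q ltac:(rewrite lexx pq //).
  suff : `|J p - J q| <= 0 by rewrite normr_le0 subr_eq0 => /eqP.
  apply/ler_addgt0Pr => k k0; rewrite add0r.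
  (* Over [n] periods the end terms contribute at most [2 * Rr * K] in total, that is, at most
     [k / 2] per period. Replacing [U] by [u] costs [k / 4] per period at each of the two
     heights. *)
  have [n nE] : exists n : nat, 4 * Rr * K / k < n%:R.
    exists (Num.bound (4 * Rr * K / k)); apply: archi_boundP.
    by apply: divr_ge0; [rewrite mulr_ge0 // mulr_ge0 // ltW|exact: ltW].
  have n0 : 0 < n%:R :> R.
    by apply: le_lt_trans nE; apply: divr_ge0; [rewrite mulr_ge0 // mulr_ge0 // ltW|exact: ltW].
  have e0 : 0 < k / (4 * P) by rewrite divr_gt0 // mulr_gt0.
  have [a [U [V [D [a0 aA S Uu VM]]]]] := app _ e0.
  set L := n%:R * P; have L0 : 0 <= L by apply: mulr_ge0; exact: ltW.
  have b1 : `|integ (fun s => U (s, q)) 0 L - integ (fun s => U (s, p)) 0 L| <= K * (q - p).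
    apply: (deriv_bound pq (fun z zpq => int_u_dy a0 S L0 _)).
    - by move=> z /andP[? ?]; have /andP[] := hz z ltac:(apply/andP; split; exact: ltW).
    - by move=> z /hz /andP[_ zR]; exact: is_derive_continuous (int_u_dy a0 S L0 zR).
    - move=> z /andP[? ?]; have /andP[z1 z2] := hz z ltac:(apply/andP; split; exact: ltW).
      have zz : y0 <= `|z| <= Rr by rewrite z1 ltW.
      have := HK a (V (L, z)) z a0 aA (VM (L, z) (ltW z2)) zz.
      have := HK a (V (0, z)) z a0 aA (VM (0, z) (ltW z2)) zz.
      by clear; move=> /ler_normlP [? ?] /ler_normlP [? ?]; apply/ler_normlP; split; lra.
  have b2 z : `|z| < Rr -> `|integ (fun s => U (s, z)) 0 L - n%:R * J z| <= n%:R * (k / 4).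
    move=> zR; rewrite /J -int_periods; last 2 first.
    - exact: cs (ltW zR).
    - by move=> s; exact: (uP (s, z) (ltW zR)).
    rewrite -intB; [|exact: (scont_slice (sol_cu S) (ltW zR))|exact: cs (ltW zR)].
    have -> : n%:R * (k / 4) = k / (4 * P) * (L - 0) by rewrite /L; field; rewrite gt_eqF.
    apply: int_norm_le => //; first exact: (scont_slice (scontB (sol_cu S) cu) (ltW zR)).
    by move=> s _; exact: (Uu (s, z) (ltW zR)).
  have b3 : K * (q - p) <= n%:R * (k / 2).
    apply: le_trans (_ : K * (2 * Rr) <= _).
      rewrite ler_wpM2l //; move: pR qR => /ltr_normlP [? ?] /ltr_normlP [? ?]; lra.
    by move: nE; rewrite ltr_pdivrMr //; clear; lra.
  rewrite -(ler_pM2l n0) -[X in X * _](gtr0_norm n0) -normrM mulrBr.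
  move: (b2 p pR) (b2 q qR) b1 b3; clear.
  move=> /ler_normlP [? ?] /ler_normlP [? ?] /ler_normlP [? ?] ?.
  by apply/ler_normlP; split; lra.
have key2 p q : p != 0 -> 0 <= p * q -> `|q| <= `|p| -> q != 0 -> `|p| < Rr -> J p = J q.
  move=> p0 pq qp q0 pR; have q1 : 0 < `|q| by rewrite normr_gt0.
  case: (ltP 0 q) => hq.
    have hp : 0 < p by rewrite lt_neqAle eq_sym p0 /= -(pmulr_lge0 _ hq).
    symmetry; apply: (key q p q) => //; first by move: qp; rewrite !gtr0_norm.
    move=> z /andP[z1 z2]; move: pR; rewrite !gtr0_norm //; last exact: lt_le_trans z1.
    by move=> pR; rewrite z1 (le_lt_trans z2).
  have hq' : q < 0 by rewrite lt_neqAle q0.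
  have hp : p < 0 by rewrite lt_neqAle p0 /= -(nmulr_lge0 _ hq').
  apply: (key p q (- q)) => //; first by rewrite oppr_gt0.
    by move: qp; rewrite !ltr0_norm // lerN2.
  move=> z /andP[z1 z2]; move: pR; rewrite !ltr0_norm //; last exact: le_lt_trans hq'.
  by move=> pR; rewrite lerN2 z2 (le_lt_trans _ pR) // lerN2.
move=> y yR; change (J y = J 0); case: (eqVneq y 0) => [->//|y0].
suff : `|J y - J 0| <= 0 by rewrite normr_le0 subr_eq0 => /eqP.
apply/ler_addgt0Pr => k k0; rewrite add0r.
(* The bound on the logarithm holds away from [y = 0] only, so height 0 is reached by continuity
   along [t * y]. *)
have cJ : {for 0, continuous J}.
  apply: (@continuous_int _ u 0 P 0 Rr R0 (ltW P0)).
  - by move=> s z; rewrite subr0 => zR; exact: (cs z (ltW zR)).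
  - by move=> s _; apply: scont_int cu _; rewrite normr0.
have [d d0 H] := (continuous_atP _ _).1 cJ k k0.
have ny : 0 < `|y| by rewrite normr_gt0.
pose t := Num.min 1 (d / (2 * `|y|)).
have t0 : 0 < t by rewrite lt_min ltr01 divr_gt0 // mulr_gt0.
have [t1 t2] : t <= 1 /\ t <= d / (2 * `|y|) by split; rewrite ge_min lexx ?orbT.
rewrite (key2 y (t * y)) //.
- apply/ltW/H; rewrite subr0 normrM (gtr0_norm t0).
  apply: le_lt_trans (ler_wpM2r (ltW ny) t2) _.
  have -> : d / (2 * `|y|) * `|y| = d / 2 by field; rewrite gt_eqF.
  by lra.
- by rewrite mulrCA; apply: mulr_ge0; [exact: ltW|rewrite -expr2 sqr_ge0].
- by rewrite normrM (gtr0_norm t0) ger_pMl.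
- by rewrite mulf_neq0 // gt_eqF.
Qed.

End PeriodMeans.

(** * Families of solutions *)

Section Family.
Context {R : realType}.
Implicit Types (x y z t e d r k s m K M A B C : R) (f g U V : R * R -> R) (Rr P a b : R).

(** Derivatives are available for [a != 0] alone, through [fam_sol]; the members with [a = 0] are
    tied to the equations by the uniform approximation [fam_lim]. *)
Record sol_family Rr P (phip phim : R -> R -> R -> R) (u v : R -> R -> R * R -> R) : Prop := Family {
  fam_R0 : 0 < Rr;
  fam_P0 : 0 < P;
  fam_sol : forall a b, a != 0 -> exists (D : derivs) (C : R),
    is_sol Rr a (u a b) (v a b) D /\ forall p, ostrip Rr p -> `|dvx D p| <= C;
  fam_lim : forall b e, 0 < e -> exists2 d, 0 < d & forall s, 0 < s < d ->
    exists U V D, [/\ is_sol Rr s U V D, (forall p, strip Rr p -> `|U p - u 0 b p| <= e) &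
      forall p, strip Rr p -> `|V p - v 0 b p| <= e];
  fam_cu : forall a b, scont Rr (u a b);
  fam_cv : forall a b, scont Rr (v a b);
  fam_uP : forall a b p, strip Rr p -> u a b (p.1 + P, p.2) = u a b p;
  fam_vP : forall a b p, strip Rr p -> v a b (p.1 + P, p.2) = v a b p;
  fam_u0 : forall a b, u a b (0, 0) = 0;
  fam_bp : forall a b x, v a b (x, Rr) = phip a b x;
  fam_bm : forall a b x, v a b (x, - Rr) = phim a b x;
  fam_phi : forall a b e, 0 < e -> exists2 d, 0 < d & forall a' b', `|a' - a| < d -> `|b' - b| < d ->
    forall x, `|phip a' b' x - phip a b x| <= e /\ `|phim a' b' x - phim a b x| <= e;
  fam_lt : forall a b b' x, b < b' -> phip a b x < phip a b' x /\ phim a b x < phim a b' x;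
  fam_ub : forall a x K, exists b, K < phip a b x /\ K < phim a b x;
  fam_lb : forall a x K, exists b, phip a b x < K /\ phim a b x < K }.

Section FamilyTheory.
Variables (Rr P : R) (phip phim : R -> R -> R -> R) (u v : R -> R -> R * R -> R).
Hypothesis F : sol_family Rr P phip phim u v.

Let R0 := fam_R0 F.
Let P0 := fam_P0 F.

Lemma strip_top x : strip Rr (x, Rr). Proof. by rewrite /strip /= ger0_norm // ltW. Qed.
Lemma strip_bot x : strip Rr (x, - Rr). Proof. by rewrite /strip /= normrN; exact: strip_top x. Qed.

Lemma fam_bounded a b : exists2 B : R, 0 <= B & forall p, strip Rr p -> `|v a b p| <= B.
Proof.
have [B h] := scont_periodic_bounded R0 P0 (fam_cv F a b) (@fam_vP _ _ _ _ _ _ F a b).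
by exists B => //; apply: le_trans (h _ (strip_top 0)).
Qed.

Lemma fam_shift_le a b b' t : a != 0 ->
  (forall x, phip a b (x + t) <= phip a b' x) -> (forall x, phim a b (x + t) <= phim a b' x) ->
  forall x y, `|y| <= Rr -> v a b (x + t, y) <= v a b' (x, y).
Proof.
move=> a0 hp hm x y yR; have [D [C [S vC]]] := fam_sol F b a0.
have [D' [C' [S' vC']]] := fam_sol F b' a0.
have [B B0 vB] := fam_bounded a b; have [B' B0' vB'] := fam_bounded a b'.
apply: (@sol_comparison _ Rr P a (B' + B) C _ _ _ _ _ _ R0 P0 a0 S' (is_sol_shift t S) _ _ _ _ _ _ (x, y) yR).
- move=> p sp; apply: (le_trans (ler_normB _ _)); apply: lerD; first exact: vB'.
  exact: (vB (p.1 + t, p.2)).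
- by move=> p sp; exact: (vC (p.1 + t, p.2)).
- by move=> p q qR; exact: (fam_uP F a b' (p := (p, q)) (ltW qR)).
- move=> p q qR /=; rewrite addrAC; exact: (fam_uP F a b (p := (p + t, q)) (ltW qR)).
- by move=> p /=; rewrite !(fam_bp F).
- by move=> p /=; rewrite !(fam_bm F).
Qed.

Lemma fam_le_cst a b K : a != 0 -> (forall x, phip a b x <= K) -> (forall x, phim a b x <= K) ->
  forall p, strip Rr p -> v a b p <= K.
Proof.
move=> a0 hp hm; have [D [C [S vC]]] := fam_sol F b a0.
have [B B0 vB] := fam_bounded a b.
apply: (@sol_comparison _ Rr P a (`|K| + B) C _ _ _ _ _ _ R0 P0 a0 (is_sol_cst Rr a K) S _ vC) => //.
- by move=> p sp; apply: (le_trans (ler_normB _ _)); rewrite lerD2l vB.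
- by move=> p q qR; exact: (fam_uP F a b (p := (p, q)) (ltW qR)).
- by move=> p; rewrite (fam_bp F).
- by move=> p; rewrite (fam_bm F).
Qed.

Lemma fam_ge_cst a b K : a != 0 -> (forall x, K <= phip a b x) -> (forall x, K <= phim a b x) ->
  forall p, strip Rr p -> K <= v a b p.
Proof.
move=> a0 hp hm; have [D [C [S vC]]] := fam_sol F b a0.
have [B B0 vB] := fam_bounded a b.
apply: (@sol_comparison _ Rr P a (B + `|K|) 0 _ _ _ _ _ _ R0 P0 a0 S (is_sol_cst Rr a K)) => //.
- by move=> p sp; apply: (le_trans (ler_normB _ _)); rewrite lerD2r vB.
- by move=> p _; rewrite normr0.
- by move=> p q qR; exact: (fam_uP F a b (p := (p, q)) (ltW qR)).
- by move=> p; rewrite (fam_bp F).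
- by move=> p; rewrite (fam_bm F).
Qed.

(** Constants as barriers bound [v a b] by its boundary data, which stay within 1 of those at
    [(a0, b0)]. *)
Lemma fam_admissible a0 b0 : exists d M A, [/\ 0 < d, 0 <= M, 0 < A &
  forall a b, `|a - a0| < d -> `|b - b0| < d -> a != 0 ->
    exists D, admissible Rr P M A a (u a b) (v a b) D].
Proof.
have [B B0 vB] := fam_bounded a0 b0; have [d d0 H] := fam_phi F a0 b0 ltr01.
exists (Num.min d 1), (B + 1), (`|a0| + 1); split.
- by rewrite lt_min d0 ltr01.
- by rewrite addr_ge0.
- by rewrite ltr_wpDl.
move=> a b; rewrite !lt_min => /andP[h1 h2] /andP[h3 _] an0.
have [D [C [S vC]]] := fam_sol F b an0; exists D.
have bp x : `|phip a b x| <= B + 1.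
  have [h _] := H a b h1 h3 x; have := vB _ (strip_top x); rewrite (fam_bp F) => h'.
  by have := ler_normD (phip a b x - phip a0 b0 x) (phip a0 b0 x); rewrite subrK; lra.
have bm x : `|phim a b x| <= B + 1.
  have [_ h] := H a b h1 h3 x; have := vB _ (strip_bot x); rewrite (fam_bm F) => h'.
  by have := ler_normD (phim a b x - phim a0 b0 x) (phim a0 b0 x); rewrite subrK; lra.
split=> //.
- by have := ler_normD (a - a0) a0; rewrite subrK; lra.
- move=> x y yR; split; [exact: (fam_uP F a b (p := (x, y)) (ltW yR))|].
  exact: (fam_vP F a b (p := (x, y)) (ltW yR)).
- move=> p sp; apply/ler_normlP; split.
    rewrite lerNl; apply: fam_ge_cst => // x; rewrite lerNl.
      by have /ler_normlP [] := bp x.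
    by have /ler_normlP [] := bm x.
  apply: fam_le_cst => // x.
    by have /ler_normlP [] := bp x.
  by have /ler_normlP [] := bm x.
Qed.

(** The intermediate solution [(U, V)] is uniformly close to the member at [(a0, b0)], singular or
    not, and close on average to the one at [(a, b)]. It may depend on [a]. *)
Lemma fam_approx a0 b0 e : 0 < e -> exists2 d : R, 0 < d & forall a b, `|a - a0| < d -> `|b - b0| < d -> a != 0 ->
  exists a' U V D, [/\ is_sol Rr a' U V D, (forall p, strip Rr p -> `|U p - u a0 b0 p| <= e),
    (forall p, strip Rr p -> `|V p - v a0 b0 p| <= e) &
    forall x x' y, x <= x' <= x + P -> `|y| <= Rr ->
      `|integ (fun s => v a b (s, y) - V (s, y)) x x'| <= e].
Proof.
move=> e0; case: (eqVneq a0 0) => [->|a00].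
  (* Boundary data and periodicity are each off by at most [2 * e1], so [avg_close] yields
     [e1 * (2 * P + 4 * Rr)]. *)
  pose e1 := Num.min e (e / (2 * P + 4 * Rr)).
  have q0 : 0 < 2 * P + 4 * Rr by have := R0; have := P0; lra.
  have e10 : 0 < e1 by rewrite lt_min e0 divr_gt0.
  have [e1e e1q] : e1 <= e /\ e1 * (2 * P + 4 * Rr) <= e.
    split; first by rewrite ge_min lexx.
    by rewrite -ler_pdivlMr // ge_min lexx orbT.
  have [d1 d10 H1] := fam_phi F 0 b0 e10; have [d2 d20 H2] := fam_lim F b0 e10.
  exists (Num.min d1 d2); first by rewrite lt_min d10.
  move=> a b; rewrite !lt_min => /andP[a1 a2] /andP[b1 b2] an0; rewrite subr0 in a2.
  have na : 0 < `|a| by rewrite normr_gt0.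
  have [U [V [D [S Uu Vv]]]] := H2 `|a| ltac:(by rewrite na).
  exists `|a|, U, V, D; split=> //.
  - by move=> p /Uu h; exact: le_trans h e1e.
  - by move=> p /Vv h; exact: le_trans h e1e.
  have [D2 [C [S2 vC]]] := fam_sol F b an0.
  have [B B0 vB] := fam_bounded a b; have [B' B0' vB'] := fam_bounded 0 b0.
  (* Both solutions now have the parameter [|a|], so [theta = 0] and the bound [C], which is not
     controlled as [a] tends to 0, drops out. *)
  have S2' : is_sol Rr `|a| (u a b) (v a b) D2.
    by apply: is_sol_sq S2; rewrite real_normK ?num_real.
  have na0 : `|a| != 0 by rewrite normr_eq0.
  have th (V1 : R) y : `|(wt `|a| V1 y)^-1 - (wt `|a| V1 y)^-1| <= 0 by rewrite subrr normr0.
  move=> x x' y hx hy.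
  have c1 : continuous (fun s => v a b (s, y)) by exact: scont_slice (fam_cv F a b) hy.
  have c2 : continuous (fun s => V (s, y)) by exact: scont_slice (sol_cv S) hy.
  have -> : integ (fun s => v a b (s, y) - V (s, y)) x x' =
      - integ (fun s => V (s, y) - v a b (s, y)) x x'.
    by rewrite !intB //; ring.
  have ee0 : 0 <= e1 + e1 by rewrite addr_ge0 // ltW.
  have bp z : `|V (z, Rr) - v a b (z, Rr)| <= e1 + e1.
    have [h _] := H1 a b a1 b1 z; have h' := Vv _ (strip_top z).
    move: h h'; rewrite !(fam_bp F); clear -R0 P0.
    by move=> /ler_normlP [? ?] /ler_normlP [? ?]; apply/ler_normlP; split; lra.
  have bm z : `|V (z, - Rr) - v a b (z, - Rr)| <= e1 + e1.
    have [_ h] := H1 a b a1 b1 z; have h' := Vv _ (strip_bot z).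
    move: h h'; rewrite !(fam_bm F); clear -R0 P0.
    by move=> /ler_normlP [? ?] /ler_normlP [? ?]; apply/ler_normlP; split; lra.
  have UP z t : `|t| < Rr -> `|U (z + P, t) - U (z, t)| <= e1 + e1.
    move=> tR; have h := Uu (z + P, t) (ltW tR); have h' := Uu (z, t) (ltW tR).
    move: h h'; rewrite (fam_uP F 0 b0 (p := (z, t)) (ltW tR)); clear -R0 P0.
    by move=> /ler_normlP [? ?] /ler_normlP [? ?]; apply/ler_normlP; split; lra.
  have uP z t : `|t| < Rr -> u a b (z + P, t) = u a b (z, t).
    by move=> tR; exact: (fam_uP F a b (p := (z, t)) (ltW tR)).
  have wB p : strip Rr p -> `|V p - v a b p| <= e1 + B' + B.
    move=> sp; move: (Vv p sp) (vB p sp) (vB' p sp); clear -R0 P0.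
    move=> /ler_normlP [? ?] /ler_normlP [? ?] /ler_normlP [? ?].
    by apply/ler_normlP; split; lra.
  have := avg_close R0 P0 na0 na0 S S2' wB vC th ee0 ee0 bp bm UP uP hx hy.
  rewrite normrN => h; apply: (le_trans h); move: e1q; clear -R0 P0; lra.
have [D2 [C [S2 vC]]] := fam_sol F b0 a00.
have C0 : 0 <= C.
  by apply: le_trans (vC (0, 0) _); rewrite // /ostrip /= normr0.
have na : 0 < `|a0| by rewrite normr_gt0.
pose e1 := e / (2 * P).
have e10 : 0 < e1 by rewrite divr_gt0 // mulr_gt0.
have [d1 d10 H1] := fam_phi F a0 b0 e10.
have Rr2 : 0 < Rr ^+ 2 by rewrite exprn_gt0.
have na2 : 0 < `|a0| ^+ 2 by rewrite exprn_gt0.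
have q0 : 0 < 4 * (C + 1) * Rr ^+ 2 by rewrite mulr_gt0 // mulr_gt0 //; lra.
(* The second bound gives [|a| >= |a0| / 2], on which [theta] relies; the third makes
   [C * theta * Rr ^+ 2] at most [e / 2], with [C + 1] to avoid division by 0. *)
pose d := Num.min d1 (Num.min (`|a0| / 2) (e * `|a0| ^+ 2 / (4 * (C + 1) * Rr ^+ 2))).
exists d; first by rewrite !lt_min d10 !divr_gt0 // mulr_gt0.
move=> a b; rewrite !lt_min => /andP[a1 /andP[a2 a3]] /andP[b1 _] an0.
exists a0, (u a0 b0), (v a0 b0), D2; split=> //.
- by move=> p _; rewrite subrr normr0 ltW.
- by move=> p _; rewrite subrr normr0 ltW.
have [D [C' [S _]]] := fam_sol F b an0.
have [B B0 vB] := fam_bounded a b; have [B' B0' vB'] := fam_bounded a0 b0.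
pose theta := 2 * `|a - a0| / `|a0| ^+ 2.
have th (V : R) y : `|(wt a V y)^-1 - (wt a0 V y)^-1| <= theta.
  apply: (le_trans (wtV_lip_a V y an0 a00)).
  have h : `|a0| / 2 <= `|a|.
    by have := ler_normD (a0 - a) a; rewrite subrK distrC; move: a2; clear -R0 P0; lra.
  have na' : 0 < `|a| by rewrite normr_gt0.
  have -> : theta = `|a - a0| / (`|a0| / 2 * `|a0|) by rewrite /theta; field; rewrite gt_eqF.
  apply: ler_wpM2l => //; rewrite lef_pV2 ?posrE ?mulr_gt0 ?divr_gt0 //.
  by rewrite ler_pM2r.
have bp z : `|v a b (z, Rr) - v a0 b0 (z, Rr)| <= e1.
  by rewrite !(fam_bp F); have [] := H1 a b a1 b1 z.
have bm z : `|v a b (z, - Rr) - v a0 b0 (z, - Rr)| <= e1.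
  by rewrite !(fam_bm F); have [] := H1 a b a1 b1 z.
have uP z t : `|t| < Rr -> `|u a b (z + P, t) - u a b (z, t)| <= 0.
  by move=> tR; rewrite (fam_uP F a b (p := (z, t)) (ltW tR)) subrr normr0.
have uP0 z t : `|t| < Rr -> u a0 b0 (z + P, t) = u a0 b0 (z, t).
  by move=> tR; exact: (fam_uP F a0 b0 (p := (z, t)) (ltW tR)).
have wB p : strip Rr p -> `|v a b p - v a0 b0 p| <= B + B'.
  by move=> sp; apply: (le_trans (ler_normB _ _)); exact: lerD (vB p sp) (vB' p sp).
move=> x x' y hx hy.
have := avg_close R0 P0 an0 a00 S S2 wB vC th (ltW e10) (lexx 0) bp bm uP uP0 hx hy.
move=> h; apply: (le_trans h); rewrite mul0r addr0.
have -> : e1 * P = e / 2 by rewrite /e1; field; rewrite gt_eqF.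
suff : C * theta * Rr ^+ 2 <= e / 2 by clear -R0 P0; lra.
move: a3; rewrite ltr_pdivlMr // => a3.
have -> : C * theta * Rr ^+ 2 = (2 * `|a - a0| * (C * Rr ^+ 2)) / `|a0| ^+ 2.
  by rewrite /theta; field; rewrite gt_eqF.
rewrite ler_pdivrMr //.
have : 0 <= `|a - a0| * Rr ^+ 2 by rewrite mulr_ge0 // ltW.
by move: a3; clear -R0 P0; lra.
Qed.

Lemma fam_mean a b y x : `|y| < Rr ->
  integ (fun s => u a b (s, y)) x (x + P) = integ (fun s => u a b (s, 0)) 0 P.
Proof.
move=> yR; have cs : continuous (fun s => u a b (s, y)) by exact: scont_slice (fam_cu F a b) (ltW yR).
rewrite (int_periodic x 0 cs); last by move=> z; exact: (fam_uP F a b (p := (z, y)) (ltW yR)).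
rewrite add0r; have z0 : `|0 : R| < Rr by rewrite normr0.
case: (eqVneq a 0) => [->|an0]; last first.
  have [D [C [S _]]] := fam_sol F b an0.
  have := int_u_cst P0 an0 S _ 0 yR z0; rewrite add0r; apply=> p q qR.
  exact: (fam_vP F a b (p := (p, q)) (ltW qR)).
have [B B0 vB] := fam_bounded 0 b.
apply: (@int_u_cst_limit _ Rr P (B + 1) 1 _ R0 P0 _ _ (fam_cu F 0 b)) => //.
- by rewrite addr_ge0.
- exact: (fam_uP F 0 b).
move=> e e0; have m0 : 0 < Num.min e 1 by rewrite lt_min e0 ltr01.
have [d d0 H] := fam_lim F b m0.
pose s := Num.min (d / 2) 1.
have s0 : 0 < s by rewrite lt_min ltr01 andbT divr_gt0.
have [s1 s2] : s <= d / 2 /\ s <= 1 by split; rewrite ge_min lexx ?orbT.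
have [U [V [D [S Uu Vv]]]] := H s ltac:(move: s0 s1 d0; clear -R0 P0; lra).
exists s, U, V, D; split=> //.
- by rewrite gt_eqF.
- by rewrite gtr0_norm.
- by move=> p /Uu h; apply: (le_trans h); rewrite ge_min lexx.
- move=> p sp; have h := Vv p sp; have h' := vB p sp.
  have h1 : Num.min e 1 <= 1 by rewrite ge_min lexx orbT.
  by have := ler_normD (V p - v 0 b p) (v 0 b p); rewrite subrK; move: h h' h1; clear -R0 P0; lra.
Qed.

Lemma fam_cv_reg a0 b0 X Y e : `|Y| < Rr -> 0 < e -> exists2 d : R, 0 < d & forall a b x y,
  `|a - a0| < d -> `|b - b0| < d -> a != 0 -> `|x - X| <= d -> `|y - Y| <= d ->
  `|v a b (x, y) - v a0 b0 (X, Y)| <= e.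
Proof.
move=> YR e0; have [d1 [M [A [d10 M0 A0 adm]]]] := fam_admissible a0 b0.
have e5 : 0 < e / 5 by rewrite divr_gt0.
have [h0 h00 H0] := (continuous2_atP _ _).1 (scont_int (x := X) (fam_cv F a0 b0) YR) _ e5.
pose r := (`|Y| + Rr) / 2; have [rR Yr] : r < Rr /\ `|Y| < r by rewrite /r; split; lra.
pose h2 := Num.min h0 (Rr - `|Y|) / 2.
have h20 : 0 < h2 by rewrite divr_gt0 // lt_min h00 subr_gt0.
have [h2h h2R] : h2 < h0 /\ h2 <= Rr - `|Y|.
  have m1 : Num.min h0 (Rr - `|Y|) <= h0 by rewrite ge_min lexx.
  have m2 : Num.min h0 (Rr - `|Y|) <= Rr - `|Y| by rewrite ge_min lexx orbT.
  by move: h20; rewrite /h2; split; lra.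
clearbody h2.
have [d [dl [d_0 dl0 H]]] := local_conv_v X (v a0 b0 (X, Y)) R0 P0 A0 M0 rR Yr e5 h20 h20.
have m0 : 0 < Num.min dl (e / 5) by rewrite lt_min dl0.
have [d2 d20 H2] := fam_approx a0 b0 m0.
exists (Num.min d (Num.min d1 d2)); first by rewrite !lt_min d_0 d10.
move=> a b x y; rewrite !lt_min !le_min => /andP[_ /andP[a1 a2]] /andP[_ /andP[b1 b2]] an0.
move=> /andP[x1 _] /andP[y1 _].
have [D ad] := adm a b a1 b1 an0; have [a' [U [V [D' [S Uu Vv av]]]]] := H2 a b a2 b2 an0.
have -> : e = 5 * (e / 5) by field.
apply: (H a (u a b) (v a b) D V ad (sol_cv S) _ _ x y x1 y1).
- move=> p q hp hq; have := H0 (p, q) (le_lt_trans hp h2h) (le_lt_trans hq h2h).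
  have qR : `|q| <= Rr.
    by have := ler_normD (q - Y) Y; rewrite subrK; lra.
  have := Vv (p, q) qR.
  have : Num.min dl (e / 5) <= e / 5 by rewrite ge_min lexx orbT.
  clear -R0 P0=> h /ler_normlP [? ?] /ltr_normlP [? ?]; apply/ler_normlP; split; lra.
- move=> p p' q hp hq; apply: (le_trans (av p p' q hp hq)); by rewrite ge_min lexx.
Qed.

Definition mean_u a b := integ (fun s => u a b (s, 0)) 0 P.

(** Window integrals see only increments of [u] in [x]. Averaged over the left end, these become [u]
    minus its period mean, which is independent of [y]; so [u] is controlled up to the difference of
    the means. *)
Lemma fam_cu_aux a0 b0 X Y e : `|Y| < Rr -> 0 < e -> exists2 d : R, 0 < d & forall a b x y,
  `|a - a0| < d -> `|b - b0| < d -> a != 0 -> `|x - X| <= d -> `|y - Y| <= d ->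
  `|u a b (x, y) - P^-1 * (mean_u a b - mean_u a0 b0) - u a0 b0 (X, Y)| <= e.
Proof.
move=> YR e0; have [d1 [M [A [d10 M0 A0 adm]]]] := fam_admissible a0 b0.
have e6 : 0 < e / 6 by rewrite divr_gt0.
have [h0 h00 H0] := (continuous2_atP _ _).1 (scont_int (x := X) (fam_cu F a0 b0) YR) _ e6.
pose r := (`|Y| + Rr) / 2; have [rR Yr] : r < Rr /\ `|Y| < r by rewrite /r; split; lra.
pose h2 := Num.min h0 (Rr - `|Y|) / 2.
have h20 : 0 < h2 by rewrite divr_gt0 // lt_min h00 subr_gt0.
have [h2h h2R] : h2 < h0 /\ h2 <= Rr - `|Y|.
  have m1 : Num.min h0 (Rr - `|Y|) <= h0 by rewrite ge_min lexx.
  have m2 : Num.min h0 (Rr - `|Y|) <= Rr - `|Y| by rewrite ge_min lexx orbT.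
  by move: h20; rewrite /h2; split; lra.
clearbody h2.
have [d [dl [d_0 dl0 H]]] := local_conv_u X (u a0 b0 (X, Y)) R0 P0 A0 M0 rR Yr e6 h20 h20.
have m0 : 0 < Num.min dl (e / 6) by rewrite lt_min dl0.
have [d2 d20 H2] := fam_approx a0 b0 m0.
exists (Num.min d (Num.min d1 d2)); first by rewrite !lt_min d_0 d10.
move=> a b x y; rewrite !lt_min !le_min => /andP[_ /andP[a1 a2]] /andP[_ /andP[b1 b2]] an0.
move=> /andP[x1 _] /andP[y1 _].
have [D ad] := adm a b a1 b1 an0; have [a' [U [V [D' [S' Uu Vv av]]]]] := H2 a b a2 b2 an0.
have [_ _ S _ _] := ad.
have mle : Num.min dl (e / 6) <= e / 6 by rewrite ge_min lexx orbT.
have mdl : Num.min dl (e / 6) <= dl by rewrite ge_min lexx.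
set m := Num.min dl (e / 6) in m0 mle mdl Uu Vv av.
have -> : e = 6 * (e / 6) by field.
apply: (H a (u a b) (v a b) D U _ ad _ _ x y x1 y1).
  move=> p q hp hq; have := H0 (p, q) (le_lt_trans hp h2h) (le_lt_trans hq h2h).
  have qR : `|q| <= Rr by have := ler_normD (q - Y) Y; rewrite subrK; lra.
  have := Uu (p, q) qR.
  move: mle; clear -R0 P0=> h /ler_normlP [? ?] /ltr_normlP [? ?]; apply/ler_normlP; split; lra.
move=> z; have zz : z - P <= z by rewrite gerBl ltW.
pose W p := integ (fun s => v a b (s, p.2) - V (s, p.2)) p.1 z.
pose f p := (u a b (z, p.2) - U (z, p.2)) - (u a b p - U p).
(* The average, over left ends in one period, of the window integrals that end at [z]. *)
exists (fun y => P^-1 * integ (fun x => W (x, y)) (z - P) z).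
exists (fun y => P^-1 * integ (fun x => f (x, y)) (z - P) z) => q qR.
have cV t : `|t| <= Rr -> continuous (fun s => v a b (s, t) - V (s, t)).
  by move=> tR; exact: (scont_slice (scontB (fam_cv F a b) (sol_cv S')) tR).
have cU t : `|t| <= Rr -> continuous (fun s => u a b (s, t) - U (s, t)).
  by move=> tR; exact: (scont_slice (scontB (fam_cu F a b) (sol_cu S')) tR).
have cW t : `|t| <= Rr -> continuous (fun s => W (s, t)).
  by move=> tR s; exact: is_derive_continuous (int_derivl z s (cV t tR)).
have cf : continuous (fun s => f (s, q)).
  by apply: ctsP => s; rewrite /f /=; apply: ctsB; [exact: cts_cst|exact: (cU q (ltW qR) s)].
have inR t : `|t - q| < Rr - `|q| -> `|t| < Rr.
  by move=> h; have := ler_normD (t - q) q; rewrite subrK; lra.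
have q0 : 0 < Rr - `|q| by rewrite subr_gt0.
split.
- apply: dZ; apply: (int_param_derive q0 zz) => //.
  + by move=> s t /inR tR; exact: (cW t (ltW tR) s).
  + move=> s t /andP[_ sz] /inR tR; exact: (int_diff_y S S' sz tR).
  + move=> s _; have cc p : {for (p, q), continuous (fun p => u a b p - U p)}.
      by apply: ctsB; [exact: scont_int (fam_cu F a b) qR|exact: scont_int (sol_cu S') qR].
    rewrite /f; apply: ctsB; last exact: cc.
    apply: (@cts_comp _ _ (fun t => u a b (z, t) - U (z, t)) snd); first exact: cvg_snd.
    exact: (continuous_slice2 (f := fun p => u a b p - U p) (cc z)).
- rewrite normrM gtr0_norm ?invr_gt0 // mulrC ler_pdivrMr //.
  apply: le_trans (_ : m * (z - (z - P)) <= _); last first.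
    by rewrite opprB addrC subrK ler_wpM2r // ltW.
  apply: int_norm_le => //; first exact: (cW q (ltW qR)).
  by move=> s /andP[s1 s2]; apply: (av s z q _ (ltW qR)); move: s1 s2; clear -R0 P0; lra.
- have E : integ (fun x => f (x, q)) (z - P) z = (u a b (z, q) - U (z, q)) * P -
     (mean_u a b - integ (fun s => U (s, q)) (z - P) z).
    rewrite /f intB /=; [|by move=> s; exact: cts_cst|exact: (cU q (ltW qR))].
    rewrite int_cst opprB [z + _]addrC subrK; congr (_ - _).
    rewrite intB; [|exact: scont_slice (fam_cu F a b) (ltW qR)|exact: scont_slice (sol_cu S') (ltW qR)].
    by have := fam_mean a b (z - P) qR; rewrite subrK => ->.
  have bU : `|integ (fun s => U (s, q)) (z - P) z - mean_u a0 b0| <= m * P.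
    have := fam_mean a0 b0 (z - P) qR; rewrite subrK -/(mean_u a0 b0) => <-.
    rewrite -intB; [|exact: scont_slice (sol_cu S') (ltW qR)|exact: scont_slice (fam_cu F a0 b0) (ltW qR)].
    apply: le_trans (_ : m * (z - (z - P)) <= _); last by rewrite opprB addrC subrK.
    apply: int_norm_le => //; first exact: (scont_slice (scontB (sol_cu S') (fam_cu F a0 b0)) (ltW qR)).
    by move=> s _; exact: (Uu (s, q) (ltW qR)).
  rewrite E; set I := integ _ _ _ in bU *.
  have -> : P^-1 * ((u a b (z, q) - U (z, q)) * P - (mean_u a b - I)) -
     (u a b (z, q) - U (z, q) - P^-1 * (mean_u a b - mean_u a0 b0)) = (I - mean_u a0 b0) * P^-1.
    by field; rewrite gt_eqF.
  rewrite normrM [`|P^-1|]gtr0_norm ?invr_gt0 // ler_pdivrMr //.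
  by apply: (le_trans bU); rewrite ler_pM2r.
Qed.

(** At the origin all [u] vanish, so [fam_cu_aux] there bounds the difference of the means, which
    can then be removed elsewhere. *)
Lemma fam_cu_reg a0 b0 X Y e : `|Y| < Rr -> 0 < e -> exists2 d : R, 0 < d & forall a b x y,
  `|a - a0| < d -> `|b - b0| < d -> a != 0 -> `|x - X| <= d -> `|y - Y| <= d ->
  `|u a b (x, y) - u a0 b0 (X, Y)| <= e.
Proof.
move=> YR e0; have e2 : 0 < e / 2 by rewrite divr_gt0.
have z0 : `|0 : R| < Rr by rewrite normr0.
have [d1 d10 H1] := fam_cu_aux a0 b0 0 z0 e2.
have [d2 d20 H2] := fam_cu_aux a0 b0 X YR e2.
exists (Num.min d1 d2); first by rewrite lt_min d10.
move=> a b x y; rewrite !lt_min !le_min => /andP[a1 a2] /andP[b1 b2] an0 /andP[_ x2] /andP[_ y2].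
have := H1 a b 0 0 a1 b1 an0; rewrite !subrr normr0 => /(_ (ltW d10) (ltW d10)).
have := H2 a b x y a2 b2 an0 x2 y2; rewrite !(fam_u0 F); clear -R0 P0.
by move=> /ler_normlP [? ?] /ler_normlP [? ?]; apply/ler_normlP; split; lra.
Qed.

(* At [a = 0] the continuity in the other variables is obtained as a limit [a -> 0]. *)
Lemma joint_of_regular (f : R -> R -> R * R -> R) :
  (forall a0 b0 X Y e, `|Y| < Rr -> 0 < e -> exists2 d : R, 0 < d & forall a b x y,
    `|a - a0| < d -> `|b - b0| < d -> a != 0 -> `|x - X| <= d -> `|y - Y| <= d ->
    `|f a b (x, y) - f a0 b0 (X, Y)| <= e) ->
  forall a0 b0 X Y e, `|Y| < Rr -> 0 < e -> exists2 d : R, 0 < d & forall a b x y,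
    `|a - a0| < d -> `|b - b0| < d -> `|x - X| < d -> `|y - Y| < d ->
    `|f a b (x, y) - f a0 b0 (X, Y)| < e.
Proof.
move=> reg a0 b0 X Y e YR e0; have e3 : 0 < e / 3 by rewrite divr_gt0.
have [d d0 H] := reg a0 b0 X Y _ YR e3.
exists (Num.min d (Rr - `|Y|)); first by rewrite lt_min d0 subr_gt0.
move=> a b x y; rewrite !lt_min => /andP[a1 _] /andP[b1 _] /andP[x1 _] /andP[y1 y2].
have yR : `|y| < Rr by have := ler_normD (y - Y) Y; rewrite subrK; lra.
have [d' d'0 H'] := reg a b x y _ yR e3.
have [s [s1 s2 sn0]] : exists s, [/\ `|s - a0| < d, `|s - a| < d' & s != 0].
  pose t := Num.min d' (d - `|a - a0|) / 2.
  have t0 : 0 < t by rewrite divr_gt0 // lt_min d'0 subr_gt0.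
  have [t1 t2] : t < d' /\ t < d - `|a - a0|.
    have m1 : Num.min d' (d - `|a - a0|) <= d' by rewrite ge_min lexx.
    have m2 : Num.min d' (d - `|a - a0|) <= d - `|a - a0| by rewrite ge_min lexx orbT.
    by move: t0; rewrite /t; split; lra.
  (* If [a + t = 0], then [a = - t] is itself nonzero and serves as [s]. *)
  case: (eqVneq (a + t) 0) => h.
    exists a; split=> //; first by rewrite subrr normr0.
    by apply: contra_eq_neq h => ->; rewrite add0r gt_eqF.
  exists (a + t); split=> //; last by rewrite addrAC subrr add0r gtr0_norm.
  rewrite addrAC; apply: (le_lt_trans (ler_normD _ _)); rewrite (gtr0_norm t0); lra.
have := H s b x y s1 b1 sn0 (ltW x1) (ltW y1).
have := H' s b x y s2 _ sn0; rewrite !subrr normr0 => /(_ d'0 (ltW d'0) (ltW d'0)).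
move: e0; clear -R0 P0; move=> e0 /ler_normlP [? ?] /ler_normlP [? ?]; apply/ltr_normlP; split; lra.
Qed.

Lemma fam_v_joint a0 b0 X Y e : `|Y| < Rr -> 0 < e -> exists2 d : R, 0 < d & forall a b x y,
  `|a - a0| < d -> `|b - b0| < d -> `|x - X| < d -> `|y - Y| < d ->
  `|v a b (x, y) - v a0 b0 (X, Y)| < e.
Proof. by apply: joint_of_regular => *; exact: fam_cv_reg. Qed.

Lemma fam_u_joint a0 b0 X Y e : `|Y| < Rr -> 0 < e -> exists2 d : R, 0 < d & forall a b x y,
  `|a - a0| < d -> `|b - b0| < d -> `|x - X| < d -> `|y - Y| < d ->
  `|u a b (x, y) - u a0 b0 (X, Y)| < e.
Proof. by apply: joint_of_regular => *; exact: fam_cu_reg. Qed.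

End FamilyTheory.
End Family.

(** * Strict monotonicity *)

Section Moments.
Context {R : realType}.
Implicit Types (x y z t e d r k s m K M A B C : R) (f g U V : R * R -> R) (Rr P a b : R).
Implicit Types (u v : R * R -> R) (D : @derivs R).

(** A bump on [[- t, t]] that vanishes at the ends together with its derivative, so that two
    integrations by parts leave no end terms. *)
Definition quartic (t s : R) := (t ^+ 2 - s ^+ 2) ^+ 2.
Definition quartic1 (t s : R) := - 4 * s * (t ^+ 2 - s ^+ 2).
Definition quartic2 (t s : R) := 12 * s ^+ 2 - 4 * t ^+ 2.

Lemma d_sqr_shift t x c : is_derive x 1 (fun s => t ^+ 2 - (s - c) ^+ 2) (- 2 * (x - c)).
Proof.
have h := dB (d_cst (t ^+ 2) x) (d_sqr (dB (d_id x) (d_cst c x))).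
by apply: d_eq h; ring.
Qed.

Lemma d_quartic t x c : is_derive x 1 (fun s => quartic t (s - c)) (quartic1 t (x - c)).
Proof. by have h := d_sqr (d_sqr_shift t x c); apply: d_eq h; rewrite /quartic1; ring. Qed.

Lemma d_quartic1 t x c : is_derive x 1 (fun s => quartic1 t (s - c)) (quartic2 t (x - c)).
Proof.
have h := dM (dZ (- 4) (dB (d_id x) (d_cst c x))) (d_sqr_shift t x c).
by apply: d_eq h; rewrite /quartic2; ring.
Qed.

Lemma cts_quartic t c x : {for x, continuous (fun s => quartic t (s - c))}.
Proof. exact: is_derive_continuous (d_quartic t x c). Qed.

Lemma cts_quartic1 t c x : {for x, continuous (fun s => quartic1 t (s - c))}.
Proof. exact: is_derive_continuous (d_quartic1 t x c). Qed.

Lemma cts_quartic2 t c x : {for x, continuous (fun s => quartic2 t (s - c))}.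
Proof.
apply: ctsB; last exact: cts_cst.
apply: ctsM; first exact: cts_cst.
by apply: ctsX; apply: ctsB; [exact: is_derive_continuous (d_id x)|exact: cts_cst].
Qed.

(** For [a != 0], [mom1] and [mom2] are the first two [y]-derivatives of [mom], with the
    [x]-derivatives moved onto the bump; they involve no derivative of [u] or [v]. *)
Definition mom t c v y := integ (fun x => v (x, y) * quartic t (x - c)) (c - t) (c + t).
Definition mom1 t c u y := integ (fun x => u (x, y) * - quartic1 t (x - c)) (c - t) (c + t).
Definition mom2 a t c v y :=
  integ (fun x => - 2^-1 * ln (v (x, y) + wt a (v (x, y)) y) * quartic2 t (x - c)) (c - t) (c + t).

Lemma quartic_end t c : quartic t (c + t - c) = 0 /\ quartic t (c - t - c) = 0.
Proof. by rewrite /quartic; split; ring. Qed.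

Lemma quartic1_end t c : quartic1 t (c + t - c) = 0 /\ quartic1 t (c - t - c) = 0.
Proof. by rewrite /quartic1; split; ring. Qed.

Lemma cts_fst_mul f (h : R -> R) x y : {for (x, y), continuous f} -> {for x, continuous h} ->
  {for (x, y), continuous (fun p : R * R => f p * h p.1)}.
Proof.
move=> cf ch; apply: ctsM => //; apply: (@cts_comp _ _ h fst); first exact: cvg_fst.
exact: ch.
Qed.

Lemma int_parts0 (f f' h h' : R -> R) p q : p <= q ->
  (forall x, is_derive x 1 f (f' x)) -> (forall x, is_derive x 1 h (h' x)) ->
  continuous f' -> continuous h' -> h p = 0 -> h q = 0 ->
  integ (fun x => f' x * h x) p q = integ (fun x => f x * - h' x) p q.
Proof.
move=> pq df dh cf' ch' hp hq.
have cf : continuous f by move=> x; exact: is_derive_continuous (df x).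
have ch : continuous h by move=> x; exact: is_derive_continuous (dh x).
have c1 : continuous (fun x => f' x * h x) by apply: ctsP => x; apply: ctsM; [exact: cf'|exact: ch].
have c2 : continuous (fun x => f x * - h' x).
  by apply: ctsP => x; apply: ctsM; [exact: cf|apply: ctsN; exact: ch'].
apply/eqP; rewrite -subr_eq0 -intB //; apply/eqP.
have c3 : continuous (fun x => f' x * h x - f x * - h' x).
  by apply: ctsP => x; apply: ctsB; [exact: c1|exact: c2].
have d3 x : p <= x <= q -> is_derive x 1 (fun x => f x * h x) (f' x * h x - f x * - h' x).
  by move=> _; have hd := dM (df x) (dh x); apply: d_eq hd; ring.
by rewrite (intE' c3 pq d3) hp hq !mulr0 subrr.
Qed.

Lemma mom_dy Rr a u v D t c y : 0 <= t -> is_sol Rr a u v D -> `|y| < Rr ->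
  is_derive y 1 (mom t c v) (mom1 t c u y).
Proof.
move=> t0 S yR; have tt : c - t <= c + t by lra.
have cux : continuous (fun s => dux D (s, y)).
  by apply: ctsP => s; apply: (@continuous_slice1 _ (dux D) s y); exact: (sol_cux S yR).
have [e1 e2] := quartic_end t c.
rewrite /mom1 -(int_parts0 tt (fun x => sol_ux S x yR) (fun x => d_quartic t x c) cux) //; last first.
  by apply: ctsP => s; exact: cts_quartic1.
have inR z : `|z - y| < Rr - `|y| -> `|z| < Rr.
  by move=> h; have := ler_normD (z - y) y; rewrite subrK; lra.
apply: (@int_param_derive _ (fun p => v p * quartic t (p.1 - c))
  (fun p => dux D p * quartic t (p.1 - c)) _ _ y (Rr - `|y|)) => //=.
- by rewrite subr_gt0.
- move=> s z /inR zR; apply: ctsM; last exact: cts_quartic.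
  exact: (scont_slice (sol_cv S) (ltW zR)).
- move=> s z _ /inR zR; have h := dM (sol_vy S s zR) (d_cst (quartic t (s - c)) z).
  by apply: d_eq h; ring.
- by move=> s; apply: ctsM; [exact: cux|exact: cts_quartic].
- by move=> s _; apply: (cts_fst_mul (h := fun s => quartic t (s - c))); [exact: (sol_cux S yR)|exact: cts_quartic].
Qed.

Lemma mom1_dy Rr a u v D t c y : 0 <= t -> a != 0 -> is_sol Rr a u v D -> `|y| < Rr ->
  is_derive y 1 (mom1 t c u) (mom2 a t c v y).
Proof.
move=> t0 a0 S yR; have tt : c - t <= c + t by lra.
have cuy : continuous (fun s => duy D (s, y)).
  by apply: ctsP => s; apply: (@continuous_slice1 _ (duy D) s y); exact: (sol_cuy S yR).
have [e1 e2] := quartic1_end t c.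
have dbN x : is_derive x 1 (fun s => - quartic1 t (s - c)) (- quartic2 t (x - c)) by apply: dN; exact: d_quartic1.
have -> : mom2 a t c v y = integ (fun x => duy D (x, y) * - quartic1 t (x - c)) (c - t) (c + t).
  rewrite (int_parts0 tt (fun x => ln_wt_dx x a0 S yR) dbN cuy) ?e1 ?e2 ?oppr0 //.
    by apply: eq_int => x; rewrite opprK.
  by apply: ctsP => s; apply: ctsN; exact: cts_quartic2.
have inR z : `|z - y| < Rr - `|y| -> `|z| < Rr.
  by move=> h; have := ler_normD (z - y) y; rewrite subrK; lra.
apply: (@int_param_derive _ (fun p => u p * - quartic1 t (p.1 - c))
  (fun p => duy D p * - quartic1 t (p.1 - c)) _ _ y (Rr - `|y|)) => //=.
- by rewrite subr_gt0.
- move=> s z /inR zR; apply: ctsM; last by apply: ctsN; exact: cts_quartic1.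
  exact: (scont_slice (sol_cu S) (ltW zR)).
- move=> s z _ /inR zR; have h := dM (sol_uy S s zR) (d_cst (- quartic1 t (s - c)) z).
  by apply: d_eq h; ring.
- by move=> s; apply: ctsM; [exact: cuy|apply: ctsN; exact: cts_quartic1].
- move=> s _; apply: (cts_fst_mul (h := fun s => - quartic1 t (s - c))); first exact: (sol_cuy S yR).
  by apply: ctsN; exact: cts_quartic1.
Qed.

(** The derivative in [V] is the inverse weight, positive and at most the inverse of [|y|] whatever
    [a] is. *)
Lemma ln_wt_lip a (V V' : R) y : a != 0 -> y != 0 -> V <= V' ->
  0 <= ln (V' + wt a V' y) - ln (V + wt a V y) <= (V' - V) / `|y|.
Proof.
move=> a0 y0; rewrite le_eqVlt => /orP[/eqP ->|VV]; first by rewrite !subrr mul0r lexx.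
have dG (W : R) : is_derive W 1 (fun W => ln (W + wt a W y)) (wt a W y)^-1.
  have q0 := wt_gt0 W y a0; have p0 := wt_add_gt0 W y a0.
  have s0 : 0 < W ^+ 2 + y ^+ 2 + a ^+ 2 by rewrite -sqr_wt exprn_gt0.
  have h0 := dD (dD (d_sqr (d_id W)) (d_cst (y ^+ 2) W)) (d_cst (a ^+ 2) W).
  have h1 := dD (d_id W) (@d_sqrt R (fun W => W ^+ 2 + y ^+ 2 + a ^+ 2) W _ s0 h0).
  have h2 := @d_ln R (fun W => W + wt a W y) W _ p0 h1.
  apply: d_eq h2; rewrite -/(wt a W y); field.
  by rewrite !gt_eqF.
have [W _ ->] := mvt VV (fun W _ => dG W) (fun W _ => is_derive_continuous (dG W)).
have q0 := wt_gt0 W y a0; have ny : 0 < `|y| by rewrite normr_gt0.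
have VV' : 0 < V' - V by rewrite subr_gt0.
apply/andP; split; first by apply: mulr_ge0; [rewrite invr_ge0|]; exact: ltW.
by rewrite mulrC ler_pM2l // lef_pV2 ?posrE // wt_ge_y.
Qed.

(** After multiplication by [t ^+ 2] the difference of the two sides is
    [4 * s ^+ 2 * (t ^+ 2 + s ^+ 2)]. This inequality is what singles out the bump. *)
Lemma quartic2_le t s : 0 < t -> - quartic2 t s <= 4 / t ^+ 2 * quartic t s.
Proof.
move=> t0; have t2 : 0 < t ^+ 2 by rewrite exprn_gt0.
rewrite -(ler_pM2l t2) /quartic /quartic2.
have -> : t ^+ 2 * (4 / t ^+ 2 * (t ^+ 2 - s ^+ 2) ^+ 2) = 4 * (t ^+ 2 - s ^+ 2) ^+ 2.
  by field; rewrite gt_eqF.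
have : 0 <= 4 * s ^+ 2 * (t ^+ 2 + s ^+ 2).
  by apply: mulr_ge0; [apply: mulr_ge0 => //; exact: sqr_ge0|apply: addr_ge0; exact: sqr_ge0].
by clear; lra.
Qed.

(** The increment of the logarithm is nonnegative, so only the upper bound [quartic2_le] of
    [- quartic2] matters; [ln_wt_lip] then replaces the logarithm by [v' - v]. *)
Lemma mom2_le Rr a t c u v D u' v' D' y : 0 < t -> a != 0 -> is_sol Rr a u v D -> is_sol Rr a u' v' D' ->
  `|y| < Rr -> y != 0 -> (forall x, v (x, y) <= v' (x, y)) ->
  mom2 a t c v' y - mom2 a t c v y <= 2 / t ^+ 2 * (mom t c v' y - mom t c v y) / `|y|.
Proof.
move=> t0 a0 S S' yR y0 vv; have tt : c - t <= c + t by lra.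
have ny : 0 < `|y| by rewrite normr_gt0.
have cm w U E : is_sol Rr a U w E -> continuous (fun x => w (x, y) * quartic t (x - c)).
  by move=> SS; apply: ctsP => x; apply: ctsM; [exact: (scont_slice (sol_cv SS) (ltW yR))|exact: cts_quartic].
have c2 w U E : is_sol Rr a U w E -> continuous (fun x => - 2^-1 * ln (w (x, y) + wt a (w (x, y)) y) * quartic2 t (x - c)).
  move=> SS; apply: ctsP => x; apply: ctsM; last exact: cts_quartic2.
  exact: is_derive_continuous (ln_wt_dx x a0 SS yR).
rewrite /mom /mom2 -intB; [|exact: c2 S'|exact: c2 S].
rewrite -intB; [|exact: cm S'|exact: cm S].
rewrite mulrAC -intZ; last by apply: ctsP => x; apply: ctsB; [exact: (cm _ _ _ S')|exact: (cm _ _ _ S)].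
apply: le_int => //.
- by apply: ctsP => x; apply: ctsB; [exact: (c2 _ _ _ S')|exact: (c2 _ _ _ S)].
- by apply: ctsP => x; apply: ctsM; [exact: cts_cst|apply: ctsB; [exact: (cm _ _ _ S')|exact: (cm _ _ _ S)]].
move=> x _; have /andP[g0 g1] := ln_wt_lip a0 y0 (vv x).
set g := _ - _ in g0 g1; have b1 := quartic2_le (x - c) t0.
have -> : - 2^-1 * ln (v' (x, y) + wt a (v' (x, y)) y) * quartic2 t (x - c) -
   - 2^-1 * ln (v (x, y) + wt a (v (x, y)) y) * quartic2 t (x - c) = 2^-1 * (g * - quartic2 t (x - c)).
  by rewrite /g; ring.
apply: le_trans (_ : 2^-1 * (g * (4 / t ^+ 2 * quartic t (x - c))) <= _).
  by rewrite ler_pM2l ?invr_gt0 // ler_wpM2l.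
have bb : 0 <= 4 / t ^+ 2 * quartic t (x - c) by rewrite mulr_ge0 ?divr_ge0 ?sqr_ge0.
have := ler_wpM2r bb g1.
have -> : 2 / t ^+ 2 / `|y| * (v' (x, y) * quartic t (x - c) - v (x, y) * quartic t (x - c)) =
  2^-1 * ((v' (x, y) - v (x, y)) / `|y| * (4 / t ^+ 2 * quartic t (x - c))).
  by field; rewrite !gt_eqF.
by clear; lra.
Qed.

(* Gronwall for [f'' <= K f / y]: the weight is harmless at [0], as [f] vanishes there to second order. *)
Lemma gronwall (f g : R -> R) c T K : 0 < K -> 0 <= c ->
  (forall y, c <= y < T -> {for y, continuous g}) ->
  (forall p q S, c <= p -> p <= q -> q < T -> (forall z, p <= z <= q -> g z <= S) ->
     f q - f p <= S * (q - p)) ->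
  (forall p q S, c <= p -> p <= q -> q < T -> (forall z, p <= z <= q -> f z <= S * z) ->
     g q - g p <= K * S * (q - p)) ->
  f c <= 0 -> g c <= 0 -> forall y, c <= y < T -> f y <= 0.
Proof.
move=> K0 c0 cg P1 P2 fc gc; pose h := (2 * K)^-1.
have h0 : 0 < h by rewrite invr_gt0 mulr_gt0.
(* Let [g] be maximal at [m]. If [g m > 0], then [f z <= g m * z] up to [m], and the second estimate
   gives [g m <= K * g m * h = g m / 2], a contradiction. *)
have step p q : c <= p -> p <= q -> q <= p + h -> q < T -> f p <= 0 -> g p <= 0 -> f q <= 0 /\ g q <= 0.
  move=> cp pq qh qT fp gp.
  have cgn : {within `[p, q], continuous (fun y => - g y)}.
    by apply: continuous_itv => z /andP[z1 z2]; apply: ctsN; apply: cg; apply/andP; split; lra.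
  have [m] := EVT_min pq cgn; rewrite in_itv /= => /andP[m1 m2] mx.
  have {}mx z : p <= z <= q -> g z <= g m by move=> hz; rewrite -lerN2; apply: mx; rewrite in_itv.
  suff gm : g m <= 0.
    split; last by apply: le_trans gm; apply: mx; rewrite pq lexx.
    have := P1 p q 0 cp pq qT (fun z hz => le_trans (mx z hz) gm); rewrite mul0r; lra.
  rewrite leNgt; apply/negP => gm.
  have fz z : p <= z <= m -> f z <= g m * z.
    move=> /andP[z1 z2]; have mz w : p <= w <= z -> g w <= g m by move=> hw; apply: mx; lra.
    have zT : z < T by lra.
    have := P1 p z (g m) cp z1 zT mz.
    have : 0 <= g m * p by rewrite mulr_ge0 //; lra.
    by lra.
  have := P2 p m (g m) cp m1 ltac:(lra) fz.
  have : K * g m * (m - p) <= K * g m * h by rewrite ler_pM2l ?mulr_gt0 //; lra.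
  have -> : K * g m * h = g m / 2 by rewrite /h; field; rewrite gt_eqF.
  by lra.
have it (n : nat) y : c <= y < T -> y <= c + n%:R * h -> f y <= 0 /\ g y <= 0.
  elim: n y => [|n IH] y /andP[y1 y2].
    by rewrite mul0r addr0 => yc; have -> : y = c by lra.
  rewrite -natr1 mulrDl mul1r => yh; have [yc|yc] := leP y (c + n%:R * h).
    by apply: IH => //; rewrite y1.
  have cn : c <= c + n%:R * h by rewrite lerDl mulr_ge0 // ltW.
  have [f1 g1] : f (c + n%:R * h) <= 0 /\ g (c + n%:R * h) <= 0.
    by apply: IH => //; rewrite cn (lt_trans yc).
  by apply: step f1 g1 => //; [exact: ltW|lra].
move=> y hy; have [|//] := it (Num.bound ((y - c) / h)) y hy.
have := archi_boundP (_ : 0 <= (y - c) / h); rewrite divr_ge0 ?subr_ge0 ?(ltW h0) //; last by case/andP: hy.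
by move=> /(_ isT); rewrite ltr_pdivrMr //; lra.
Qed.

End Moments.

(** * Uniformity in the parameter and passage to its limit *)

Section FamilyOrder.
Context {R : realType}.
Implicit Types (x y z t e d r k s m K M A B C : R) (f g U V : R * R -> R) (a b : R).

Lemma gap_line (g g' : R -> R) (P : R) : 0 < P -> continuous g -> continuous g' ->
  (forall x, g (x + P) = g x) -> (forall x, g' (x + P) = g' x) -> (forall x, g x < g' x) ->
  exists k t, [/\ 0 < k, 0 < t & forall x s, `|s| <= t -> g (x + s) + k <= g' x].
Proof.
move=> P0 cg cg' gP gP' lt.
have ch : {within `[0, P], continuous (fun x => g' x - g x)}.
  by apply: continuous_itv => x _; apply: ctsB; [exact: cg'|exact: cg].
have [c _ mn] := EVT_min (ltW P0) ch.
have k0 : 0 < (g' c - g c) / 2 by rewrite divr_gt0 // subr_gt0.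
have cs : continuous (fun p : R * R => g (p.1 + p.2)).
  apply: ctsP => p; apply: (cts_comp (f := fun p => p.1 + p.2)); last exact: cg.
  by apply: ctsD; [exact: cvg_fst|exact: cvg_snd].
have [d d0 H] := @itv_near_unif _ (fun p => g (p.1 + p.2)) 0 P 0 _ (fun x _ => cs (x, 0)) k0.
exists ((g' c - g c) / 2), (d / 2); split=> //; first by rewrite divr_gt0.
move=> x s sd.
have per z : (g' (z + P), g (z + P + s)) = (g' z, g (z + s)) by rewrite gP' addrAC gP.
have [x0 x0P [E1 E2]] := periodic_reduce P0 (g := fun x => (g' x, g (x + s))) per x.
rewrite -E1 -E2; have := mn x0; rewrite in_itv /= => /(_ x0P).
have := H x0 s x0P; rewrite subr0 /= addr0 => /(_ ltac:(lra)) /ltr_normlP [? ?].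
lra.
Qed.

(** The sign [s] reflects the strip, so that its two halves are treated at once. *)
Lemma itv_near_unif2 (f : R -> R * R -> R) p q a y s e :
  (forall x, p <= x <= q -> forall k, 0 < k -> exists2 d : R, 0 < d & forall a' x' y',
     `|a' - a| < d -> `|x' - x| < d -> `|y' - s * y| < d -> `|f a' (x', y') - f a (x, s * y)| < k) ->
  `|s| = 1 -> 0 < e ->
  exists2 d : R, 0 < d & forall a' x y', p <= x <= q -> `|a' - a| < d -> `|y' - y| < d ->
    `|f a' (x, s * y') - f a (x, s * y)| < e.
Proof.
move=> cf s1 e0.
have /compact_near_coveringP/(_ (R * R)%type (nbhs ((a, y) : R * R))
  (fun (w : R * R) x => `|f w.1 (x, s * w.2) - f a (x, s * y)| < e)) :=
  @segment_compact R p q.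
move=> /(_ _ _) [|[B1 B2] /= [/nbhs_ballP[d1 /= d10 H1] /nbhs_ballP[d2 /= d20 H2]] H].
  move=> x /=; rewrite in_itv /= => xpq.
  have [d d0 H] := cf x xpq (e / 2) ltac:(lra).
  exists (ball x d, (ball a d `*` ball y d)).
    split; first exact: nbhsx_ballx.
    by exists (ball a d, ball y d); [split; exact: nbhsx_ballx|].
  move=> [z1 [z2 z3]] [/= h1 [h2 h3]].
  have h4 : `|s * z3 - s * y| < d by rewrite -mulrBr normrM s1 mul1r distrC.
  have e1 : `|f z2 (z1, s * z3) - f a (x, s * y)| < e / 2 by apply: H => //=; rewrite distrC.
  have e2 : `|f a (z1, s * y) - f a (x, s * y)| < e / 2.
    by apply: H => /=; rewrite ?subrr ?normr0 // distrC.
  rewrite (_ : _ - _ = (f z2 (z1, s * z3) - f a (x, s * y)) - (f a (z1, s * y) - f a (x, s * y))); last by ring.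
  by apply: (le_lt_trans (ler_normB _ _)); lra.
exists (Num.min d1 d2); first by rewrite lt_min d10.
move=> a' x y' xpq; rewrite !lt_min => /andP[a1 _] /andP[_ y2].
apply: (H (a', y')); last by rewrite /= in_itv.
by split; [apply: H1|apply: H2]; rewrite /ball /= distrC.
Qed.

Lemma int_joint (f : R -> R * R -> R) (h : R -> R) p q a y s : p <= q -> `|s| = 1 -> continuous h ->
  (exists2 d : R, 0 < d & forall a' y', `|y' - y| < d -> continuous (fun x => f a' (x, s * y'))) ->
  (forall x, p <= x <= q -> forall k, 0 < k -> exists2 d : R, 0 < d & forall a' x' y',
     `|a' - a| < d -> `|x' - x| < d -> `|y' - s * y| < d -> `|f a' (x', y') - f a (x, s * y)| < k) ->
  {for (y, a), continuous (fun z : R * R => integ (fun x => f z.2 (x, s * z.1) * h x) p q)}.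
Proof.
move=> pq s1 chh [r r0 cf] jf; apply/continuous2_atP => e e0.
have ch : {within `[p, q], continuous (fun x => - `|h x|)}.
  apply: continuous_itv => x _; apply: ctsN; apply: (@cts_comp _ _ (fun t : R => `|t|) h).
    exact: chh.
  exact: norm_continuous.
have [c _ mx] := EVT_min pq ch; set B := `|h c| in mx.
have hB x : p <= x <= q -> `|h x| <= B by move=> hx; rewrite -lerN2; apply: mx; rewrite in_itv.
have B0 : 0 <= B by exact: normr_ge0.
have q0 : 0 < (B + 1) * (q - p + 1) by rewrite mulr_gt0 //; lra.
have k0 : 0 < e / ((B + 1) * (q - p + 1)) by rewrite divr_gt0.
have [d d0 H] := itv_near_unif2 jf s1 k0.
exists (Num.min d r); first by rewrite lt_min d0.
move=> [y' a'] /=; rewrite !lt_min => /andP[y1 y2] /andP[a1 _].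
have c1 z w : `|w - y| < r -> continuous (fun x => f z (x, s * w) * h x).
  by move=> wr; apply: ctsP => x; apply: ctsM; [exact: (cf z w wr x)|exact: chh].
have yy : `|y - y| < r by rewrite subrr normr0.
rewrite -intB; [|exact: c1|exact: c1].
apply: (@le_lt_trans _ _ (e / ((B + 1) * (q - p + 1)) * B * (q - p))).
  apply: int_norm_le => //.
    by apply: ctsP => x; apply: ctsB; [exact: (c1 a' y')|exact: (c1 a y)].
  move=> x /andP[x1 x2]; have hx : p <= x <= q by rewrite !ltW.
  rewrite -mulrBl normrM; apply: ler_pM => //; last exact: hB.
  by apply: ltW; exact: H.
rewrite -mulrA mulrAC ltr_pdivrMr // ltr_pM2l //.
have : 0 <= B * (q - p) by rewrite mulr_ge0 // subr_ge0.
by move: pq B0; clear; nra.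
Qed.

(** Differentiability is assumed for [a != 0] only. The bound on increments survives at [a0] because
    [F] is continuous in both variables. *)
Lemma limit_deriv_le (F : R -> R -> R) (dF : R -> R -> R) a0 p q S : p <= q ->
  (forall z, p <= z <= q -> {for (z, a0), continuous (fun w : R * R => F w.2 w.1)}) ->
  (forall a z, a != 0 -> p <= z <= q -> is_derive z 1 (F a) (dF a z)) ->
  (forall e, 0 < e -> exists2 d : R, 0 < d & forall a z, a != 0 -> `|a - a0| < d -> p <= z <= q ->
     dF a z <= S + e) ->
  F a0 q - F a0 p <= S * (q - p).
Proof.
move=> pq cF dFF lim; apply/ler_addgt0Pr => e e0.
(* The errors are [e1 * (q - p)] from the derivative and [e1] from replacing [a0] by [a] at each
   end. *)
pose e1 := e / (q - p + 2); have q0 : 0 < q - p + 2 by lra.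
have e10 : 0 < e1 by rewrite divr_gt0.
have [d1 d10 H1] := itv_near_unif cF e10; have [d2 d20 H2] := lim e1 e10.
have [a [a1 a2 an0]] : exists a, [/\ `|a - a0| < d1, `|a - a0| < d2 & a != 0].
  pose d := Num.min d1 d2 / 2; have d0 : 0 < d by rewrite divr_gt0 // lt_min d10.
  have [dd1 dd2] : d < d1 /\ d < d2.
    have m1 : Num.min d1 d2 <= d1 by rewrite ge_min lexx.
    have m2 : Num.min d1 d2 <= d2 by rewrite ge_min lexx orbT.
    by move: d0; rewrite /d; split; lra.
  case: (eqVneq a0 0) => h; last by exists a0; rewrite subrr normr0.
  by exists d; rewrite h subr0 gtr0_norm // gt_eqF.
have := H1 q a ltac:(by rewrite pq lexx) a1; have := H1 p a ltac:(by rewrite pq lexx) a1.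
have : F a q - F a p <= (S + e1) * (q - p).
  have := @derive_ge0_le _ (fun z => (S + e1) * z - F a z) (fun z => (S + e1) * 1 - dF a z) p q pq.
  have dz z : p <= z <= q -> is_derive z 1 (fun z => (S + e1) * z - F a z) ((S + e1) * 1 - dF a z).
    by move=> hz; have h := dB (dZ (S + e1) (d_id z)) (dFF a z an0 hz).
  move=> /(_ _ _ _)H; have : (S + e1) * p - F a p <= (S + e1) * q - F a q.
    apply: H.
    - by move=> z /andP[z1 z2]; apply: dz; rewrite !ltW.
    - by move=> z /dz h; exact: is_derive_continuous h.
    - move=> z /andP[z1 z2]; rewrite mulr1 subr_ge0; apply: H2 => //; by rewrite !ltW.
  by clear; lra.
have : e1 * (q - p) + 2 * e1 = e by rewrite /e1; field; rewrite gt_eqF.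
rewrite /=; clear=> ? ? /ltr_normlP [? ?] /ltr_normlP [? ?]; lra.
Qed.

End FamilyOrder.

(** * Order in [b] and positivity of moments *)

Section StrictMonotonicity.
Context {R : realType}.
Implicit Types (x y z t e d r k s m K M A B C : R) (f g U V : R * R -> R) (a b : R).
Variables (Rr P : R) (phip phim : R -> R -> R -> R) (u v : R -> R -> R * R -> R).
Hypothesis F : sol_family Rr P phip phim u v.

Let R0 := fam_R0 F.
Let P0 := fam_P0 F.

Lemma continuous_phip a b : continuous (phip a b).
Proof.
have h : continuous (fun x => v a b (x, Rr)) by exact: scont_slice (fam_cv F a b) (strip_top F 0).
by move=> x; apply: cts_ext (h x) => s; exact: fam_bp F a b s.
Qed.

Lemma continuous_phim a b : continuous (phim a b).
Proof.
have h : continuous (fun x => v a b (x, - Rr)) by exact: scont_slice (fam_cv F a b) (strip_bot F 0).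
by move=> x; apply: cts_ext (h x) => s; exact: fam_bm F a b s.
Qed.

Lemma phip_periodic a b x : phip a b (x + P) = phip a b x.
Proof. by rewrite -!(fam_bp F); exact: (fam_vP F a b (p := (x, Rr)) (strip_top F x)). Qed.

Lemma phim_periodic a b x : phim a b (x + P) = phim a b x.
Proof. by rewrite -!(fam_bm F); exact: (fam_vP F a b (p := (x, - Rr)) (strip_bot F x)). Qed.

Lemma fam_gap a b b' : b < b' -> exists k t, [/\ 0 < k, 0 < t & forall x s, `|s| <= t ->
  phip a b (x + s) + k <= phip a b' x /\ phim a b (x + s) + k <= phim a b' x].
Proof.
move=> bb; have [k1 [t1 [k10 t10 H1]]] := gap_line P0 (@continuous_phip a b) (@continuous_phip a b')
  (phip_periodic a b) (phip_periodic a b') (fun x => (fam_lt F a x bb).1).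
have [k2 [t2 [k20 t20 H2]]] := gap_line P0 (@continuous_phim a b) (@continuous_phim a b')
  (phim_periodic a b) (phim_periodic a b') (fun x => (fam_lt F a x bb).2).
exists (Num.min k1 k2), (Num.min t1 t2); split; rewrite ?lt_min ?k10 ?t10 //.
have m1 : Num.min k1 k2 <= k1 by rewrite ge_min lexx.
have m2 : Num.min k1 k2 <= k2 by rewrite ge_min lexx orbT.
move=> x s; rewrite le_min => /andP[s1 s2]; have h1 := H1 x s s1; have h2 := H2 x s s2.
by split; lra.
Qed.

Lemma exists_near_neq0 a0 d : 0 < d -> exists2 a, `|a - a0| < d & a != 0.
Proof.
move=> d0; case: (eqVneq a0 0) => h; last by exists a0; rewrite ?subrr ?normr0.
have d2 : 0 < d / 2 by rewrite divr_gt0.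
by exists (d / 2); rewrite ?h ?subr0 ?gtr0_norm ?gt_eqF //; lra.
Qed.

(* The boundary data at nearby parameters are still ordered, so that the comparison principle applies
   for [a <> 0] and the conclusion survives the limit. *)
Lemma fam_shift a b b' : b < b' -> exists2 t, 0 < t & forall s x y, `|s| <= t -> `|y| < Rr ->
  v a b (x + s, y) <= v a b' (x, y).
Proof.
move=> bb; have [k [t [k0 t0 H]]] := fam_gap a bb; exists t => // s x y st yR.
have k2 : 0 < k / 2 by rewrite divr_gt0.
have [d1 d10 H1] := fam_phi F a b k2; have [d2 d20 H2] := fam_phi F a b' k2.
apply/ler_addgt0Pr => e e0; have e2 : 0 < e / 2 by rewrite divr_gt0.
have [d3 d30 H3] := fam_v_joint F a b (x + s) yR e2.
have [d4 d40 H4] := fam_v_joint F a b' x yR e2.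
have [a'] : exists2 a', `|a' - a| < Num.min (Num.min d1 d2) (Num.min d3 d4) & a' != 0.
  by apply: exists_near_neq0; rewrite !lt_min d10 d20 d30.
rewrite !lt_min => /andP[/andP[a1 a2] /andP[a3 a4]] an0.
have le1 : v a' b (x + s, y) <= v a' b' (x, y).
  apply: (fam_shift_le F an0 _ _ x (ltW yR)) => z; have [h1 h2] := H z s st.
    have [/ler_normlP [? ?] _] := H1 a' b a1 ltac:(by rewrite subrr normr0) (z + s).
    have [/ler_normlP [? ?] _] := H2 a' b' a2 ltac:(by rewrite subrr normr0) z.
    lra.
  have [_ /ler_normlP [? ?]] := H1 a' b a1 ltac:(by rewrite subrr normr0) (z + s).
  have [_ /ler_normlP [? ?]] := H2 a' b' a2 ltac:(by rewrite subrr normr0) z.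
  lra.
have := H3 a' b (x + s) y a3; rewrite !subrr normr0 => /(_ d30 d30 d30).
have := H4 a' b' x y a4; rewrite !subrr normr0 => /(_ d40 d40 d40).
move: le1; clear -R0 P0=> ? /ltr_normlP [? ?] /ltr_normlP [? ?]; lra.
Qed.

Lemma fam_mono a b b' x y : b < b' -> `|y| < Rr -> v a b (x, y) <= v a b' (x, y).
Proof.
move=> bb yR; have [t t0 H] := fam_shift a bb.
by have := H 0 x y; rewrite normr0 addr0; apply => //; exact: ltW.
Qed.

Section FixedWindow.
Variables (t c s : R).
Hypotheses (t0 : 0 < t) (s1 : `|s| = 1).

(** With [s] a sign, [y >= 0] measures the distance from the axis in either half of the strip; the
    factor [s] in [dmom1] comes from the chain rule. *)
Definition dmom b1 b2 a y := mom t c (v a b2) (s * y) - mom t c (v a b1) (s * y).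
Definition dmom1 b1 b2 a y := s * (mom1 t c (u a b2) (s * y) - mom1 t c (u a b1) (s * y)).

Lemma norm_sign_mul y : `|s * y| = `|y|.
Proof. by rewrite normrM s1 mul1r. Qed.

Lemma cts_mom b a y : `|y| < Rr ->
  {for (y, a), continuous (fun z : R * R => mom t c (v z.2 b) (s * z.1))}.
Proof.
move=> yR; apply: (@int_joint R (fun a => v a b) (fun x => quartic t (x - c))) => //.
- by have := t0; lra.
- by move=> x; exact: cts_quartic.
- exists (Rr - `|y|); first by rewrite subr_gt0.
  move=> a' y' h; apply: scont_slice (fam_cv F a' b) _; rewrite norm_sign_mul.
  by have := ler_normD (y' - y) y; rewrite subrK; lra.
move=> x _ k k0; have syR : `|s * y| < Rr by rewrite norm_sign_mul.
have [d d0 H] := fam_v_joint F a b x syR k0.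
by exists d => // a' x' y' h1 h2 h3; apply: H => //; rewrite subrr normr0.
Qed.

Lemma cts_mom1 b a y : `|y| < Rr ->
  {for (y, a), continuous (fun z : R * R => mom1 t c (u z.2 b) (s * z.1))}.
Proof.
move=> yR; apply: (@int_joint R (fun a => u a b) (fun x => - quartic1 t (x - c))) => //.
- by have := t0; lra.
- by apply: ctsP => x; apply: ctsN; exact: cts_quartic1.
- exists (Rr - `|y|); first by rewrite subr_gt0.
  move=> a' y' h; apply: scont_slice (fam_cu F a' b) _; rewrite norm_sign_mul.
  by have := ler_normD (y' - y) y; rewrite subrK; lra.
move=> x _ k k0; have syR : `|s * y| < Rr by rewrite norm_sign_mul.
have [d d0 H] := fam_u_joint F a b x syR k0.
by exists d => // a' x' y' h1 h2 h3; apply: H => //; rewrite subrr normr0.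
Qed.

Lemma cts_dmom b1 b2 a y : `|y| < Rr ->
  {for (y, a), continuous (fun z : R * R => dmom b1 b2 z.2 z.1)}.
Proof. by move=> yR; apply: ctsB; exact: cts_mom. Qed.

Lemma cts_dmom1 b1 b2 a y : `|y| < Rr ->
  {for (y, a), continuous (fun z : R * R => dmom1 b1 b2 z.2 z.1)}.
Proof.
move=> yR; apply: ctsM; first exact: cts_cst.
by apply: ctsB; exact: cts_mom1.
Qed.

Lemma d_sign (h : R -> R) (dh : R) y : is_derive (s * y) 1 h dh -> is_derive y 1 (fun z => h (s * z)) (s * dh).
Proof.
move=> hd; have h1 := @d_comp R h (fun z => s * z) y _ dh (dZ s (d_id y)) hd.
by apply: d_eq h1; ring.
Qed.

Lemma dmom_dy b1 b2 a y : a != 0 -> `|y| < Rr -> is_derive y 1 (dmom b1 b2 a) (dmom1 b1 b2 a y).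
Proof.
move=> an0 yR; have syR : `|s * y| < Rr by rewrite norm_sign_mul.
have [D1 [_ [S1 _]]] := fam_sol F b1 an0; have [D2 [_ [S2 _]]] := fam_sol F b2 an0.
have h1 := d_sign (mom_dy c (ltW t0) S1 syR); have h2 := d_sign (mom_dy c (ltW t0) S2 syR).
by have h := dB h2 h1; apply: d_eq h; rewrite /dmom1; ring.
Qed.

Lemma dmom1_dy b1 b2 a y : a != 0 -> `|y| < Rr -> is_derive y 1 (dmom1 b1 b2 a)
  (mom2 a t c (v a b2) (s * y) - mom2 a t c (v a b1) (s * y)).
Proof.
move=> an0 yR; have syR : `|s * y| < Rr by rewrite norm_sign_mul.
have [D1 [_ [S1 _]]] := fam_sol F b1 an0; have [D2 [_ [S2 _]]] := fam_sol F b2 an0.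
have h1 := d_sign (mom1_dy c (ltW t0) an0 S1 syR).
have h2 := d_sign (mom1_dy c (ltW t0) an0 S2 syR).
have h := dZ s (dB h2 h1); apply: d_eq h.
by rewrite -mulrBr mulrA -expr2 -(real_normK (num_real s)) s1 expr1n mul1r.
Qed.

Lemma dmom_incr b1 b2 a p q S : - Rr < p -> p <= q -> q < Rr ->
  (forall z, p <= z <= q -> dmom1 b1 b2 a z <= S) ->
  dmom b1 b2 a q - dmom b1 b2 a p <= S * (q - p).
Proof.
move=> pR pq qR H; have inR z : p <= z <= q -> `|z| < Rr.
  by move=> /andP[z1 z2]; apply/ltr_normlP; split; lra.
apply: (limit_deriv_le (dF := fun a z => dmom1 b1 b2 a z) pq).
- by move=> z /inR zR; exact: cts_dmom.
- by move=> a' z an0 /inR zR; exact: dmom_dy.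
move=> e e0.
have [d d0 H1] := itv_near_unif (fun z hz => @cts_dmom1 b1 b2 a z (inR z hz)) e0.
exists d => // a' z _ ad hz; have := H1 z a' hz ad; have := H z hz.
by rewrite /=; clear -R0 P0=> ? /ltr_normlP [? ?]; lra.
Qed.

(** Heights bounded below by [p > 0] keep the weight [1 / y] bounded in the passage to the limit in
    the parameter. *)
Lemma dmom1_incr_pos b1 b2 a p q S : b1 < b2 -> 0 < p -> p <= q -> q < Rr ->
  (forall z, p <= z <= q -> dmom b1 b2 a z <= S * z) ->
  dmom1 b1 b2 a q - dmom1 b1 b2 a p <= 2 / t ^+ 2 * S * (q - p).
Proof.
move=> bb p0 pq qR H; have inR z : p <= z <= q -> `|z| < Rr.
  by move=> /andP[z1 z2]; apply/ltr_normlP; split; lra.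
have K0 : 0 < 2 / t ^+ 2 by rewrite divr_gt0 // exprn_gt0.
apply: (limit_deriv_le (dF := fun a z => mom2 a t c (v a b2) (s * z) - mom2 a t c (v a b1) (s * z)) pq).
- by move=> z /inR zR; exact: cts_dmom1.
- by move=> a' z an0 /inR zR; exact: dmom1_dy.
(* Such an error in [dmom], multiplied by [2 / t ^+ 2] and divided by a height [z >= p], costs at
   most [e]. *)
move=> e e0; have k0 : 0 < e * p / (2 / t ^+ 2) by rewrite divr_gt0 // mulr_gt0.
have [d d0 H1] := itv_near_unif (fun z hz => @cts_dmom b1 b2 a z (inR z hz)) k0.
exists d => // a' z an0 ad hz; have := H1 z a' hz ad; have hS := H z hz => /= /ltr_normlP [_ h2].
have zR := inR z hz; have szR : `|s * z| < Rr by rewrite norm_sign_mul.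
have [z1 z2] := andP hz; have z0 : 0 < z by exact: lt_le_trans z1.
have sz0 : s * z != 0 by rewrite -normr_eq0 norm_sign_mul normr_eq0 gt_eqF.
have [D1 [_ [S1 _]]] := fam_sol F b1 an0; have [D2 [_ [S2 _]]] := fam_sol F b2 an0.
have := mom2_le c t0 an0 S1 S2 szR sz0 (fun x => fam_mono a' x bb szR).
rewrite norm_sign_mul (gtr0_norm z0) -/(dmom b1 b2 a' z) => h; apply: (le_trans h).
rewrite ler_pdivrMr //.
have h3 : dmom b1 b2 a' z <= S * z + e * p / (2 / t ^+ 2) by move: h2 hS; clear -R0 P0; lra.
apply: (le_trans (ler_wpM2l (ltW K0) h3)).
have -> : 2 / t ^+ 2 * (S * z + e * p / (2 / t ^+ 2)) = 2 / t ^+ 2 * S * z + e * p.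
  by field; rewrite gt_eqF.
by rewrite [leRHS]mulrDl; apply: lerD => //; rewrite ler_pM2l.
Qed.

(** The case [p = 0], where the weight is singular, follows from small positive [p] by continuity of
    [dmom1]. *)
Lemma dmom1_incr b1 b2 a p q S : b1 < b2 -> 0 <= p -> p <= q -> q < Rr ->
  (forall z, p <= z <= q -> dmom b1 b2 a z <= S * z) ->
  dmom1 b1 b2 a q - dmom1 b1 b2 a p <= 2 / t ^+ 2 * S * (q - p).
Proof.
move=> bb; rewrite le_eqVlt => /orP[/eqP <-|p0]; last exact: dmom1_incr_pos.
rewrite le_eqVlt => /orP[/eqP <-|q0]; first by rewrite !subrr mulr0.
move=> qR H; apply/ler_addgt0Pr => e e0; set K := 2 / t ^+ 2 * S.
have z0R : `|0 : R| < Rr by rewrite normr0.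
have c0 : {for 0, continuous (fun z => dmom1 b1 b2 a z - K * z)}.
  apply: ctsB; first exact: (@continuous_slice1 _ (fun w => dmom1 b1 b2 w.2 w.1) 0 a (@cts_dmom1 b1 b2 a _ z0R)).
  exact: is_derive_continuous (dZ K (d_id 0)).
have [d d0 Hd] := (continuous_atP _ _).1 c0 e e0.
pose m := Num.min d q / 2.
have m0 : 0 < m by rewrite divr_gt0 // lt_min d0.
have [md mq] : m < d /\ m < q.
  have m1 : Num.min d q <= d by rewrite ge_min lexx.
  have m2 : Num.min d q <= q by rewrite ge_min lexx orbT.
  by move: m0; rewrite /m; split; lra.
have := Hd m; rewrite subr0 gtr0_norm // mulr0 subr0 => /(_ md) /ltr_normlP [_ h].
have Hm z : m <= z <= q -> dmom b1 b2 a z <= S * z.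
  by move=> /andP[z1 z2]; apply: H; rewrite z2 (le_trans (ltW m0) z1).
have := dmom1_incr_pos bb m0 (ltW mq) qR Hm; rewrite -/K subr0 mulrBr => h'.
have aux (A B C D G : R) : A - B <= D - G -> B - G - C < e -> A - C <= D + e by lra.
exact: aux h' h.
Qed.

Lemma dmom_antisym b1 b2 a y : dmom b1 b2 a y = - dmom b2 b1 a y /\ dmom1 b1 b2 a y = - dmom1 b2 b1 a y.
Proof. by rewrite /dmom /dmom1; split; ring. Qed.

Lemma dmom_ge0 b1 b2 a y : b1 < b2 -> `|y| < Rr -> 0 <= dmom b1 b2 a y.
Proof.
move=> bb yR; have syR : `|s * y| < Rr by rewrite norm_sign_mul.
have tt : c - t <= c + t by have := t0; lra.
have cm b : continuous (fun x => v a b (x, s * y) * quartic t (x - c)).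
  apply: ctsP => x; apply: ctsM; last exact: cts_quartic.
  exact: (scont_slice (fam_cv F a b) (ltW syR)).
rewrite subr_ge0; apply: le_int => // x _.
by apply: ler_wpM2r; [exact: sqr_ge0|exact: fam_mono].
Qed.

(* [dmom b1 b2 a], being nonnegative, has a minimum where it vanishes, hence its derivative vanishes too. *)
Lemma dmom1_eq0 b1 b2 a y : b1 < b2 -> `|y| < Rr -> dmom b1 b2 a y <= 0 -> dmom1 b1 b2 a y <= 0.
Proof.
move=> bb yR fy; rewrite leNgt; apply/negP => gy.
have cg : {for y, continuous (fun z => dmom1 b1 b2 a z)}.
  exact: (@continuous_slice1 _ (fun w => dmom1 b1 b2 w.2 w.1) y a (@cts_dmom1 b1 b2 a _ yR)).
have g2 : 0 < dmom1 b1 b2 a y / 2 by rewrite divr_gt0.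
have [d d0 H] := (continuous_atP _ _).1 cg _ g2.
pose m := Num.min d (Rr - `|y|) / 2.
have m0 : 0 < m by rewrite divr_gt0 // lt_min d0 subr_gt0.
have [md mR] : m < d /\ m < Rr - `|y|.
  have m1 : Num.min d (Rr - `|y|) <= d by rewrite ge_min lexx.
  have m2 : Num.min d (Rr - `|y|) <= Rr - `|y| by rewrite ge_min lexx orbT.
  by move: m0; rewrite /m; split; lra.
have [y1 y2] : - Rr < y - m /\ y < Rr.
  by have := ler_norm y; have := ler_norm (- y); rewrite normrN; split; lra.
have ym : y - m <= y by rewrite gerBl ltW.
have := @dmom_incr b2 b1 a (y - m) y (- (dmom1 b1 b2 a y / 2)) y1 ym y2.
have Hz z : y - m <= z <= y -> dmom1 b2 b1 a z <= - (dmom1 b1 b2 a y / 2).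
  move=> /andP[z1 z2]; rewrite (dmom_antisym b2 b1 a z).2.
  have := H z; have -> : `|z - y| < d by apply/ltr_normlP; split; lra.
  by move=> /(_ isT) /ltr_normlP [? ?]; lra.
move=> /(_ Hz); rewrite (dmom_antisym b2 b1 a y).1 (dmom_antisym b2 b1 a (y - m)).1.
have ymR : `|y - m| < Rr by apply/ltr_normlP; split; lra.
have := dmom_ge0 a bb ymR; have : 0 < dmom1 b1 b2 a y / 2 * m by rewrite mulr_gt0.
by move: fy; clear -R0 P0; lra.
Qed.

Lemma dmom_pos b1 b2 a y : b1 < b2 -> 0 <= y < Rr -> 0 < dmom b1 b2 a y.
Proof.
move=> bb /andP[y0 yR]; rewrite ltNge; apply/negP => fy.
have absR z : 0 <= z -> z < Rr -> `|z| < Rr by move=> z0; rewrite ger0_norm.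
have yaR := absR y y0 yR.
have gy := dmom1_eq0 bb yaR fy.
have K0 : 0 < 2 / t ^+ 2 by rewrite divr_gt0 // exprn_gt0.
have vanish z : y <= z < Rr -> dmom b1 b2 a z <= 0.
  apply: (gronwall (f := dmom b1 b2 a) (g := dmom1 b1 b2 a) (K := 2 / t ^+ 2)) => //.
  - move=> w /andP[w1 w2]; have wR := absR w (le_trans y0 w1) w2.
    exact: (@continuous_slice1 _ (fun w => dmom1 b1 b2 w.2 w.1) w a (@cts_dmom1 b1 b2 a _ wR)).
  - move=> p q S h1 h2 h3; apply: dmom_incr => //; have := R0; lra.
  - move=> p q S h1; apply: dmom1_incr => //; exact: le_trans h1.
(* The data differ at the centre of the bump, which makes the moment positive at heights close to
   the boundary. *)
have gap : 0 < v a b2 (c, s * Rr) - v a b1 (c, s * Rr).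
  have [h1 h2] := fam_lt F a c bb.
  have : s = 1 \/ s = -1.
    by have /eqP := s1; rewrite eqr_norml => /andP[/orP[/eqP ->|/eqP ->] _]; [left|right].
  case=> ->; first by rewrite mul1r !(fam_bp F) subr_gt0.
  by rewrite mulN1r !(fam_bm F) subr_gt0.
have RR : strip Rr (c, s * Rr) by rewrite /strip /= norm_sign_mul ger0_norm // ltW.
have [d d0 H] := scontB (fam_cv F a b2) (fam_cv F a b1) RR gap.
pose m := Num.min d (Rr - y) / 2.
have m0 : 0 < m by rewrite divr_gt0 // lt_min d0 subr_gt0.
have [md mR] : m < d /\ m < Rr - y.
  have m1 : Num.min d (Rr - y) <= d by rewrite ge_min lexx.
  have m2 : Num.min d (Rr - y) <= Rr - y by rewrite ge_min lexx orbT.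
  by move: m0; rewrite /m; split; lra.
pose z := Rr - m; have zR : `|z| < Rr by apply: absR; rewrite /z; lra.
have szR : `|s * z| < Rr by rewrite norm_sign_mul.
have := vanish z ltac:(apply/andP; rewrite /z; split; lra).
apply/negP; rewrite -ltNge.
have cm b : continuous (fun x => v a b (x, s * z) * quartic t (x - c)).
  apply: ctsP => x; apply: ctsM; last exact: cts_quartic.
  exact: (scont_slice (fam_cv F a b) (ltW szR)).
rewrite /dmom /mom -intB; [|exact: cm|exact: cm].
apply: (int_gt0 (x := c)).
- by apply: ctsP => x; apply: ctsB; exact: cm.
- move=> x _; rewrite -mulrBl; apply: mulr_ge0; last exact: sqr_ge0.
  by rewrite subr_ge0; exact: fam_mono.
- by have h := t0; apply/andP; split; lra.
rewrite -mulrBl; apply: mulr_gt0; last first.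
  by rewrite /quartic subrr expr0n /= subr0 !exprn_gt0.
have := H (c, s * z) (ltW szR); rewrite /= subrr normr0 => /(_ d0).
have -> : s * z - s * Rr = s * - m by rewrite /z; ring.
by rewrite norm_sign_mul normrN gtr0_norm // => /(_ md) /ltr_normlP [h _]; lra.
Qed.

End FixedWindow.

Lemma fam_strict a b b' x y : b < b' -> `|y| < Rr -> v a b (x, y) < v a b' (x, y).
Proof.
move=> bb yR; rewrite lt_neqAle fam_mono // andbT; apply/eqP => E.
(* The outer thirds leave room for translations: for [z] near [x], [v b2 (z, y) <= v b' (x, y) = v b
   (x, y) <= v b1 (z, y)]. So equality at one point forces [v b1 = v b2] on a segment. *)
pose b1 := b + (b' - b) / 3; pose b2 := b + 2 * (b' - b) / 3.
have [h1 h2 h3] : [/\ b < b1, b1 < b2 & b2 < b'] by rewrite /b1 /b2; split; lra.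
have [t1 t10 H1] := fam_shift a h1; have [t2 t20 H2] := fam_shift a h3.
pose t := Num.min t1 t2; have t0 : 0 < t by rewrite lt_min t10.
have [tt1 tt2] : t <= t1 /\ t <= t2 by split; rewrite ge_min lexx ?orbT.
pose s : R := if 0 <= y then 1 else -1.
have s1 : `|s| = 1 by rewrite /s; case: ifP; rewrite ?normrN normr1.
have sy : s * `|y| = y.
  rewrite /s; case: (leP 0 y) => hy; first by rewrite mul1r ger0_norm.
  by rewrite mulN1r ltr0_norm // opprK.
have := dmom_pos x t0 s1 a h2 (_ : 0 <= `|y| < Rr); rewrite normr_ge0 yR => /(_ isT).
suff -> : dmom t x s b1 b2 a `|y| = 0 by rewrite ltxx.
have tt : x - t <= x + t by lra.
have cm c : continuous (fun z => v a c (z, y) * quartic t (z - x)).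
  apply: ctsP => z; apply: ctsM; last exact: cts_quartic.
  exact: (scont_slice (fam_cv F a c) (ltW yR)).
apply/eqP; rewrite /dmom sy subr_eq0; apply/eqP; apply: eq_int_itv => // z /andP[z1 z2].
congr (_ * _).
have zt : `|x - z| <= t by apply/ler_normlP; split; lra.
have zt' : `|z - x| <= t by rewrite distrC.
have l1 := H1 (x - z) z y (le_trans zt tt1) yR; rewrite [z + _]addrC subrK in l1.
have l2 := H2 (z - x) x y (le_trans zt' tt2) yR; rewrite [x + _]addrC subrK in l2.
have l3 := fam_mono a z h2 yR.
by apply/eqP; rewrite eq_le l3 andbT (le_trans l2) // -E.
Qed.

End StrictMonotonicity.

(** * The fibration *)

Section Fibration.
Context {R : realType}.
Implicit Types (x y z t e d r k s m K M A B C : R) (f g U V : R * R -> R) (a b : R).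

(** As in Dini's theorem, monotonicity in [b] and compactness of a period make the pointwise
    statement uniform. *)
Lemma unbounded_line (g : R -> R -> R) (P : R) : 0 < P -> (forall b, continuous (g b)) ->
  (forall b x, g b (x + P) = g b x) -> (forall b b' x, b < b' -> g b x < g b' x) ->
  forall K, (forall x, exists b, K < g b x) -> exists B, forall b x, B < b -> K < g b x.
Proof.
move=> P0 cg gP mono K ub.
have /compact_near_coveringP/(_ R (pinfty_nbhs R) (fun b x => K < g b x)) := @segment_compact R 0 P.
move=> /(_ _ _) [|B [_ H]]; last first.
  exists B => b x Bb; have [x0 x0P <-] := periodic_reduce P0 (gP b) x.
  by apply: (H b Bb); rewrite /= in_itv.
move=> x _; have [b hb] := ub x.
have k0 : 0 < g b x - K by rewrite subr_gt0.
have [d d0 H] := (continuous_atP _ _).1 (cg b x) _ k0.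
exists (ball x d, [set b' | b < b']).
  split; first exact: nbhsx_ballx.
  by exists b; rewrite num_real.
move=> [x' b'] [/= h1 h2]; apply: lt_trans (mono b b' x' h2).
by have := H x'; rewrite distrC => /(_ h1) /ltr_normlP [? ?]; lra.
Qed.

Variables (Rr P : R) (phip phim : R -> R -> R -> R) (u v : R -> R -> R * R -> R).
Hypothesis F : sol_family Rr P phip phim u v.

Let R0 := fam_R0 F.
Let P0 := fam_P0 F.

Lemma fam_unbounded_above a K x y : `|y| < Rr -> exists b, K < v a b (x, y).
Proof.
move=> yR.
(* Of the excess 2, one unit pays for moving the boundary data to a nearby [a' != 0], where
   constants are barriers, and one for returning from [v a'] to [v a]. *)
have [B1 H1] := unbounded_line P0 (fun b => @continuous_phip _ _ _ _ _ _ _ F a b)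
  (phip_periodic F a) (fun b b' x bb => (fam_lt F a x bb).1)
  (K := K + 2) (fun x => let: ex_intro b h := fam_ub F a x (K + 2) in ex_intro _ b h.1).
have [B2 H2] := unbounded_line P0 (fun b => @continuous_phim _ _ _ _ _ _ _ F a b)
  (phim_periodic F a) (fun b b' x bb => (fam_lt F a x bb).2)
  (K := K + 2) (fun x => let: ex_intro b h := fam_ub F a x (K + 2) in ex_intro _ b h.2).
pose b := Num.max B1 B2 + 1; exists b.
have [b1 b2] : B1 < b /\ B2 < b.
  have m1 : B1 <= Num.max B1 B2 by rewrite le_max lexx.
  have m2 : B2 <= Num.max B1 B2 by rewrite le_max lexx orbT.
  by rewrite /b; split; lra.
have [d1 d10 h1] := fam_phi F a b ltr01; have [d2 d20 h2] := fam_v_joint F a b x yR ltr01.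
have [a'] : exists2 a', `|a' - a| < Num.min d1 d2 & a' != 0.
  by apply: exists_near_neq0; rewrite !lt_min d10.
rewrite lt_min => /andP[a1 a2] an0.
have h3 : K + 1 <= v a' b (x, y).
  apply: (fam_ge_cst F an0) => [z|z|]; last exact: ltW.
    have [/ler_normlP [? ?] _] := h1 a' b a1 ltac:(by rewrite subrr normr0) z.
    by have := H1 b z b1; lra.
  have [_ /ler_normlP [? ?]] := h1 a' b a1 ltac:(by rewrite subrr normr0) z.
  by have := H2 b z b2; lra.
have := h2 a' b x y a2; rewrite !subrr normr0 => /(_ d20 d20 d20) /ltr_normlP [? ?].
lra.
Qed.

Lemma fam_unbounded_below a K x y : `|y| < Rr -> exists b, v a b (x, y) < K.
Proof.
move=> yR.
have [B1 H1] : exists B, forall b x, B < b -> - K + 2 < - phip a (- b) x.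
  apply: (@unbounded_line (fun b x => - phip a (- b) x) P P0).
  - by move=> b; apply: ctsP => z; apply: ctsN; exact: (continuous_phip F).
  - by move=> b z; rewrite (phip_periodic F).
  - by move=> b b' z bb; rewrite ltrN2; apply: (fam_lt F _ _ _).1; rewrite ltrN2.
  - by move=> z; have [b [h _]] := fam_lb F a z (K - 2); exists (- b); rewrite opprK; lra.
have [B2 H2] : exists B, forall b x, B < b -> - K + 2 < - phim a (- b) x.
  apply: (@unbounded_line (fun b x => - phim a (- b) x) P P0).
  - by move=> b; apply: ctsP => z; apply: ctsN; exact: (continuous_phim F).
  - by move=> b z; rewrite (phim_periodic F).
  - by move=> b b' z bb; rewrite ltrN2; apply: (fam_lt F _ _ _).2; rewrite ltrN2.
  - by move=> z; have [b [_ h]] := fam_lb F a z (K - 2); exists (- b); rewrite opprK; lra.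
pose b := Num.max B1 B2 + 1; exists (- b).
have [b1 b2] : B1 < b /\ B2 < b.
  have m1 : B1 <= Num.max B1 B2 by rewrite le_max lexx.
  have m2 : B2 <= Num.max B1 B2 by rewrite le_max lexx orbT.
  by rewrite /b; split; lra.
have [d1 d10 h1] := fam_phi F a (- b) ltr01; have [d2 d20 h2] := fam_v_joint F a (- b) x yR ltr01.
have [a'] : exists2 a', `|a' - a| < Num.min d1 d2 & a' != 0.
  by apply: exists_near_neq0; rewrite !lt_min d10.
rewrite lt_min => /andP[a1 a2] an0.
have h3 : v a' (- b) (x, y) <= K - 1.
  apply: (fam_le_cst F an0) => [z|z|]; last exact: ltW.
    have [/ler_normlP [? ?] _] := h1 a' (- b) a1 ltac:(by rewrite subrr normr0) z.
    by have := H1 b z b1; lra.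
  have [_ /ler_normlP [? ?]] := h1 a' (- b) a1 ltac:(by rewrite subrr normr0) z.
  by have := H2 b z b2; lra.
have := h2 a' (- b) x y a2; rewrite !subrr normr0 => /(_ d20 d20 d20) /ltr_normlP [? ?].
lra.
Qed.

Lemma fam_lt_inv a b b' x y : `|y| < Rr -> v a b (x, y) < v a b' (x, y) -> b < b'.
Proof.
move=> yR; case: (ltgtP b b') => // [bb|->]; last by rewrite ltxx.
by move=> h; have := lt_trans h (fam_strict F a x bb yR); rewrite ltxx.
Qed.

Lemma fam_inj a b b' x y : `|y| < Rr -> v a b (x, y) = v a b' (x, y) -> b = b'.
Proof.
move=> yR E; case: (ltgtP b b') => // bb; have := fam_strict F a x bb yR; by rewrite E ltxx.
Qed.

Lemma fam_surj a x y K : `|y| < Rr -> exists b, v a b (x, y) = K.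
Proof.
move=> yR; have [b1 h1] := fam_unbounded_below a K x yR; have [b2 h2] := fam_unbounded_above a K x yR.
have bb : b1 <= b2 by apply: ltW; exact: fam_lt_inv yR (lt_trans h1 h2).
have cv : {within `[b1, b2], continuous (fun b => v a b (x, y))}.
  apply: continuous_itv => b _; apply/continuous_atP => e e0.
  have [d d0 H] := fam_v_joint F a b x yR e0.
  by exists d => // b' h; apply: H; rewrite ?subrr ?normr0.
have [|b _ <-] := IVT bb cv (v := K); last by exists b.
by rewrite ge_min (ltW h1) le_max (ltW h2) orbT.
Qed.

(** The default 0 is never taken for [|y| < Rr], where such a [b] exists and is unique. *)
Definition level a x y K := xget 0 [set b | v a b (x, y) = K].

Lemma levelP a x y K : `|y| < Rr -> v a (level a x y K) (x, y) = K.
Proof. by move=> yR; exact: (xgetPex 0 (fam_surj a x K yR)). Qed.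

Lemma level_eq a b x y : `|y| < Rr -> level a x y (v a b (x, y)) = b.
Proof. by move=> yR; apply: (fam_inj yR); exact: levelP. Qed.

Lemma level_near a0 x0 y0 K0 e : `|y0| < Rr -> 0 < e -> exists2 d : R, 0 < d & forall a x y K,
  `|a - a0| < d -> `|x - x0| < d -> `|y - y0| < d -> `|K - K0| < d ->
  `|level a x y K - level a0 x0 y0 K0| < e.
Proof.
move=> yR e0; set b0 := level a0 x0 y0 K0; have E := levelP a0 x0 K0 yR; rewrite -/b0 in E.
have [l1 l2] : b0 - e < b0 /\ b0 < b0 + e by split; lra.
have := fam_strict F a0 x0 l1 yR; have := fam_strict F a0 x0 l2 yR; rewrite E => s2 s1.
pose k := Num.min (K0 - v a0 (b0 - e) (x0, y0)) (v a0 (b0 + e) (x0, y0) - K0) / 2.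
have k0 : 0 < k by rewrite divr_gt0 // lt_min !subr_gt0 s1.
have [k1 k2] : 2 * k <= K0 - v a0 (b0 - e) (x0, y0) /\ 2 * k <= v a0 (b0 + e) (x0, y0) - K0.
  by rewrite /k mulrC divfK //; split; rewrite ge_min lexx ?orbT.
clearbody k.
have [d1 d10 H1] := fam_v_joint F a0 (b0 - e) x0 yR k0.
have [d2 d20 H2] := fam_v_joint F a0 (b0 + e) x0 yR k0.
exists (Num.min (Num.min d1 d2) (Num.min k (Rr - `|y0|))).
  by rewrite !lt_min d10 d20 k0 subr_gt0.
move=> a x y K; rewrite !lt_min => /andP[/andP[a1 a2] _] /andP[/andP[x1 x2] _].
move=> /andP[/andP[y1 y2] /andP[_ y3]] /andP[_ /andP[/ltr_normlP [K1 K2] _]].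
have yR' : `|y| < Rr by have := ler_normD (y - y0) y0; rewrite subrK; lra.
have E' := levelP a x K yR'; set b := level a x y K in E' *.
have z0 : `|b0 - e - (b0 - e)| < d1 by rewrite subrr normr0.
have z1 : `|b0 + e - (b0 + e)| < d2 by rewrite subrr normr0.
have /ltr_normlP [g1 g2] := H1 a (b0 - e) x y a1 z0 x1 y1.
have /ltr_normlP [g3 g4] := H2 a (b0 + e) x y a2 z1 x2 y2.
have c1 : b0 - e < b by apply: (fam_lt_inv (a := a) (x := x) yR'); rewrite E'; lra.
have c2 : b < b0 + e by apply: (fam_lt_inv (a := a) (x := x) yR'); rewrite E'; lra.
by apply/ltr_normlP; split; lra.
Qed.

Section Continuity.
Context {T : topologicalType}.
Implicit Type p : T.

Lemma cts_fst (A B : topologicalType) (f : T -> A * B) p :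
  {for p, continuous f} -> {for p, continuous (fun w => (f w).1)}.
Proof. by move=> cf; apply: (continuous_comp cf); exact: cvg_fst. Qed.

Lemma cts_snd (A B : topologicalType) (f : T -> A * B) p :
  {for p, continuous f} -> {for p, continuous (fun w => (f w).2)}.
Proof. by move=> cf; apply: (continuous_comp cf); exact: cvg_snd. Qed.

Lemma cts_pair (A B : topologicalType) (f : T -> A) (g : T -> B) p :
  {for p, continuous f} -> {for p, continuous g} -> {for p, continuous (fun w => (f w, g w))}.
Proof. by move=> cf cg; exact: cvg_pair. Qed.

Lemma cts_level (a x y K : T -> R) p : {for p, continuous a} -> {for p, continuous x} ->
  {for p, continuous y} -> {for p, continuous K} -> `|y p| < Rr ->
  {for p, continuous (fun w => level (a w) (x w) (y w) (K w))}.
Proof.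
move=> ca cx cy cK yR; apply/cvgrPdist_lt => e e0.
have [d d0 H] := level_near (a p) (x p) (K p) yR e0.
near=> w; rewrite distrC; apply: H.
- by rewrite distrC; near: w; exact: (cvgrPdist_lt _ _).1 ca d d0.
- by rewrite distrC; near: w; exact: (cvgrPdist_lt _ _).1 cx d d0.
- by rewrite distrC; near: w; exact: (cvgrPdist_lt _ _).1 cy d d0.
- by rewrite distrC; near: w; exact: (cvgrPdist_lt _ _).1 cK d d0.
Unshelve. all: by end_near. Qed.

Lemma cts_u (a b x y : T -> R) p : {for p, continuous a} -> {for p, continuous b} ->
  {for p, continuous x} -> {for p, continuous y} -> `|y p| < Rr ->
  {for p, continuous (fun w => u (a w) (b w) (x w, y w))}.
Proof.
move=> ca cb cx cy yR; apply/cvgrPdist_lt => e e0.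
have [d d0 H] := fam_u_joint F (a p) (b p) (x p) yR e0.
near=> w; rewrite distrC; apply: H.
- by rewrite distrC; near: w; exact: (cvgrPdist_lt _ _).1 ca d d0.
- by rewrite distrC; near: w; exact: (cvgrPdist_lt _ _).1 cb d d0.
- by rewrite distrC; near: w; exact: (cvgrPdist_lt _ _).1 cx d d0.
- by rewrite distrC; near: w; exact: (cvgrPdist_lt _ _).1 cy d d0.
Unshelve. all: by end_near. Qed.

End Continuity.

Definition fib_a (z : C3 R) := (cnorm2 z.1.1 - cnorm2 z.1.2) / 2.
Definition fib_b (z : C3 R) := level (fib_a z) z.2.1 (cmul z.1.1 z.1.2).2 (cmul z.1.1 z.1.2).1.
Definition fib_c (z : C3 R) := z.2.2 - u (fib_a z) (fib_b z) (z.2.1, (cmul z.1.1 z.1.2).2).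
Definition fib (z : C3 R) := (fib_a z, fib_b z, fib_c z).

Lemma fib_fibre a b c : Vset Rr `&` fib @^-1` [set (a, b, c)] = Nset Rr (u a b) (v a b) a c.
Proof.
apply/seteqP; split=> z.
  move=> [Vz]; rewrite /preimage /= /fib => -[Ea Eb Ec].
  split; first by rewrite -Ea /fib_a; field.
  exists z.2.1, (cmul z.1.1 z.1.2).2; split; first by rewrite -ltr_norml.
  split.
    have := levelP (fib_a z) z.2.1 (cmul z.1.1 z.1.2).1 Vz.
    by rewrite -/(fib_b z) Eb Ea => ->; case: (cmul _ _).
  by rewrite -Ec /fib_c Ea Eb addrC subrK; case: (z.2).
move=> [Na [x [y [yR [Nb Nc]]]]].
have yR' : `|y| < Rr by rewrite ltr_norml.
have Ea : fib_a z = a by rewrite /fib_a Na; field.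
have Eb : fib_b z = b by rewrite /fib_b Ea Nb Nc /=; exact: level_eq.
have Vz : `|(cmul z.1.1 z.1.2).2| < Rr by rewrite Nb.
split; first exact: Vz.
by rewrite /preimage /= /fib /fib_c Eb Ea Nb Nc /= addrAC subrr add0r.
Qed.

Lemma fib_shift (z : C3 R) (n : int) : Vset Rr z -> fib (zshift P n z) = fib z.
Proof.
move=> Vz; have uS a b x : u a b (x + n%:~R * P, (cmul z.1.1 z.1.2).2) = u a b (x, (cmul z.1.1 z.1.2).2).
  apply: (@periodic_int_shift _ _ (fun x => u a b (x, (cmul z.1.1 z.1.2).2))) => w.
  exact: (fam_uP F a b (p := (w, (cmul z.1.1 z.1.2).2)) (ltW Vz)).
have vS a b x : v a b (x + n%:~R * P, (cmul z.1.1 z.1.2).2) = v a b (x, (cmul z.1.1 z.1.2).2).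
  apply: (@periodic_int_shift _ _ (fun x => v a b (x, (cmul z.1.1 z.1.2).2))) => w.
  exact: (fam_vP F a b (p := (w, (cmul z.1.1 z.1.2).2)) (ltW Vz)).
have Eb : fib_b (zshift P n z) = fib_b z.
  by rewrite /fib_b /level /=; congr xget; apply/funext => b /=; rewrite vS.
by rewrite /fib /fib_c Eb /= uS.
Qed.

Lemma fib_continuous : {within Vset Rr, continuous fib}.
Proof.
apply: continuous_in_subspaceT => z; rewrite inE => Vz.
have c0 : {for z, continuous (fun w : C3 R => w)} by exact: cvg_id.
have c11 := cts_fst (cts_fst c0); have c12 := cts_snd (cts_fst c0).
have cn (f : C3 R -> R * R) : {for z, continuous f} -> {for z, continuous (fun w => cnorm2 (f w))}.
  by move=> cf; apply: ctsD; apply: ctsX; [exact: cts_fst|exact: cts_snd].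
have ca : {for z, continuous fib_a}.
  by apply: ctsM; [apply: ctsB; exact: cn|exact: cts_cst].
have cw1 : {for z, continuous (fun w : C3 R => (cmul w.1.1 w.1.2).1)}.
  by apply: ctsB; apply: ctsM; (exact: cts_fst || exact: cts_snd).
have cw2 : {for z, continuous (fun w : C3 R => (cmul w.1.1 w.1.2).2)}.
  by apply: ctsD; apply: ctsM; (exact: cts_fst || exact: cts_snd).
have cx := cts_fst (cts_snd c0).
have cb : {for z, continuous fib_b} by exact: cts_level.
apply: cts_pair; first exact: cts_pair.
by apply: ctsB; [exact: cts_snd (cts_snd c0)|exact: cts_u].
Qed.

Lemma fib_surj (t : R * R * R) : exists z : C3 R, Vset Rr z /\ fib z = t.
Proof.
(* A point over [x = y = 0] with real [z1 = p], [z2 = q]: the conditions [p ^+ 2 - q ^+ 2 = 2 * a]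
   and [p * q = w] are met by [p ^+ 2 = r + a], [q ^+ 2 = r - a], with [q] carrying the sign of
   [w]. *)
case: t => [[a b] c]; pose w := v a b (0, 0); pose r := Num.sqrt (a ^+ 2 + w ^+ 2).
have r0 : 0 <= a ^+ 2 + w ^+ 2 by rewrite addr_ge0 ?sqr_ge0.
have ar : `|a| <= r.
  by rewrite -sqrtr_sqr; apply: ler_wsqrtr; rewrite lerDl sqr_ge0.
have /ler_normlP [ar1 ar2] := ar.
pose s : R := if 0 <= w then 1 else -1.
have sw : s * `|w| = w.
  rewrite /s; case: (leP 0 w) => hw; first by rewrite mul1r ger0_norm.
  by rewrite mulN1r ltr0_norm // opprK.
have ss : s ^+ 2 = 1 by rewrite /s; case: ifP; rewrite ?sqrrN expr1n.
pose p := Num.sqrt (r + a); pose q := s * Num.sqrt (r - a).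
have pp : p ^+ 2 = r + a by rewrite sqr_sqrtr //; lra.
have qq : q ^+ 2 = r - a by rewrite exprMn ss mul1r sqr_sqrtr //; lra.
have pq : p * q = w.
  rewrite /p /q mulrCA -sqrtrM; last by lra.
  have -> : (r + a) * (r - a) = w ^+ 2.
    have := sqr_sqrtr r0; rewrite -/r => h.
    by rewrite (_ : (r + a) * (r - a) = r ^+ 2 - a ^+ 2); [rewrite h; ring|ring].
  by rewrite sqrtr_sqr.
pose z : C3 R := ((p, 0), (q, 0), (0, c)).
have zN : Nset Rr (u a b) (v a b) a c z.
  split; first by rewrite /cnorm2 /= expr0n /= !addr0 pp qq; ring.
  exists 0, 0; split; first by rewrite oppr_lt0 R0.
  by rewrite /cmul /= !mulr0 mul0r subr0 addr0 pq (fam_u0 F) add0r.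
by move: zN; rewrite -fib_fibre => -[Vz Fz]; exists z.
Qed.

End Fibration.

(** * From the given data to an abstract family of solutions *)

Section FromHypotheses.
Context {R : realType}.
Implicit Types (Rr P al a b : R) (f : R -> R) (u v : R * R -> R).

Lemma holder_norm_sup al f e x : holder_norm_le al f e -> `|f x| <= e.
Proof.
move=> [M [HM [H4 sM]]].
have M0 j : (j <= 3)%N -> 0 <= M j by move=> j3; exact: le_trans (HM j j3 0).
have M4 : 0 <= M 4%N.
  (* The Hoelder bound between two points at distance 1 shows [M 4] nonnegative, so that [M 0] is at
     most the whole sum. *)
  have := H4 1 0 (oner_neq0 R); rewrite subr0 normr1 powR1 mulr1.
  exact: le_trans.
have fM : `|f x| <= M 0%N by have := HM 0%N isT x; rewrite derive1n0.
apply: le_trans fM (le_trans _ sM); rewrite !big_ord_recl big_ord0 /= addr0 lerDl.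
by rewrite !addr_ge0 // M0.
Qed.

Lemma assoc_sol_regular Rr P al a phip phim u v : assoc_sol Rr P al a phip phim u v -> a != 0 ->
  exists (D : derivs) (C : R), is_sol Rr a u v D /\ forall p, ostrip Rr p -> `|dvx D p| <= C.
Proof.
move=> [_ [_ [_ [h _]]]] /h [[cu _] [[cv [bv _]] hs]].
have [C HC] := bv [:: false] isT.
exists (pderivs u v), C; split; last exact: HC.
by apply: is_sol_of_Ck => //; [exact: Ck_le cu|exact: Ck_le cv].
Qed.

Lemma assoc_sol_scont Rr P al a phip phim u v : assoc_sol Rr P al a phip phim u v ->
  scont Rr u /\ scont Rr v.
Proof.
move=> [_ [_ [_ [h h0]]]]; have [/h0 [cu [cv _]]|an0] := eqVneq a 0.
  by split; exact: within_scont.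
have [[[cu _] _] [[[cv _] _] _]] := h an0.
by split; exact: within_scont.
Qed.

Lemma assoc_sol_limit Rr P al phip phim u v e : assoc_sol Rr P al 0 phip phim u v -> 0 < e ->
  exists2 d, 0 < d & forall s, 0 < s < d -> exists U V D,
    [/\ is_sol Rr s U V D, (forall p, strip Rr p -> `|U p - u p| <= e) &
      forall p, strip Rr p -> `|V p - v p| <= e].
Proof.
move=> [_ [_ [_ [_ /(_ erefl) [_ [_ [_ [_ [U [V [HUV lim]]]]]]]]]]] e0.
have [d [d0 H]] := lim e e0; exists d => // s /andP[s0 sd].
have [cU [cV hs]] := HUV s s0; exists (U s), (V s), (pderivs (U s) (V s)).
by split; [exact: is_sol_of_Ck|move=> p sp; have [] := H s s0 sd p sp|move=> p sp; have [] := H s s0 sd p sp].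
Qed.

End FromHypotheses.

Theorem theorem7p5 (R : realType) (Rr P al : R)
  (phip phim : R -> R -> R -> R) (u v : R -> R -> R * R -> R) :
  0 < Rr -> 0 < P -> 0 < al < 1 ->
  (* phi^pm_{a,b} in C^{3,al}(R) *)
  (forall a b, C3a_line al (phip a b) /\ C3a_line al (phim a b)) ->
  (* (i) continuous dependence in C^{3,al} *)
  (forall a b e, 0 < e -> exists d, 0 < d /\ forall a' b',
     `|a' - a| < d -> `|b' - b| < d ->
     holder_norm_le al (fun x => phip a' b' x - phip a b x) e /\
     holder_norm_le al (fun x => phim a' b' x - phim a b x) e) ->
  (* (ii) periodicity *)
  (forall a b x, phip a b (x + P) = phip a b x /\ phim a b (x + P) = phim a b x) ->
  (* (iii) equal integrals *)
  (forall a b, (\int[lebesgue_measure]_(x in `[0%R, P]) (phip a b x)%:E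
                = \int[lebesgue_measure]_(x in `[0%R, P]) (phim a b x)%:E)%E) ->
  (* (iv) strict monotonicity in b *)
  (forall a b b' x, b < b' -> phip a b x < phip a b' x /\ phim a b x < phim a b' x) ->
  (* (v) limits as b -> +-oo *)
  (forall a x,
     phip a b x @[b --> +oo] --> +oo /\ phip a b x @[b --> -oo] --> -oo /\
     phim a b x @[b --> +oo] --> +oo /\ phim a b x @[b --> -oo] --> -oo) ->
  (* (u_{a,b}, v_{a,b}) is the solution associated to phi^pm_{a,b} *)
  (forall a b, assoc_sol Rr P al a (phip a b) (phim a b) (u a b) (v a b)) ->
  (forall a b c a' b' c', (a, b, c) <> (a', b', c') ->
     Nset Rr (u a b) (v a b) a c `&` Nset Rr (u a' b') (v a' b') a' c' = set0) /\
  exists F : C3 R -> R * R * R,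
    (forall z (n : int), Vset Rr z -> F (zshift P n z) = F z) /\
    {within Vset Rr, continuous F} /\
    (forall t, exists z, Vset Rr z /\ F z = t) /\
    (forall a b c, Vset Rr `&` F @^-1` [set (a, b, c)] = Nset Rr (u a b) (v a b) a c).
Proof.
move=> R0 P0 _ _ cphi _ _ mono lims sol.
have F : sol_family Rr P phip phim u v.
  split=> //.
  - by move=> a b; exact: assoc_sol_regular (sol a b).
  - by move=> b e; exact: assoc_sol_limit (sol 0 b).
  - by move=> a b; have [] := assoc_sol_scont (sol a b).
  - by move=> a b; have [] := assoc_sol_scont (sol a b).
  - by move=> a b p sp; have [h _] := sol a b; have [] := h p sp.
  - by move=> a b p sp; have [h _] := sol a b; have [] := h p sp.
  - by move=> a b; have [_ [h _]] := sol a b.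
  - by move=> a b x; have [_ [_ [h _]]] := sol a b; have [] := h x.
  - by move=> a b x; have [_ [_ [h _]]] := sol a b; have [] := h x.
  - move=> a b e e0; have [d [d0 H]] := cphi a b e e0; exists d => // a' b' h1 h2 x.
    have [hp hm] := H a' b' h1 h2.
    by split; [exact: (holder_norm_sup x hp)|exact: (holder_norm_sup x hm)].
  - move=> a x K; have [/cvgryPgt h1 [_ [/cvgryPgt h2 _]]] := lims a x.
    near (pinfty_nbhs R) => b; exists b.
    by split; near: b; [exact: h1|exact: h2].
  - move=> a x K; have [_ [/cvgrNyPlt h1 [_ /cvgrNyPlt h2]]] := lims a x.
    near (ninfty_nbhs R) => b; exists b.
    by split; near: b; [exact: h1|exact: h2].
split.
  move=> a b c a' b' c' neq; rewrite -!(fib_fibre F) -subset0 => z [[_ /= e1] [_ /= e2]].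
  by apply: neq; rewrite -e1 -e2.
exists (fib u v); split; first by move=> z n; exact: (fib_shift F).
split; first exact: (fib_continuous F).
by split; [exact: (fib_surj F)|exact: (fib_fibre F)].
Unshelve. all: by end_near. Qed.
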